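(* Let $(\mathcal M,\tau)$ be a tracial von Neumann algebra. Let $\mathbf X=(X_1,\dots,X_m)$ be an $m$-tuple and $\mathbf Y=(Y_1,Y_2,\dots)$ an infinite tuple of self-adjoint elements of $\mathcal M$, and let $\mathbf R=(R_1,\dots,R_m;R_1',R_2',\dots)$ be positive numbers with $\|X_j\|_{\mathrm{op}}\le R_j$ for $1\le j\le m$ and $\|Y_j\|_{\mathrm{op}}\le R_j'$ for $j\in\mathbb N$. Let $\mathcal B=\mathrm W^*(\mathbf Y)$. Then $$\overline\chi(\mathbf X\mid\mathbf Y)=\overline\chi_{\mathbf R}(\mathbf X\mid\mathbf Y)=\sup_{\mathcal U}\chi^{\mathcal U}(\mathbf X\mid\mathcal B)=\sup_{\mathcal U}\ \sup_{\iota:\mathcal B\to\mathbb M_{\mathcal U}}\chi^{\mathcal U}(\mathbf X\mid\mathcal B,\iota),$$ where $\sup_{\mathcal U}$ is the supremum over all non-principal ultrafilters on $\mathbb N$.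
   Context: A tracial von Neumann algebra $(\mathcal M,\tau)$ is a von Neumann algebra with a faithful normal tracial state. $\mathrm W^*(\mathbf Y)$ is the von Neumann subalgebra generated by $\mathbf Y$. $\operatorname{tr}_n$ is the normalized trace on $M_n(\mathbb C)$. Laws. For an index set $I$, $\Sigma_I$ is the set of unital positive tracial linear functionals $\lambda$ on the $*$-algebra $\mathbb C\langle x_i:i\in I\rangle$ of non-commutative polynomials in self-adjoint variables for which there are $R_i>0$ with $|\lambda(x_{i_1}\cdots x_{i_\ell})|\le R_{i_1}\cdots R_{i_\ell}$ for all words; it carries the topology of pointwise convergence on polynomials. The law of a self-adjoint tuple $\mathbf X$ is $p\mapsto\tau(p(\mathbf X))$ (for matrices $\tau=\operatorname{tr}_n$). Lebesgue measure. $\nu_n$ is Lebesgue measure on $M_n(\mathbb C)_{\mathrm{sa}}^m$ for the real inner product $\langle\mathbf A,\mathbf B\rangle_{\operatorname{tr}_n}=\sum_j\operatorname{tr}_n(A_jB_j)$ (transported from $\mathbb R^{mn^2}$ by a linear isometry). Convention $\log0=-\infty$; suprema over empty sets of measures are $0$ and of entropies are $-\infty$. Shlyakhtenko's conditional entropy. For a neighborhood $\mathcal O$ of $\mathrm{law}(\mathbf X,\mathbf Y)$, let $\pi_2(\mathcal O)$ be the set of restrictions to $\mathbb C\langle\mathbf y\rangle$ of laws $\lambda\in\mathcal O$ on $\mathbb C\langle\mathbf x,\mathbf y\rangle$, and $\Gamma^{(n)}_{\mathbf R}(\pi_2(\mathcal O))$ the set of $\mathbf Z\in M_n(\mathbb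 C)_{\mathrm{sa}}^{\mathbb N}$ with $\|Z_j\|_{\mathrm{op}}\le R_j'$ for all $j$ and $\mathrm{law}(\mathbf Z)\in\pi_2(\mathcal O)$. Then $$\overline\chi_{\mathbf R}(\mathbf X\mid\mathbf Y)=\inf_{\mathcal O}\limsup_{n\to\infty}\Big[\tfrac1{n^2}\log\sup_{\mathbf Z\in\Gamma^{(n)}_{\mathbf R}(\pi_2(\mathcal O))}\nu_n\{\mathbf A\in M_n(\mathbb C)_{\mathrm{sa}}^m:\|A_j\|_{\mathrm{op}}\le R_j\ \forall j,\ \mathrm{law}(\mathbf A,\mathbf Z)\in\mathcal O\}+m\log n\Big],$$ where the infimum is over neighborhoods $\mathcal O$ of $\mathrm{law}(\mathbf X,\mathbf Y)$, and $\overline\chi(\mathbf X\mid\mathbf Y)$ is the supremum of $\overline\chi_{\mathbf R}(\mathbf X\mid\mathbf Y)$ over $\mathbf R$ (bounding the operator norms of $\mathbf X,\mathbf Y$). Entropy via embeddings. For a non-principal ultrafilter $\mathcal U$ on $\mathbb N$, $\mathbb M_{\mathcal U}=\prod_{\mathcal U}M_n(\mathbb C)$ is the tracial ultraproduct, and $\iota:\mathcal B\to\mathbb M_{\mathcal U}$ ranges over trace-preserving unital $*$-homomorphisms. Given $\iota$, choose $\mathbf Y^{(n)}\in M_n(\mathbb C)_{\mathrm{sa}}^{\mathbb N}$ with $\sup_n\|Y_j^{(n)}\|_{\mathrm{op}}<\infty$ and $\iota(Y_j)=[Y_j^{(n)}]_{\mathcal U}$ for each $j$, and put $$\chi^{\mathcal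 U}(\mathbf X\mid\mathcal B,\iota)=\sup_{\mathbf Q\in(0,\infty)^m}\inf_{\mathcal O}\lim_{n\to\mathcal U}\Big[\tfrac1{n^2}\log\nu_n\{\mathbf A\in M_n(\mathbb C)_{\mathrm{sa}}^m:\|A_j\|_{\mathrm{op}}\le Q_j\ \forall j,\ \mathrm{law}(\mathbf A,\mathbf Y^{(n)})\in\mathcal O\}+m\log n\Big],$$ infimum over neighborhoods $\mathcal O$ of $\mathrm{law}(\mathbf X,\mathbf Y)$; the value does not depend on the choice of generating tuple $\mathbf Y$ of $\mathcal B$ or of the lifts $\mathbf Y^{(n)}$. Then $\chi^{\mathcal U}(\mathbf X\mid\mathcal B)=\sup_\iota\chi^{\mathcal U}(\mathbf X\mid\mathcal B,\iota)$. *)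

(* Defs.v *)
From HB Require Import structures.
From mathcomp Require Import all_boot all_order all_algebra.
From mathcomp Require Import finmap complex monalg.
From mathcomp Require Import all_classical all_reals all_analysis.
From mathcomp Require Import measurable_realfun ring.

Set Implicit Arguments.
Unset Strict Implicit.
Unset Printing Implicit Defensive.
Import Order.TTheory GRing.Theory Num.Theory.
Import numFieldNormedType.Exports.
Local Open Scope classical_set_scope.
Local Open Scope ring_scope.

Section NCPolynomials.
Variables (R : realType) (I : choiceType).
Local Notation C := (R[i]).

Definition ncpoly := {malg C[{fmonom I}]}.

Definition ncword (w : seq I) : ncpoly := << FMonom w >>.

(* The conjugate-linear involution that reverses words and fixes variables. *)
Definition ncstar (p : ncpoly) : ncpoly :=
  \sum_(w <- msupp p) << (p@_w)^* *g FMonom (rev w) >>.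

Record is_law (l : ncpoly -> C) : Prop := {
  law_linear : scalar l;
  law_unital : l 1 = 1;
  law_positive : forall p, 0 <= l (ncstar p * p);
  law_tracial : forall p q, l (p * q) = l (q * p);
  law_bounded : exists r : I -> R, (forall i, 0 < r i) /\
    forall w : seq I, `|l (ncword w)| <= (\prod_(i <- w) r i)%:C%C }.

(* Open neighborhoods of l in Sigma_I, for the topology induced by pointwise
   convergence on polynomials. *)
Definition law_nbhd (l : ncpoly -> C) (O : set (ncpoly -> C)) : Prop :=
  O l /\ exists2 V : set {ptws ncpoly -> C^o}, open V & O = V `&` is_law.

End NCPolynomials.

(* Restriction to C<y> of a functional on C<x, y>. *)
Definition law_snd (R : realType) (I J : choiceType)
    (l : ncpoly R (I + J)%type -> R[i]) : ncpoly R J -> R[i] :=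
  fun p => l (\sum_(w <- msupp p) << p@_w *g FMonom (map inr w) >>).

Definition join (I J T : Type) (X : I -> T) (Y : J -> T) (k : I + J) : T :=
  match k with inl i => X i | inr j => Y j end.

Section Matrices.
Variable R : realType.
Local Notation C := (R[i]).

Definition adjmx n (A : 'M[C]_n) : 'M[C]_n := (map_mx Num.conj A)^T.

Definition samx n (A : 'M[C]_n) : Prop := adjmx A = A.

Definition ntr n (A : 'M[C]_n) : C := n%:R^-1 * \tr A.

(* The operator norm of A on the Hilbert space C^n is at most r. *)
Definition mx_opnorm_le n (A : 'M[C]_n) (r : R) : Prop :=
  0 <= r /\ forall v : 'cV[C]_n,
    sqrtC (\sum_i `|(A *m v) i 0| ^+ 2) <=
      r%:C%C * sqrtC (\sum_i `|v i 0| ^+ 2).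

Definition norm2 n (A : 'M[C]_n) : C := sqrtC (ntr (adjmx A *m A)).

Definition mx_law (I : choiceType) n (A : I -> 'M[C]_n) : ncpoly R I -> C :=
  fun p => ntr (\sum_(w <- msupp p)
    p@_w *: foldr (fun i B => A i *m B) 1%:M (w : seq I)).

End Matrices.

Section LebesgueMeasure.
Variable R : realType.
Local Notation C := (R[i]).

(* Lebesgue measure on R^k in product form, by integrating the measures of the
   slices along the first coordinate; meant for Borel sets. *)
Fixpoint lebesgue_tuple (k : nat) : set (k.-tuple R) -> \bar R :=
  match k with
  | 0 => fun S => \d_[tuple] S
  | k'.+1 => fun S =>
      (\int[@lebesgue_measure R]_x
         lebesgue_tuple [set v | S (cons_tuple (x : R) v)])%E
  end.

(* Coordinates in the orthonormal basis of M_n(C)_sa, for <A, B> = tr_n(AB),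
   formed by sqrt n E_ii and, for i < j, sqrt (n/2) (E_ij + E_ji) and
   sqrt (n/2) 'i (E_ij - E_ji). *)
Definition sa_of_coord n (a : 'I_n -> 'I_n -> R) : 'M[C]_n :=
  \matrix_(i, j)
    if i == j then (Num.sqrt n%:R * a i i)%:C%C
    else if (i < j)%N then
      (Num.sqrt (n%:R / 2))%:C%C * ((a i j) +i* (a j i))%C
    else (Num.sqrt (n%:R / 2))%:C%C * ((a j i) -i* (a i j))%C.

Definition tuple_of_coord m n (t : (m * (n * n)).-tuple R) :
    'I_m -> 'M[C]_n :=
  fun k => sa_of_coord
    (fun i j => tnth t (mxvec_index k (mxvec_index i j))).

Definition nu m n (S : set ('I_m -> 'M[C]_n)) : \bar R :=
  lebesgue_tuple (tuple_of_coord (m := m) (n := n) @^-1` S).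

Lemma lebesgue_tuple_box k (a b : 'I_k -> R) : (forall i, a i <= b i) ->
  lebesgue_tuple [set t | forall i, tnth t i \in `[a i, b i]] =
  (\prod_(i < k) (b i - a i))%:E.
Proof.
elim: k a b => [|k IHk] a b leab.
  by rewrite big_ord0 /= diracE mem_set//= => -[].
rewrite big_ord_recl /=.
pose B := [set t : k.-tuple R |
  forall i, tnth t i \in `[a (lift ord0 i), b (lift ord0 i)]].
have IH : lebesgue_tuple B = (\prod_(i < k) (b (lift ord0 i) - a (lift ord0 i)))%:E.
  exact: IHk.
have lt0 j : @lebesgue_tuple j set0 = 0%E.
  elim: j => [|j IHj] /=; first by rewrite dirac0.
  rewrite (_ : (fun x => _) = cst 0%E) ?integral0//.
  by apply/funext => x; rewrite -[RHS]IHj; congr lebesgue_tuple.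
rewrite (_ : (fun x => _) = (fun x => (\prod_(i < k) (b (lift ord0 i) - a (lift ord0 i)))%:E *
    (\1_(`[a ord0, b ord0]%classic : set R) x)%:E)%E); last first.
  apply/funext => x; rewrite indicE; case: (boolP (x \in `[a ord0, b ord0])) => xab.
    rewrite mem_set//= mule1 -IH; congr lebesgue_tuple; apply/seteqP; split => t /= tB.
      by move=> i; have := tB (lift ord0 i); rewrite tnthS.
    move=> i; case: (unliftP ord0 i) => [j|] ->; first by rewrite tnthS.
    by rewrite tnth0.
  rewrite memNset/=; last by move=> xin; move: xab; rewrite xin.
  rewrite mule0 -[RHS](lt0 k); congr lebesgue_tuple; apply/seteqP; split => t //= tB.
  by have := tB ord0; rewrite tnth0 (negPf xab).
rewrite ge0_integralZl//=; last 2 first.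
  exact/measurable_EFinP/measurable_indic.
  by rewrite lee_fin prodr_ge0// => i _; rewrite subr_ge0.
rewrite integral_indic//= setIT lebesgue_measure_itv/= lte_fin.
have := leab ord0; rewrite le_eqVlt => /orP[/eqP ->|->].
  by rewrite ltxx subrr mul0r mule0.
by rewrite -EFinB -EFinM mulrC.
Qed.

Lemma sa_of_coord_linear n (c : R) (a b : 'I_n -> 'I_n -> R) :
  sa_of_coord (fun i j => c * a i j + b i j) =
  c%:C%C *: sa_of_coord a + sa_of_coord b.
Proof.
apply/matrixP => i j; rewrite !mxE.
by case: ifP => _; [|case: ifP => _]; apply/eqP; rewrite eq_complex /=;
  apply/andP; split; apply/eqP; ring.
Qed.

Lemma sa_of_coord_sa n (a : 'I_n -> 'I_n -> R) : samx (sa_of_coord a).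
Proof.
apply/matrixP => i j; rewrite !mxE eq_sym.
have [->|nij] := eqVneq i j; first by apply/eqP; rewrite eq_complex /= oppr0 !eqxx.
rewrite -val_eqE /= in nij.
by case: ltngtP nij => // _ _; apply/eqP; rewrite eq_complex /=;
  apply/andP; split; apply/eqP; ring.
Qed.

Lemma sa_of_coord_isometry n (a b : 'I_n -> 'I_n -> R) :
  ntr (sa_of_coord a *m sa_of_coord b) = (\sum_i \sum_j a i j * b i j)%:C%C.
Proof.
have [n0|n_gt0] := posnP n.
  by subst n; rewrite /ntr !big_ord0 /mxtrace big_ord0 mulr0.
rewrite /ntr /mxtrace; under eq_bigr do rewrite mxE.
set A := sa_of_coord a; set B := sa_of_coord b.
have n0 : n%:R != 0 :> R by rewrite pnatr_eq0 -lt0n.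
have nC0 : n%:R != 0 :> C by rewrite pnatr_eq0 -lt0n.
apply: (mulfI nC0); rewrite mulVKf//.
apply: (@mulIf _ 2); first by rewrite pnatr_eq0.
rewrite !mulr_natr !mulr2n -[X in X + _]exchange_big /= -big_split /=.
rewrite (_ : \sum_i _ = \sum_i \sum_j n%:R * (a i j * b i j + a j i * b j i)%:C%C); last first.
  apply: eq_bigr => i _; rewrite -big_split /=; apply: eq_bigr => j _.
  have [t tE] : exists t, t = Num.sqrt n%:R :> R by eexists.
  have [s sE] : exists s, s = Num.sqrt (n%:R / 2) :> R by eexists.
  have nt : n%:R = t ^+ 2 :> R by rewrite tE sqr_sqrtr.
  have ns : n%:R = s ^+ 2 *+ 2 :> R.
    by rewrite sE sqr_sqrtr ?divr_ge0// -[RHS]mulr_natr divfK.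
  rewrite -(rmorph_nat (real_complex R)) !mxE (eq_sym j i) -tE -sE.
  have [->|nij] := eqVneq i j.
    by apply/eqP; rewrite eq_complex nt /=; apply/andP; split; apply/eqP; ring.
  rewrite -val_eqE /= in nij.
  by case: ltngtP nij => // _ _; apply/eqP; rewrite eq_complex ns /=;
    apply/andP; split; apply/eqP; ring.
rewrite -mulrDr -rmorphD [X in _ = _ * (_ + X)%:C%C]exchange_big /= -big_split /=.
rewrite rmorph_sum mulr_sumr; apply: eq_bigr => i _.
by rewrite -big_split /= rmorph_sum mulr_sumr.
Qed.

Lemma sa_of_coord_surj n (B : 'M[C]_n) : samx B ->
  exists a, sa_of_coord a = B.
Proof.
move=> saB; have [n0|n_gt0] := posnP n.
  by subst n; exists (fun _ _ => 0); apply/matrixP => -[].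
have BE i j : B i j = (B j i)^*.
  by move/matrixP: saB => /(_ i j); rewrite !mxE.
have t0 : Num.sqrt n%:R != 0 :> R by rewrite sqrtr_eq0 -ltNge ltr0n.
have s0 : Num.sqrt (n%:R / 2) != 0 :> R.
  by rewrite sqrtr_eq0 -ltNge divr_gt0// ltr0n.
exists (fun i j => if i == j then complex.Re (B i i) / Num.sqrt n%:R
  else if (i < j)%N then complex.Re (B i j) / Num.sqrt (n%:R / 2)
  else complex.Im (B j i) / Num.sqrt (n%:R / 2)).
apply/matrixP => i j; rewrite !mxE (eq_sym j i).
have [->|nij] := eqVneq i j.
  rewrite eqxx mulrC divfK//.
  move: (BE j j); case: (B j j) => x y /eqP; rewrite eq_complex /= => /andP[_ /eqP yN].
  have /eqP : y *+ 2 = 0 by rewrite mulr2n {1}yN addNr.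
  by rewrite mulrn_eq0 /= => /eqP ->.
move: (nij); rewrite -val_eqE /= => nij'.
case: ltngtP nij' => // ltij _; rewrite ?(BE i j).
  rewrite -BE; case: (B i j) => x y; apply/eqP; rewrite eq_complex /=.
  by rewrite !mul0r subr0 addr0 !(mulrC (Num.sqrt _)) !divfK// !eqxx.
case: (B j i) => x y; apply/eqP; rewrite eq_complex /=.
by rewrite !mul0r subr0 addr0 mulrN !(mulrC (Num.sqrt _)) !divfK// !eqxx.
Qed.

End LebesgueMeasure.

Section MatricialEntropy.
Variables (R : realType) (m : nat).
Local Notation C := (R[i]).
Local Notation law_xy := (ncpoly R ('I_m + nat)%type -> C).

Definition microstates n (r : 'I_m -> R) (Z : nat -> 'M[C]_n)
    (O : set law_xy) : set ('I_m -> 'M[C]_n) :=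
  [set A | [/\ forall j, samx (A j), forall j, mx_opnorm_le (A j) (r j)
             & O (mx_law (join A Z))]].

Definition normalized_log n (v : \bar R) : \bar R :=
  (((n%:R ^+ 2)^-1)%:E * lne v + (m%:R * ln n%:R)%:E)%E.

(* Gamma_R^(n)(pi_2(O)) *)
Definition microstates_snd n (r' : nat -> R) (O : set law_xy) :
    set (nat -> 'M[C]_n) :=
  [set Z | [/\ forall j, samx (Z j), forall j, mx_opnorm_le (Z j) (r' j)
             & (@law_snd R 'I_m nat @` O) (mx_law Z)]].

(* Adding 0 to the family makes the supremum over the empty set equal to 0. *)
Definition sup_nu n (r : 'I_m -> R) (r' : nat -> R) (O : set law_xy) : \bar R :=
  ereal_sup (0%E |` [set nu (microstates r Z O)
                    | Z in microstates_snd (n := n) r' O]).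

Definition chi_cutoff (l : law_xy) (r : 'I_m -> R) (r' : nat -> R) : \bar R :=
  ereal_inf [set limn_esup (fun n => normalized_log n (sup_nu n r r' O))
            | O in law_nbhd l].

Definition chi_lift (l : law_xy) (U : set_system nat)
    (Yn : forall n, nat -> 'M[C]_n) : \bar R :=
  ereal_sup
    [set ereal_inf
           [set lim ((fun n => normalized_log n
                                 (nu (microstates q (Yn n) O))) @ U)
           | O in law_nbhd l]
    | q in [set q : 'I_m -> R | forall j, 0 < q j]].

End MatricialEntropy.

Record hilbert (R : realType) := Hilbert {
  hspace :> completeNormedModType R[i];
  hdot : hspace -> hspace -> R[i];
  hdot_linear : forall y, scalar (hdot ^~ y);
  hdot_conj : forall x y, hdot y x = (hdot x y)^*;
  hdot_norm : forall x, `|x| ^+ 2 = hdot x x }.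

Section Operators.
Variables (R : realType) (H : hilbert R).
Local Notation C := (R[i]).
Implicit Types (S T : H -> H) (N : set (H -> H)).

Definition opnorm_le T (r : R) : Prop :=
  0 <= r /\ forall x, `|T x| <= r%:C%C * `|x|.

Definition bounded_op T : Prop := linear T /\ exists r, opnorm_le T r.

Definition is_adjoint T S : Prop := forall x y, hdot (T x) y = hdot x (S y).

Definition sa_op T : Prop := is_adjoint T T.

Definition positive_op T : Prop := forall x, 0 <= hdot (T x) x.

Definition op_le S T : Prop := positive_op (T \- S).

(* {ptws H -> H} induces the strong operator topology on bounded operators. *)
Record von_neumann N : Prop := {
  vn_bounded : forall T, N T -> bounded_op T;
  vn_id : N id;
  vn_add : forall S T, N S -> N T -> N (S \+ T);
  vn_scale : forall (c : C) T, N T -> N (c \*: T);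
  vn_comp : forall S T, N S -> N T -> N (S \o T);
  vn_adjoint : forall T, N T -> exists2 S, N S & is_adjoint T S;
  vn_closed : forall T, bounded_op T ->
    closure (N : set {ptws H -> H}) T -> N T }.

Definition Wstar (Y : nat -> H -> H) : set (H -> H) :=
  [set T | forall N, von_neumann N -> (forall j, N (Y j)) -> N T].

Record tracial_vna N (tau : (H -> H) -> C) : Prop := {
  tvna_vn : von_neumann N;
  tvna_add : forall S T, N S -> N T -> tau (S \+ T) = tau S + tau T;
  tvna_scale : forall (c : C) T, N T -> tau (c \*: T) = c * tau T;
  tvna_unital : tau id = 1;
  tvna_positive : forall T, N T -> positive_op T -> 0 <= tau T;
  tvna_faithful : forall T, N T -> positive_op T -> tau T = 0 ->
    T = fun=> 0;
  tvna_tracial : forall S T, N S -> N T -> tau (S \o T) = tau (T \o S);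
  (* Normality: tau preserves suprema of upward directed sets of positive
     elements. *)
  tvna_normal : forall (D : set (H -> H)) T,
    D !=set0 -> D `<=` N -> (forall S, D S -> positive_op S) ->
    (forall S1 S2, D S1 -> D S2 ->
       exists S3, [/\ D S3, op_le S1 S3 & op_le S2 S3]) ->
    N T -> (forall S, D S -> op_le S T) ->
    (forall T', N T' -> (forall S, D S -> op_le S T') -> op_le T T') ->
    forall c : C, (forall S, D S -> tau S <= c) -> tau T <= c }.

Definition op_law (I : choiceType) (tau : (H -> H) -> C) (X : I -> H -> H) :
    ncpoly R I -> C :=
  fun p => tau (fun v => \sum_(w <- msupp p)
    p@_w *: foldr (fun i u => X i u) v (w : seq I)).

End Operators.

Section Ultraproduct.
Variables (R : realType) (U : set_system nat).
Local Notation C := (R[i]).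

Definition nonprincipal_ultrafilter : Prop :=
  UltraFilter U /\ forall k : nat, ~ U [set k].

Definition mxseq := forall n : nat, 'M[C]_n.

Definition bounded_mxseq (a : mxseq) : Prop :=
  exists r : R, forall n, mx_opnorm_le (a n) r.

(* The class [a]_U of a bounded sequence modulo the sequences whose 2-norms
   tend to 0 along U. *)
Definition ucoset (a : mxseq) : set mxseq :=
  [set b | bounded_mxseq b /\
           (fun n => norm2 (b n - a n) : C^o) @ U --> (0 : C^o)].

Definition ultraproduct : set (set mxseq) :=
  [set c | exists2 a, bounded_mxseq a & c = ucoset a].

(* The operations and the trace of the ultraproduct are described on
   representatives; only the values of iota on B are relevant. *)
Record embedding (H : hilbert R) (tau : (H -> H) -> C) (B : set (H -> H))
    (iota : (H -> H) -> set mxseq) : Prop := {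
  emb_in : forall S, B S -> ultraproduct (iota S);
  emb_id : iota id (fun n => 1%:M);
  emb_add : forall S T a b, B S -> B T -> iota S a -> iota T b ->
    iota (S \+ T) (fun n => a n + b n);
  emb_scale : forall (c : C) S a, B S -> iota S a ->
    iota (c \*: S) (fun n => c *: a n);
  emb_mul : forall S T a b, B S -> B T -> iota S a -> iota T b ->
    iota (S \o T) (fun n => a n *m b n);
  emb_adjoint : forall S T a, B S -> B T -> is_adjoint S T -> iota S a ->
    iota T (fun n => adjmx (a n));
  emb_trace : forall S a, B S -> iota S a ->
    (fun n => ntr (a n) : C^o) @ U --> (tau S : C^o) }.

Definition is_lift (H : hilbert R) (iota : (H -> H) -> set mxseq)
    (Y : nat -> H -> H) (Yn : forall n, nat -> 'M[C]_n) : Prop :=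
  forall j, [/\ forall n, samx (Yn n j), bounded_mxseq (fun n => Yn n j)
              & iota (Y j) = ucoset (fun n => Yn n j)].

End Ultraproduct.

Section Entropy.
Variables (R : realType) (H : hilbert R) (tau : (H -> H) -> R[i]).
Variables (m : nat) (X : 'I_m -> H -> H).

Definition norm_bounds (Y : nat -> H -> H) (r : 'I_m -> R) (r' : nat -> R) :
    Prop :=
  [/\ forall j, 0 < r j, forall j, 0 < r' j,
      forall j, opnorm_le (X j) (r j) & forall j, opnorm_le (Y j) (r' j)].

Definition chi_bar_cutoff (Y : nat -> H -> H) (r : 'I_m -> R) (r' : nat -> R) :
    \bar R := chi_cutoff (op_law tau (join X Y)) r r'.

Definition chi_bar (Y : nat -> H -> H) : \bar R :=
  ereal_sup [set chi_bar_cutoff Y rr.1 rr.2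
            | rr in [set rr | norm_bounds Y rr.1 rr.2]].

(* The value for a chosen self-adjoint generating tuple W of B and a chosen
   lift Wn of iota(W); the default -oo is used only if B has no such W. *)
Definition chi_emb (B : set (H -> H)) (U : set_system nat)
    (iota : (H -> H) -> set (mxseq R)) : \bar R :=
  xget -oo%E [set v | exists W Wn,
    [/\ forall j, sa_op (W j) /\ bounded_op (W j), Wstar W = B,
        is_lift U iota W Wn
      & v = chi_lift (op_law tau (join X W)) U Wn]].

Definition chi_U (B : set (H -> H)) (U : set_system nat) : \bar R :=
  ereal_sup [set chi_emb B U iota | iota in embedding U tau B].

End Entropy.

(* Main.v *)
(* Both entropies are compared through one ultrafilter. If chi_R(X | Y) > c,
   there are, for a decreasing basis O_k of neighborhoods of law(X, Y),
   arbitrarily large n and matrices Z with law(Z) in pi_2(O_k) whose microstate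
   space has normalized logarithmic volume above c. Along an ultrafilter
   concentrated on these n, the laws of the Z converge to law(Y); hence the Z are
   lifts of Y for a trace-preserving embedding of W*(Y), which shows
   chi^U(X | B) >= c. To define the embedding on all of W*(Y) one needs 2-norm
   density of polynomials in Y together with a Kaplansky theorem in which the
   approximating polynomials are bounded on all matrix tuples at once.

   Conversely, for an embedding iota the value of chi^U does not depend on the
   generators or lifts, so one may use lifts of Y clamped to norm at most R'.
   Their laws lie in pi_2(O), which gives chi^U <= chi_R once the cutoff Q is
   replaced by R. For this, a microstate A with even moments close to those of X
   has a proportion at most delta of eigenvalues outside [-R(1 + kappa),
   R(1 + kappa)]; the corresponding spectral part lies, up to kappa R in operator
   norm, in a net of exp(eps n^2) matrices, and subtracting and rescaling changes
   the volume by a factor exp(eps n^2) only. As chi_R equals sup_U chi^U for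
   every R, it does not depend on R. *)

Require Import Defs.
From HB Require Import structures.
From mathcomp Require Import all_boot all_order all_algebra.
From mathcomp Require Import finmap complex monalg.
From mathcomp Require Import all_classical all_reals all_analysis.
From mathcomp Require Import measurable_realfun ring lra.

Set Implicit Arguments.
Unset Strict Implicit.
Unset Printing Implicit Defensive.
Import Order.TTheory GRing.Theory Num.Theory.
Import numFieldNormedType.Exports ComplexField.Normc.
Local Open Scope classical_set_scope.
Local Open Scope ring_scope.

Local Notation Re := complex.Re.
Local Notation Im := complex.Im.

(** * Semi-inner products *)

(** The Hilbert space completion of the 2-norm is never formed: inner products live on subspaces of
    arbitrary modules, and orthogonal projections are replaced by almost minimizers and the limits
    of their matrix entries. The obstacle is that [Wstar] is defined by strong closure while the
    embedding needs 2-norm approximation, and [tau] need not be a vector state on the given space.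
    Normality is therefore used, through Zorn's lemma, to find many b for which the 2-norm of w b is
    dominated by a single vector.

    The bound in the Kaplansky step must hold in every dimension. The function t / (1 + t^2/16) is
    reached by a Neumann series whose estimates use only that the letters are self-adjoint, so they
    hold on all spaces simultaneously.

    In the removal of the cutoff, volumes are compared by translations and dilations alone. The
    outlying spectral part has the form W^* s W with s a diagonal of signs and W having at most
    delta n nonzero rows, hence at most 2 delta n^2 real parameters; the choice of s costs a factor
    3^n, which the normalization by n^2 does not see. *)

Lemma quadratic_ge0 (R : realType) (a b N : R) : 0 <= a -> 0 <= b -> 0 <= N ->
  (forall t, 0 <= a - 2 * t * N + t ^+ 2 * N * b) -> N <= a * b.
Proof.
move=> a0 b0; rewrite le_eqVlt => /predU1P[<- _|N0 h]; first exact: mulr_ge0.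
move: b0; rewrite le_eqVlt => /predU1P[b0|b0].
  (* For b = 0 the quadratic is affine in t with slope -2N < 0, and this t makes it equal to -1. *)
  have := h ((a + 1) / (2 * N)).
  have -> : a - 2 * ((a + 1) / (2 * N)) * N +
     ((a + 1) / (2 * N)) ^+ 2 * N * b = -1.
    rewrite -b0; field; lra.
  lra.
have := h b^-1.
have -> : a - 2 * b^-1 * N + b^-1 ^+ 2 * N * b = (a * b - N) / b by field; lra.
by rewrite pmulr_lge0 ?invr_gt0// subr_ge0.
Qed.

Section ComplexParts.
Variable R : realType.
Local Notation C := (R[i]).
Implicit Types (x y z : C) (a : R).

Lemma conjE x : x^* = (Re x -i* Im x)%C.
Proof. by case: x. Qed.

Lemma conjD x y : (x + y)^* = x^* + y^*.
Proof. exact: rmorphD. Qed.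

Lemma conjM x y : (x * y)^* = x^* * y^*.
Proof. exact: rmorphM. Qed.

Lemma conjK x : x^*^* = x.
Proof. exact: conjcK. Qed.

Lemma ReD x y : Re (x + y) = Re x + Re y.
Proof. by case: x; case: y. Qed.

Lemma ReN x : Re (- x) = - Re x.
Proof. by case: x. Qed.

Lemma ReB x y : Re (x - y) = Re x - Re y.
Proof. by rewrite ReD ReN. Qed.

Lemma ReZ a x : Re (a%:C%C * x) = a * Re x.
Proof. by case: x => u v /=; rewrite mul0r subr0. Qed.

Lemma Re_conj x : Re x^* = Re x.
Proof. by case: x. Qed.

Lemma Re_sum (I : Type) (s : seq I) (F : I -> C) :
  Re (\sum_(i <- s) F i) = \sum_(i <- s) Re (F i).
Proof. by elim: s => [|i s IH]; rewrite ?big_nil// !big_cons ReD IH. Qed.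

Lemma normcE' x : `|x| = (normc x)%:C%C.
Proof. by []. Qed.

Lemma normc_ge0 x : 0 <= normc x.
Proof. by case: x => u v; exact: sqrtr_ge0. Qed.

Lemma sqr_normc' x : (normc x) ^+ 2 = Re x ^+ 2 + Im x ^+ 2.
Proof. by case: x => u v /=; rewrite sqr_sqrtr ?addr_ge0 ?sqr_ge0. Qed.

Lemma mulc_conj x : x * x^* = ((normc x) ^+ 2)%:C%C.
Proof.
rewrite sqr_normc' conjE; case: x => u v; apply/eqP; rewrite eq_complex /=.
by apply/andP; split; apply/eqP; ring.
Qed.

Lemma normc_conj x : normc x^* = normc x.
Proof. by case: x => u v /=; rewrite sqrrN. Qed.

Lemma normcR a : normc a%:C%C = `|a|.
Proof. by rewrite /= expr0n addr0 sqrtr_sqr. Qed.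

Lemma Re_le_normc x : Re x <= normc x.
Proof.
have := sqr_normc' x; have := normc_ge0 x; move: (normc x) (Re x) (Im x).
by move=> a b c a0 e; nra.
Qed.

Lemma normRe_le x : `|Re x| <= normc x.
Proof.
rewrite ler_norml Re_le_normc andbT lerNl -ReN -normcN.
exact: Re_le_normc.
Qed.

Lemma ge0c_Re x : 0 <= x -> x = (Re x)%:C%C.
Proof. by case: x => u v; rewrite lecE /= => /andP[/eqP ->]. Qed.

Lemma Re_ge0 x : 0 <= x -> 0 <= Re x.
Proof. by case: x => u v; rewrite lecE /= => /andP[]. Qed.

Lemma normc_sum (I : Type) (s : seq I) (F : I -> C) :
  normc (\sum_(i <- s) F i) <= \sum_(i <- s) normc (F i).
Proof.
elim: s => [|i s IH]; first by rewrite !big_nil normc0.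
by rewrite !big_cons (le_trans (le_normcD _ _))// lerD2l.
Qed.

Lemma normcB x y : normc (x - y) = normc (y - x).
Proof. by rewrite -normcN opprB. Qed.

End ComplexParts.

Section SemiInnerProduct.
Variables (R : realType) (V : lmodType R[i]).
Local Notation C := (R[i]).
Implicit Types (D : V -> Prop) (dot : V -> V -> C).

(** The domain is a predicate because the algebra sits inside the module [H -> H] of all maps, where
    the trace form is sesquilinear only on the algebra. Definiteness is not part of the
    structure. *)
Record sdot D dot : Prop := SDot {
  sd0 : D 0;
  sdD : forall x y, D x -> D y -> D (x + y);
  sdZ : forall c x, D x -> D (c *: x);
  sdotDl : forall x y z, D x -> D y -> D z -> dot (x + y) z = dot x z + dot y z;
  sdotZl : forall c x z, D x -> D z -> dot (c *: x) z = c * dot x z;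
  sdotC : forall x y, D x -> D y -> dot y x = (dot x y)^*;
  sdot_ge0 : forall x, D x -> 0 <= dot x x }.

Definition snorm dot x : R := Num.sqrt (Re (dot x x)).

Variables (D : V -> Prop) (dot : V -> V -> C).
Hypothesis sD : sdot D dot.
Local Notation sn := (snorm dot).

Lemma sdN x : D x -> D (- x).
Proof. by move=> Dx; rewrite -scaleN1r; exact: (sdZ sD). Qed.

Lemma sdB x y : D x -> D y -> D (x - y).
Proof. by move=> Dx Dy; apply: (sdD sD) => //; exact: sdN. Qed.

Lemma sdotDr x y z : D x -> D y -> D z -> dot z (x + y) = dot z x + dot z y.
Proof.
move=> Dx Dy Dz; have Dxy := sdD sD Dx Dy.
by rewrite (sdotC sD Dxy Dz) (sdotDl sD)// conjD -!(sdotC sD).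
Qed.

Lemma sdotZr c x z : D x -> D z -> dot z (c *: x) = c^* * dot z x.
Proof.
move=> Dx Dz; have Dcx := sdZ sD c Dx.
by rewrite (sdotC sD Dcx Dz) (sdotZl sD)// conjM -(sdotC sD).
Qed.

Lemma sdotNl x z : D x -> D z -> dot (- x) z = - dot x z.
Proof. by move=> Dx Dz; rewrite -scaleN1r (sdotZl sD)// mulN1r. Qed.

Lemma sdotNr x z : D x -> D z -> dot z (- x) = - dot z x.
Proof. by move=> Dx Dz; rewrite -scaleN1r sdotZr// rmorphN rmorph1 mulN1r. Qed.

Lemma sdotBl x y z : D x -> D y -> D z -> dot (x - y) z = dot x z - dot y z.
Proof. by move=> Dx Dy Dz; rewrite (sdotDl sD)// ?sdotNl//; exact: sdN. Qed.

Lemma sdotBr x y z : D x -> D y -> D z -> dot z (x - y) = dot z x - dot z y.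
Proof. by move=> Dx Dy Dz; rewrite sdotDr// ?sdotNr//; exact: sdN. Qed.

Lemma snorm_ge0 x : 0 <= sn x.
Proof. exact: sqrtr_ge0. Qed.

Lemma sqr_snorm x : D x -> sn x ^+ 2 = Re (dot x x).
Proof. by move=> Dx; rewrite sqr_sqrtr// Re_ge0//; exact: (sdot_ge0 sD). Qed.

Lemma sdot_snorm x : D x -> dot x x = (sn x ^+ 2)%:C%C.
Proof. by move=> Dx; rewrite sqr_snorm// -ge0c_Re//; exact: (sdot_ge0 sD). Qed.

Lemma sqr_snormD x y : D x -> D y ->
  sn (x + y) ^+ 2 = sn x ^+ 2 + 2 * Re (dot x y) + sn y ^+ 2.
Proof.
move=> Dx Dy; have Dxy := sdD sD Dx Dy; rewrite !sqr_snorm//.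
rewrite (sdotDl sD)// !sdotDr// !ReD (sdotC sD Dx Dy) Re_conj.
by ring.
Qed.

Lemma snormZ c x : D x -> sn (c *: x) = normc c * sn x.
Proof.
move=> Dx; have Dcx := sdZ sD c Dx.
apply/(@pexpIrn _ 2) => //; rewrite ?nnegrE ?mulr_ge0 ?snorm_ge0 ?normc_ge0//.
rewrite exprMn !sqr_snorm// (sdotZl sD)// sdotZr// mulrA mulc_conj.
by rewrite ReZ.
Qed.

Lemma snormN x : D x -> sn (- x) = sn x.
Proof. by move=> Dx; rewrite -scaleN1r snormZ// normcN normc1 mul1r. Qed.

Lemma snormB x y : D x -> D y -> sn (x - y) = sn (y - x).
Proof. by move=> Dx Dy; rewrite -opprB snormN//; exact: sdB. Qed.

Lemma sqr_snormDZ c x y : D x -> D y ->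
  sn (x + c *: y) ^+ 2 =
    sn x ^+ 2 + 2 * Re (c * dot y x) + normc c ^+ 2 * sn y ^+ 2.
Proof.
move=> Dx Dy; rewrite sqr_snormD//; last exact: (sdZ sD).
by rewrite snormZ// sdotZr// (sdotC sD Dy Dx) -conjM Re_conj exprMn.
Qed.

Lemma cauchy_schwarz x y : D x -> D y -> normc (dot x y) <= sn x * sn y.
Proof.
move=> Dx Dy; rewrite -(@ler_pXn2r _ 2) ?nnegrE ?mulr_ge0 ?snorm_ge0 ?normc_ge0//.
rewrite exprMn; apply: quadratic_ge0; rewrite ?sqr_ge0// => t.
(* Expanding |x - t <x, y> y|^2 gives the quadratic of [quadratic_ge0] with N = |<x, y>|^2. *)
have := sqr_ge0 (sn (x + (- t%:C%C * dot x y) *: y)); rewrite sqr_snormDZ//.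
rewrite (sdotC sD Dx Dy) normcM normcN normcR -(mulrA (- t%:C%C)) mulc_conj -rmorphN ReZ.
rewrite exprMn real_normK ?num_real//=; lra.
Qed.

Lemma snormD x y : D x -> D y -> sn (x + y) <= sn x + sn y.
Proof.
move=> Dx Dy; rewrite -(@ler_pXn2r _ 2) ?nnegrE ?addr_ge0 ?snorm_ge0//.
rewrite sqr_snormD// sqrrD -mulr_natl.
have := cauchy_schwarz Dx Dy; have := Re_le_normc (dot x y); lra.
Qed.

Lemma snorm0 : sn 0 = 0.
Proof. by rewrite -[X in sn X](scale0r 0) snormZ ?normc0 ?mul0r//; exact: (sd0 sD). Qed.

(* Minimize |x|^2 - 2 Re phi(x). *)
Lemma approx_riesz (phi : V -> C) (K : R) :
  (forall x y, D x -> D y -> phi (x + y) = phi x + phi y) ->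
  (forall c x, D x -> phi (c *: x) = c * phi x) ->
  (forall x, D x -> normc (phi x) <= K * sn x) ->
  forall e, 0 < e ->
    exists2 a, D a & forall c, D c -> normc (dot c a - phi c) <= e * sn c.
Proof.
move=> phiD phiZ phiK e e0.
pose J x := sn x ^+ 2 - 2 * Re (phi x).
have Jlb x : D x -> - K ^+ 2 <= J x.
  move=> Dx; have := phiK _ Dx; have := Re_le_normc (phi x).
  rewrite /J; have := sqr_ge0 (K - sn x); nra.
have hi : has_inf (J @` D).
  split; first by exists (J 0), 0 => //; exact: (sd0 sD).
  by exists (- K ^+ 2) => _ [x Dx <-]; exact: Jlb.
have [_ [a Da <-] Ja] := inf_adherent (exprn_gt0 2 e0) hi.
exists a => // c Dc.
rewrite -(@ler_pXn2r _ 2) ?nnegrE ?mulr_ge0 ?snorm_ge0 ?normc_ge0 ?(ltW e0)//.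
set w := dot c a - phi c.
rewrite exprMn; apply: quadratic_ge0; rewrite ?sqr_ge0// => t.
(* In this direction J changes by -2 t |w|^2 + t^2 |w|^2 |c|^2, and it cannot drop by more than e^2
   below its value at a; the discriminant gives |w|^2 <= e^2 |c|^2. *)
pose s := - t%:C%C * w^*.
have Ds : D (a + s *: c) by apply: (sdD sD) => //; exact: (sdZ sD).
have := ge_inf (proj2 hi) (imageP J Ds); rewrite /J sqr_snormDZ//.
rewrite phiD ?phiZ//; last exact: (sdZ sD).
have -> : dot c a = w + phi c by rewrite /w subrK.
have -> : normc s ^+ 2 = t ^+ 2 * normc w ^+ 2.
  by rewrite /s normcM normcN normcR normc_conj exprMn real_normK ?num_real.
have -> : s * (w + phi c) = (- t * normc w ^+ 2)%:C%C + s * phi c.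
  by rewrite mulrDr {1}/s -mulrA (mulrC _ w) mulc_conj -rmorphN -rmorphM.
rewrite !ReD /=; rewrite /J in Ja => h; clear -h Ja; lra.
Qed.

End SemiInnerProduct.

Lemma invS_le (R : realType) (e : R) : 0 < e ->
  exists N : nat, forall n, (N <= n)%N -> (n.+1%:R)^-1 <= e.
Proof.
move=> e0; have [N hN] := ltr_add_invr e0; rewrite add0r in hN.
exists N => n Nn; apply: le_trans (ltW hN).
by rewrite lef_pV2 ?posrE// ler_nat.
Qed.

(** * Hilbert space operators, Riesz representation and strong closure *)

Section HilbertSpace.
Variables (R : realType) (H : hilbert R).
Local Notation C := (R[i]).
Implicit Types (S T : H -> H).

Lemma hdot_sdot : sdot (fun _ : H => True) (@hdot R H).
Proof.
split=> // [x y z _ _ _|c x z _ _|x y _ _|x _].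
- by have := hdot_linear z 1 x y; rewrite scale1r mul1r.
- have := hdot_linear z c x 0; rewrite addr0 => ->.
  have := hdot_linear z (-1) 0 0; rewrite scaleN1r oppr0 addr0 mulN1r addNr.
  by move=> ->; rewrite addr0.
- exact: hdot_conj.
- by rewrite -hdot_norm exprn_ge0.
Qed.
Local Notation hS := hdot_sdot.

Definition hnorm (x : H) : R := snorm (@hdot R H) x.

Lemma hnormE x : `|x| = (hnorm x)%:C%C.
Proof.
apply/eqP; rewrite -(@eqrXn2 _ 2)//; last by rewrite lecR snorm_ge0.
by rewrite hdot_norm (sdot_snorm hS)// rmorphXn.
Qed.

Lemma hdotDl (x y z : H) : hdot (x + y) z = hdot x z + hdot y z.
Proof. exact: (sdotDl hS). Qed.

Lemma hdotDr (x y z : H) : hdot z (x + y) = hdot z x + hdot z y.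
Proof. exact: (sdotDr hS). Qed.

Lemma hdotZl (c : C) (x z : H) : hdot (c *: x) z = c * hdot x z.
Proof. exact: (sdotZl hS). Qed.

Lemma hdotZr (c : C) (x z : H) : hdot z (c *: x) = c^* * hdot z x.
Proof. exact: (sdotZr hS). Qed.

Lemma hdotBl (x y z : H) : hdot (x - y) z = hdot x z - hdot y z.
Proof. exact: (sdotBl hS). Qed.

Lemma hdotBr (x y z : H) : hdot z (x - y) = hdot z x - hdot z y.
Proof. exact: (sdotBr hS). Qed.

Lemma hdotNl (x z : H) : hdot (- x) z = - hdot x z.
Proof. exact: (sdotNl hS). Qed.

Lemma hdotNr (x z : H) : hdot z (- x) = - hdot z x.
Proof. exact: (sdotNr hS). Qed.

Lemma hdot0l (z : H) : hdot 0 z = 0.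
Proof. by rewrite -(scale0r 0) hdotZl mul0r. Qed.

Lemma hdot0r (z : H) : hdot z 0 = 0.
Proof. by rewrite hdot_conj hdot0l [LHS]conjc0. Qed.

Lemma hnorm_ge0 x : 0 <= hnorm x.
Proof. exact: snorm_ge0. Qed.

Lemma sqr_hnorm x : hnorm x ^+ 2 = Re (hdot x x).
Proof. exact: (sqr_snorm hS). Qed.

Lemma hdot_hnorm x : hdot x x = (hnorm x ^+ 2)%:C%C.
Proof. exact: (sdot_snorm hS). Qed.

Lemma hnormZ c x : hnorm (c *: x) = normc c * hnorm x.
Proof. exact: (snormZ hS). Qed.

Lemma hnormD x y : hnorm (x + y) <= hnorm x + hnorm y.
Proof. exact: (snormD hS). Qed.

Lemma hnormN x : hnorm (- x) = hnorm x.
Proof. exact: (snormN hS). Qed.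

Lemma hnormB x y : hnorm (x - y) = hnorm (y - x).
Proof. exact: (snormB hS). Qed.

Lemma hnorm0 : hnorm 0 = 0.
Proof. exact: (snorm0 hS). Qed.

Lemma hnorm_eq0 x : hnorm x = 0 -> x = 0.
Proof. by move=> x0; apply/normr0_eq0; rewrite hnormE x0. Qed.

Lemma hdot_le x y : normc (hdot x y) <= hnorm x * hnorm y.
Proof. exact: (cauchy_schwarz hS). Qed.

Lemma hdot_inj (x y : H) : (forall z, hdot x z = hdot y z) -> x = y.
Proof.
move=> xy; apply/eqP; rewrite -subr_eq0; apply/eqP/hnorm_eq0.
by apply/eqP; rewrite -sqrf_eq0 sqr_hnorm hdotBl xy subrr.
Qed.

Lemma hcauchy (u : nat -> H) :
  (forall e, 0 < e -> exists N, forall n, (N <= n)%N -> hnorm (u n - u N) <= e) ->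
  exists l, forall e, 0 < e -> exists N, forall n, (N <= n)%N -> hnorm (u n - l) <= e.
Proof.
move=> cu; have : cvg (u @ \oo).
  apply: cauchy_cvg; suff : @cauchy_ex _ H (u @ \oo) by exact: cauchy_exP.
  move=> e e0.
  have [e1 [e1E e10]] : exists e1 : R, e = e1%:C%C /\ 0 < e1.
    exists (Re e); have := e0; case: (e) => a b; rewrite ltcE /= => /andP[/eqP ->].
    by split.
  have [N hN] := cu (e1 / 2) (divr_gt0 e10 (ltr0Sn _ 1)).
  exists (u N); exists N => // n /= Nn; rewrite -ball_normE /= hnormE e1E ltcR hnormB.
  by apply: le_lt_trans (hN _ Nn) _; lra.
move=> /cvg_ex[l /= ul]; exists l => e e0.
have /cvgrPdist_le/(_ e%:C%C) := ul.
rewrite ltcR => /(_ e0) [N _ hN]; exists N => n Nn.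
by have := hN n Nn; rewrite /= hnormE lecR hnormB.
Qed.

Lemma opnormP T r : opnorm_le T r <->
  0 <= r /\ forall x, hnorm (T x) <= r * hnorm x.
Proof.
by split=> -[r0 h]; split=> // x; have := h x;
  rewrite !hnormE -rmorphM lecR.
Qed.

Lemma opnorm_ge0 T r : opnorm_le T r -> 0 <= r.
Proof. by case. Qed.

Lemma opnormE T r x : opnorm_le T r -> hnorm (T x) <= r * hnorm x.
Proof. by move=> /opnormP[_]. Qed.

Lemma opnorm_le_trans T r s : r <= s -> opnorm_le T r -> opnorm_le T s.
Proof.
move=> rs /opnormP[r0 h]; apply/opnormP; split; first exact: le_trans rs.
by move=> x; apply: le_trans (h x) _; rewrite ler_wpM2r ?hnorm_ge0.
Qed.

Lemma opnorm_comp S T r s : opnorm_le S r -> opnorm_le T s ->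
  opnorm_le (S \o T) (r * s).
Proof.
move=> /opnormP[r0 hS] /opnormP[s0 hT]; apply/opnormP; split; first exact: mulr_ge0.
move=> x; apply: le_trans (hS _) _; rewrite -mulrA ler_wpM2l//; exact: hT.
Qed.

Lemma opnorm_add S T r s : opnorm_le S r -> opnorm_le T s ->
  opnorm_le (S + T) (r + s).
Proof.
move=> /opnormP[r0 hS] /opnormP[s0 hT]; apply/opnormP; split; first exact: addr_ge0.
by move=> x; apply: le_trans (hnormD _ _) _; rewrite mulrDl lerD.
Qed.

Lemma opnorm_scale c T r : opnorm_le T r -> opnorm_le (c *: T) (normc c * r).
Proof.
move=> /opnormP[r0 hT]; apply/opnormP; split; first by rewrite mulr_ge0 ?normc_ge0.
by move=> x; rewrite hnormZ -mulrA ler_wpM2l ?normc_ge0.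
Qed.

Lemma opnorm_id : opnorm_le (id : H -> H) 1.
Proof. by apply/opnormP; split => // x; rewrite mul1r. Qed.

Lemma lin_addE T (lT : linear T) x y : T (x + y) = T x + T y.
Proof. by have := lT 1 x y; rewrite !scale1r. Qed.

Lemma lin_0E T (lT : linear T) : T 0 = 0.
Proof. by have := lT (-1) 0 0; rewrite !scaleN1r oppr0 addr0 addNr. Qed.

Lemma lin_scaleE T (lT : linear T) c x : T (c *: x) = c *: T x.
Proof. by have := lT c x 0; rewrite (lin_0E lT) !addr0. Qed.

Lemma lin_oppE T (lT : linear T) x : T (- x) = - T x.
Proof. by rewrite -scaleN1r lin_scaleE// scaleN1r. Qed.

Lemma lin_subE T (lT : linear T) x y : T (x - y) = T x - T y.
Proof. by rewrite lin_addE// lin_oppE. Qed.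

Lemma adjoint_uniq T S1 S2 : is_adjoint T S1 -> is_adjoint T S2 -> S1 = S2.
Proof.
move=> h1 h2; apply/funext => y; apply: hdot_inj => x.
by rewrite hdot_conj -h1 h2 -hdot_conj.
Qed.

Lemma adjoint_sym T S : is_adjoint T S -> is_adjoint S T.
Proof. by move=> h x y; rewrite hdot_conj -h -hdot_conj. Qed.

Lemma adjoint_opnorm T S r : is_adjoint T S -> opnorm_le T r -> opnorm_le S r.
Proof.
move=> TS /opnormP[r0 hT]; apply/opnormP; split=> // y.
have [->|y0] := eqVneq (hnorm (S y)) 0; first by rewrite mulr_ge0 ?hnorm_ge0.
have Sy0 : 0 < hnorm (S y) by rewrite lt_neqAle eq_sym y0 hnorm_ge0.
rewrite -(ler_pM2l Sy0) -expr2 sqr_hnorm -TS.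
apply: le_trans (Re_le_normc _) _; apply: le_trans (hdot_le _ _) _.
rewrite mulrCA mulrA ler_wpM2r ?hnorm_ge0//.
Qed.

(** [E] may fail to be closed. Approximate representatives a_n and a_k, tested against their
    difference, are seen to differ by at most 1/(n+1) + 1/(k+1), so they converge in [H]. *)
Lemma riesz (E : H -> Prop) (phi : H -> C) (K : R) :
  E 0 -> (forall x y, E x -> E y -> E (x + y)) ->
  (forall c x, E x -> E (c *: x)) ->
  (forall x y, E x -> E y -> phi (x + y) = phi x + phi y) ->
  (forall c x, E x -> phi (c *: x) = c * phi x) ->
  (forall x, E x -> normc (phi x) <= K * hnorm x) ->
  exists z, forall x, E x -> phi x = hdot x z.
Proof.
move=> E0 ED EZ phiD phiZ phiK.
have sE : sdot E (@hdot R H).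
  by split=> //; intros; [exact: hdotDl|exact: hdotZl|exact: hdot_conj|
    apply: (sdot_ge0 hS)].
have ar := approx_riesz sE phiD phiZ phiK.
have e0 n : 0 < n.+1%:R^-1 :> R by rewrite invr_gt0.
pose a n := projT1 (cid2 (ar _ (e0 n))).
have Ea n : E (a n) by rewrite /a; case: cid2.
have ha n c : E c -> normc (hdot c (a n) - phi c) <= n.+1%:R^-1 * hnorm c.
  by rewrite /a; case: cid2 => b /= _ hb Ec; exact: hb.
have haa n k : hnorm (a n - a k) <= n.+1%:R^-1 + k.+1%:R^-1.
  have [->|y0] := eqVneq (hnorm (a n - a k)) 0.
    by rewrite addr_ge0 ?invr_ge0.
  have Sy0 : 0 < hnorm (a n - a k) by rewrite lt_neqAle eq_sym y0 hnorm_ge0.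
  have Ec : E (a n - a k) by exact: (sdB sE).
  rewrite -(ler_pM2r Sy0) -expr2 sqr_hnorm hdotBr.
  set c := a n - a k.
  have -> : hdot c (a n) - hdot c (a k) =
      (hdot c (a n) - phi c) - (hdot c (a k) - phi c) by ring.
  apply: le_trans (Re_le_normc _) _; apply: le_trans (le_normcD _ _) _.
  by rewrite normcN mulrDl lerD// ha.
have [|z hz] := @hcauchy a.
  move=> e ep; have [N hN] := invS_le (divr_gt0 ep (ltr0Sn _ 1)).
  exists N => n Nn; apply: le_trans (haa _ _) _.
  by rewrite [leRHS]splitr lerD ?hN.
exists z => x Ex; apply/eqP; rewrite -subr_eq0; apply/eqP/eq0_normc/eqP.
rewrite eq_le normc_ge0 andbT; apply/ler_addgt0Pr => e ep; rewrite add0r.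
have x1 : 0 < hnorm x + 1 by rewrite ltr_wpDl ?hnorm_ge0.
have e20 : 0 < e / 2 / (hnorm x + 1) by rewrite !divr_gt0.
have [N hN] := hz _ e20; have [M hM] := invS_le e20.
pose n := maxn N M.
have hn := hN n (leq_maxl _ _).
have hm := hM n (leq_maxr _ _).
have -> : phi x - hdot x z = hdot x (a n - z) - (hdot x (a n) - phi x).
  by rewrite hdotBr; ring.
apply: le_trans (le_normcD _ _) _; rewrite normcN.
have := hdot_le x (a n - z); have := ha n x Ex; have := hnorm_ge0 x.
move: (normc _) (normc _) => p1 p2 x0 hp1 hp2.
have dE : (e / 2 / (hnorm x + 1)) * (hnorm x + 1) = e / 2 by rewrite divfK// gt_eqF.
move: hn hm dE e20; move: (_ / _) (n.+1%:R^-1) hp1 => d v hp1 hn hm dE d0.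
have : hnorm x * hnorm (a n - z) <= hnorm x * d by rewrite ler_wpM2l.
have : v * hnorm x <= d * hnorm x by rewrite ler_wpM2r.
move: hp2 hp1 dE; set q1 := hnorm x * hnorm _.
lra.
Qed.

Lemma sot_closure (N : set (H -> H)) T : closure (N : set {ptws H -> H}) T ->
  forall (s : seq H) e, 0 < e ->
  exists2 S, N S & forall x, x \in s -> hnorm (S x - T x) <= e.
Proof.
move=> cT s e e0.
have nb x : nbhs (T : {ptws H -> H}) [set S : {ptws H -> H} | hnorm (S x - T x) <= e].
  have : (fun S : {ptws H -> H} => S x) @ (T : {ptws H -> H}) --> (T x : H).
    exact: (@proj_continuous H (fun _ => H : topologicalType) x).
  move/cvgrPdist_le => /(_ e%:C%C).
  rewrite ltcR => /(_ e0); apply: filterS => S /=.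
  by rewrite hnormE lecR hnormB.
have : nbhs (T : {ptws H -> H})
   [set S : {ptws H -> H} | forall x, x \in s -> hnorm (S x - T x) <= e].
  elim: s => [|x s IH]; first by apply: filterE => S x; rewrite in_nil.
  apply: filterS2 (nb x) IH => S /= h1 h2 y; rewrite inE => /predU1P[->//|].
  exact: h2.
by move=> /cT[S [NS hS]]; exists S.
Qed.

Lemma sot_closure_net (N : set (H -> H)) T (F : set_system (H -> H)) :
  ProperFilter F -> F N ->
  (forall x e, 0 < e -> F [set S | hnorm (S x - T x) <= e]) ->
  closure (N : set {ptws H -> H}) T.
Proof.
move=> PF FN FT B nB.
have : {ptws, F --> T}.
  apply/pointwise_cvgP => x; apply/cvgrPdist_le => e e0.
  have [e1 [e1E e10]] : exists e1 : R, e = e1%:C%C /\ 0 < e1.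
    exists (Re e); have := e0; case: (e) => a b; rewrite ltcE /= => /andP[/eqP ->].
    by split.
  have := FT x _ e10; apply: filterS => S /=.
  by rewrite e1E hnormE lecR hnormB.
move=> /(_ _ nB) FB; exact: filter_ex (filterI FN FB).
Qed.

End HilbertSpace.

(** * Tracial von Neumann algebras *)

Section TracialVNA.
Variables (R : realType) (H : hilbert R) (M : set (H -> H)).
Variables (tau : (H -> H) -> R[i]).
Hypothesis hM : tracial_vna M tau.
Local Notation C := (R[i]).
Implicit Types (S T : H -> H).

Let vM := tvna_vn hM.

Lemma M_id : M id. Proof. exact: vn_id vM. Qed.

Lemma M_add S T : M S -> M T -> M (S + T).
Proof. exact: (vn_add vM). Qed.

Lemma M_scale c T : M T -> M (c *: T).
Proof. exact: (vn_scale vM). Qed.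

Lemma M_opp T : M T -> M (- T).
Proof. by move=> MT; rewrite -scaleN1r; exact: M_scale. Qed.

Lemma M_sub S T : M S -> M T -> M (S - T).
Proof. by move=> MS MT; apply: M_add => //; exact: M_opp. Qed.

Lemma M_comp S T : M S -> M T -> M (S \o T).
Proof. exact: (vn_comp vM). Qed.

Lemma M_0 : M 0.
Proof. by rewrite -(scale0r id); exact/M_scale/M_id. Qed.

Lemma M_lin T : M T -> linear T.
Proof. by move=> /(vn_bounded vM)[]. Qed.

Lemma M_bnd T : M T -> exists2 r, 0 < r & opnorm_le T r.
Proof.
move=> /(vn_bounded vM)[_ [r hr]]; exists (r + 1).
  by rewrite ltr_wpDl//; exact: opnorm_ge0 hr.
by apply: opnorm_le_trans hr; rewrite lerDl.
Qed.

(** Total by convention, with value [id] when no adjoint exists; otherwise uniqueness of the adjoint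
    makes the choice immaterial ([adj_eq]). *)
Definition adj T : H -> H :=
  if pselect (exists S, is_adjoint T S) is left h then projT1 (cid h) else id.

Lemma adj_eq T S : is_adjoint T S -> adj T = S.
Proof.
move=> TS; rewrite /adj; case: pselect => [h|[]]; last by exists S.
by case: cid => S' /= TS'; exact: (adjoint_uniq TS' TS).
Qed.

Lemma adjP T : M T -> is_adjoint T (adj T).
Proof. by move=> /(vn_adjoint vM)[S _ TS]; rewrite (adj_eq TS). Qed.

Lemma M_adj T : M T -> M (adj T).
Proof. by move=> /(vn_adjoint vM)[S NS TS]; rewrite (adj_eq TS). Qed.

Local Ltac inM := repeat (first [assumption | lazymatch goal with
  | |- M id => exact M_id
  | |- M 0 => exact M_0
  | |- M (_ \o _) => apply: M_comp
  | |- M (- _) => apply: M_opp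
  | |- M (_ + _) => apply: M_add
  | |- M (_ *: _) => apply: M_scale
  | |- M (adj _) => apply: M_adj
  end]).

Lemma adj_dot T x y : M T -> hdot (T x) y = hdot x (adj T y).
Proof. by move=> MT; rewrite adjP. Qed.

Lemma adj_dotr T x y : M T -> hdot x (T y) = hdot (adj T x) y.
Proof. by move=> MT; rewrite (adjoint_sym (adjP MT)). Qed.

Lemma adjK T : M T -> adj (adj T) = T.
Proof. by move=> MT; apply/adj_eq/adjoint_sym/adjP. Qed.

Lemma adj_id : adj id = id.
Proof. exact: adj_eq. Qed.

Lemma adj_add S T : M S -> M T -> adj (S + T) = adj S + adj T.
Proof.
by move=> MS MT; apply: adj_eq => x y; rewrite hdotDl !adj_dot// -hdotDr.
Qed.

Lemma adj_scale c T : M T -> adj (c *: T) = c^* *: adj T.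
Proof.
by move=> MT; apply: adj_eq => x y; rewrite hdotZl adj_dot// hdotZr conjK.
Qed.

Lemma adj_opp T : M T -> adj (- T) = - adj T.
Proof.
by move=> MT; apply: adj_eq => x y; rewrite hdotNl adj_dot// -hdotNr.
Qed.

Lemma adj_sub S T : M S -> M T -> adj (S - T) = adj S - adj T.
Proof. by move=> MS MT; rewrite adj_add ?adj_opp//; inM. Qed.

Lemma adj_comp S T : M S -> M T -> adj (S \o T) = adj T \o adj S.
Proof. by move=> MS MT; apply: adj_eq => x y; rewrite /= !adj_dot. Qed.

Lemma adj_sa T : sa_op T -> adj T = T.
Proof. exact: adj_eq. Qed.

Lemma sa_adj T : M T -> adj T = T -> sa_op T.
Proof. by move=> MT e; have := adjP MT; rewrite e. Qed.

Lemma opnorm_adj T r : M T -> opnorm_le T r -> opnorm_le (adj T) r.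
Proof. by move=> MT; apply: adjoint_opnorm; exact: adjP. Qed.

Lemma tau_add S T : M S -> M T -> tau (S + T) = tau S + tau T.
Proof. exact: (tvna_add hM). Qed.

Lemma tau_scale c T : M T -> tau (c *: T) = c * tau T.
Proof. exact: (tvna_scale hM). Qed.

Lemma tau_opp T : M T -> tau (- T) = - tau T.
Proof. by move=> MT; rewrite -scaleN1r tau_scale// mulN1r. Qed.

Lemma tau_sub S T : M S -> M T -> tau (S - T) = tau S - tau T.
Proof. by move=> MS MT; rewrite tau_add ?tau_opp//; inM. Qed.

Lemma tau_id : tau id = 1. Proof. exact: (tvna_unital hM). Qed.

Lemma tau_comm S T : M S -> M T -> tau (S \o T) = tau (T \o S).
Proof. exact: (tvna_tracial hM). Qed.

Lemma sa_dot_real T x : sa_op T -> Im (hdot (T x) x) = 0.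
Proof.
move=> sT; have : hdot (T x) x = (hdot (T x) x)^* by rewrite -hdot_conj sT.
case: (hdot _ _) => u v /= [e]; lra.
Qed.

Lemma sa_posP T : sa_op T -> (forall x, 0 <= Re (hdot (T x) x)) -> positive_op T.
Proof. by move=> sT h x; rewrite lecE /= sa_dot_real// eqxx h. Qed.

(** If r bounds T, then T + r is positive, so its trace tau T + r is a nonnegative real. *)
Lemma tau_sa_real T : M T -> sa_op T -> Im (tau T) = 0.
Proof.
move=> MT sT; have [r r0 hr] := M_bnd MT.
have p : positive_op (T + r%:C%C *: id).
  apply: sa_posP => [x y|x].
    by rewrite hdotDl hdotDr sT hdotZl hdotZr conjE /= oppr0.
  rewrite hdotDl hdotZl ReD ReZ -sqr_hnorm.
  have := hdot_le (T x) x; have := opnormE x hr; have := normRe_le (hdot (T x) x).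
  rewrite ler_norml => /andP[+ _]; have := hnorm_ge0 x.
  move: (normc _) (Re _) (hnorm (T x)) (hnorm x) => a b c d *; nra.
have := tvna_positive hM (M_add MT (M_scale r%:C%C M_id)) p.
rewrite tau_add// ?tau_scale ?tau_id ?mulr1; inM.
by case: (tau T) => u v; rewrite lecE /= addr0 => /andP[/eqP].
Qed.

Lemma tau_adj T : M T -> tau (adj T) = (tau T)^*.
Proof.
move=> MT.
have h1 : Im (tau (T + adj T)) = 0.
  apply: tau_sa_real; inM; apply: sa_adj; inM.
  by rewrite adj_add ?adjK 1?addrC//; inM.
have h2 : Im (tau ('i%C *: (T - adj T))) = 0.
  apply: tau_sa_real; inM; apply: sa_adj; inM.
  rewrite adj_scale ?adj_sub ?adjK//; inM.
  by rewrite -opprB scalerN -scaleNr; congr (_ *: _); rewrite conjE; apply/eqP;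
    rewrite eq_complex /= oppr0 opprK !eqxx.
move: h1 h2; rewrite tau_scale; inM.
rewrite (tau_add MT (M_adj MT)) (tau_sub MT (M_adj MT)).
case: (tau T) => a b; case: (tau _) => c d /= h1 h2.
by apply/eqP; rewrite eq_complex /=; apply/andP; split; apply/eqP; lra.
Qed.

Definition tdot S T : C := tau (adj T \o S).

Lemma comp_linD S T1 T2 : linear S -> S \o (T1 + T2) = (S \o T1) + (S \o T2).
Proof. by move=> lS; apply/funext => x /=; exact: lin_addE. Qed.

Lemma comp_linB S T1 T2 : linear S -> S \o (T1 - T2) = (S \o T1) - (S \o T2).
Proof. by move=> lS; apply/funext => x /=; exact: lin_subE. Qed.

Lemma comp_linZ S c T : linear S -> S \o (c *: T) = c *: (S \o T).
Proof. by move=> lS; apply/funext => x /=; exact: lin_scaleE. Qed.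

Lemma positive_adjM T : M T -> positive_op (adj T \o T).
Proof.
by move=> MT x; rewrite /= -adj_dotr ?adjK ?hdot_hnorm ?lecR ?sqr_ge0//; inM.
Qed.

Lemma tdot_sdot : sdot (M : (H -> H) -> Prop) tdot.
Proof.
split; rewrite /tdot.
- exact: M_0.
- by move=> *; inM.
- by move=> *; inM.
- by move=> x y z *; rewrite comp_linD ?tau_add//; [inM|inM|apply: M_lin; inM].
- by move=> c x z *; rewrite comp_linZ ?tau_scale//; [inM|apply: M_lin; inM].
- move=> x y Mx My; rewrite -tau_adj; inM.
  by rewrite (adj_comp (M_adj My) Mx) (adjK My).
- by move=> x Mx; apply: (tvna_positive hM); [inM|exact: positive_adjM].
Qed.

Definition n2 T : R := snorm tdot T.

Lemma n2_ge0 T : 0 <= n2 T. Proof. exact: snorm_ge0. Qed.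

Lemma sqr_n2 T : M T -> n2 T ^+ 2 = Re (tau (adj T \o T)).
Proof. by move=> MT; rewrite (sqr_snorm tdot_sdot). Qed.

Lemma n2D S T : M S -> M T -> n2 (S + T) <= n2 S + n2 T.
Proof. exact: (snormD tdot_sdot). Qed.

Lemma n2Z c T : M T -> n2 (c *: T) = normc c * n2 T.
Proof. exact: (snormZ tdot_sdot). Qed.

Lemma n2N T : M T -> n2 (- T) = n2 T.
Proof. exact: (snormN tdot_sdot). Qed.

Lemma n2B S T : M S -> M T -> n2 (S - T) = n2 (T - S).
Proof. exact: (snormB tdot_sdot). Qed.

Lemma n2_sub_le S T : M S -> M T -> n2 (S - T) <= n2 S + n2 T.
Proof. by move=> MS MT; rewrite -(n2N MT); apply: n2D => //; inM. Qed.

Lemma tdot_le S T : M S -> M T -> normc (tdot S T) <= n2 S * n2 T.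
Proof. exact: (cauchy_schwarz tdot_sdot). Qed.

Lemma n2_id : n2 id = 1.
Proof. by rewrite /n2 /snorm /tdot adj_id tau_id sqrtr1. Qed.

Lemma normc_tau_le T : M T -> normc (tau T) <= n2 T.
Proof.
move=> MT; rewrite -[leRHS]mulr1 -n2_id.
by have := tdot_le MT M_id; rewrite /tdot adj_id.
Qed.

Lemma tau_mono S T : M S -> M T -> positive_op (T - S) -> Re (tau S) <= Re (tau T).
Proof.
move=> MS MT ST; rewrite -subr_ge0 -ReB -tau_sub//.
by apply: Re_ge0; apply: (tvna_positive hM) => //; inM.
Qed.

Lemma n2_adj T : M T -> n2 (adj T) = n2 T.
Proof.
by move=> MT; rewrite /n2 /snorm /tdot adjK// tau_comm//; inM.
Qed.

(** The operator r^2 S^* S - (T S)^* (T S) is positive, and the trace is monotone. *)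
Lemma n2_mull T S r : M T -> M S -> opnorm_le T r -> n2 (T \o S) <= r * n2 S.
Proof.
move=> MT MS hr; have r0 := opnorm_ge0 hr.
have MTS : M (T \o S) by inM.
rewrite -(@ler_pXn2r _ 2) ?nnegrE ?mulr_ge0 ?n2_ge0// exprMn !sqr_n2//.
rewrite -ReZ -tau_scale; inM; apply: tau_mono; inM.
apply: sa_posP => [|x].
  apply: sa_adj; inM; rewrite adj_sub; inM; rewrite adj_scale; inM.
  rewrite (adj_comp (M_adj MS) MS) (adj_comp (M_adj MTS) MTS) !adjK//.
  by rewrite conjE /= oppr0.
rewrite hdotBl hdotZl ReB ReZ /= -!adj_dotr ?adjK//; inM.
rewrite -!sqr_hnorm subr_ge0 -exprMn ler_pXn2r ?nnegrE ?mulr_ge0 ?hnorm_ge0//.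
exact: opnormE.
Qed.

(** Passing to adjoints exchanges the two sides; it preserves the 2-norm because [tau] is
    tracial. *)
Lemma n2_mulr T S r : M T -> M S -> opnorm_le T r -> n2 (S \o T) <= r * n2 S.
Proof.
move=> MT MS hr; rewrite -n2_adj; inM; rewrite adj_comp// -(n2_adj MS).
by apply: n2_mull; inM; exact: opnorm_adj.
Qed.

Lemma n2_le_op T r : M T -> opnorm_le T r -> n2 T <= r.
Proof. by move=> MT /(n2_mull MT M_id); rewrite n2_id mulr1. Qed.

End TracialVNA.

Ltac inM := repeat (first [assumption | lazymatch goal with
  | hM : tracial_vna ?M _ |- ?M id => exact: (M_id hM)
  | hM : tracial_vna ?M _ |- ?M 0 => exact: (M_0 hM)
  | hM : tracial_vna ?M _ |- ?M (_ \o _) => apply: (M_comp hM)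
  | hM : tracial_vna ?M _ |- ?M (- _) => apply: (M_opp hM)
  | hM : tracial_vna ?M _ |- ?M (_ + _) => apply: (M_add hM)
  | hM : tracial_vna ?M _ |- ?M (_ *: _) => apply: (M_scale hM)
  | hM : tracial_vna ?M _ |- ?M (adj _) => apply: (M_adj hM)
  end]).

Lemma le_eps (R : realType) (a b K : R) :
  (forall e, 0 < e -> a <= b + e * K) -> a <= b.
Proof.
move=> h; apply/ler_addgt0Pr => e e0.
have K0 : 0 < `|K| + 1 by rewrite ltr_wpDl.
apply: le_trans (h _ (divr_gt0 e0 K0)) _; rewrite lerD2l.
rewrite -[leRHS](divfK (lt0r_neq0 K0)) ler_wpM2l ?divr_ge0 ?(ltW e0) ?(ltW K0)//.
by apply: le_trans (ler_norm K) _; rewrite lerDl.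
Qed.

(** * Monotone strong limits and Zorn's lemma for positive contractions *)

Section MonotoneLimits.
Variables (R : realType) (H : hilbert R) (M : set (H -> H)).
Variables (tau : (H -> H) -> R[i]).
Hypothesis hM : tracial_vna M tau.
Local Notation C := (R[i]).
Implicit Types (S T : H -> H).

Definition qf T x : R := Re (hdot (T x) x).

Definition qle S T := forall x, qf S x <= qf T x.

Definition contr S := [/\ M S, sa_op S, qle 0 S & qle S id].

Lemma qf0 x : qf 0 x = 0.
Proof. by rewrite /qf hdot0l. Qed.

Lemma qf_id x : qf id x = hnorm x ^+ 2.
Proof. by rewrite /qf -sqr_hnorm. Qed.

Lemma qfD S T x : qf (S + T) x = qf S x + qf T x.
Proof. by rewrite /qf hdotDl ReD. Qed.

Lemma qfB S T x : qf (S - T) x = qf S x - qf T x.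
Proof. by rewrite /qf hdotBl ReB. Qed.

Lemma qle_refl T : qle T T. Proof. by []. Qed.

Lemma qle_trans S T U : qle S T -> qle T U -> qle S U.
Proof. by move=> h k x; exact: le_trans (h x) (k x). Qed.

Lemma sa_add S T : sa_op S -> sa_op T -> sa_op (S + T).
Proof. by move=> sS sT x y; rewrite hdotDl hdotDr sS sT. Qed.

Lemma sa_sub S T : sa_op S -> sa_op T -> sa_op (S - T).
Proof. by move=> sS sT x y; rewrite hdotBl hdotBr sS sT. Qed.

Lemma sa_id : sa_op (id : H -> H). Proof. by []. Qed.

Lemma sa_0 : sa_op (0 : H -> H).
Proof. by move=> x y; rewrite hdot0l hdot0r. Qed.

Lemma sa_dot_qf T x : sa_op T -> hdot (T x) x = (qf T x)%:C%C.
Proof. by move=> /sa_dot_real => /(_ x); rewrite /qf; case: (hdot _ _) => u v /= ->. Qed.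

Lemma contr_pos S : contr S -> positive_op S.
Proof. by move=> [_ sS S0 _] x; rewrite sa_dot_qf// lecR -(qf0 x). Qed.

(** Cauchy-Schwarz for the form <P x, y> at y = P x gives |P x|^4 <= <P x, x> <P P x, P x>, and the
    second factor is at most |P x|^2. *)
Lemma contr_hnorm P x : contr P -> hnorm (P x) ^+ 2 <= qf P x.
Proof.
move=> [MP sP P0 P1]; have lP := M_lin hM MP.
have sd : sdot (fun _ : H => True) (fun x y => hdot (P x) y).
  split=> // [y1 y2 z _ _ _|c y z _ _|y z _ _|y _].
  - by rewrite lin_addE// hdotDl.
  - by rewrite lin_scaleE// hdotZl.
  - by rewrite -hdot_conj sP.
  - by rewrite sa_dot_qf// lecR -(qf0 y).
have a0 : 0 <= qf P x by rewrite -(qf0 x).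
have b0 : 0 <= qf P (P x) by rewrite -(qf0 (P x)).
have := cauchy_schwarz sd (I : True) (I : True) (x := x) (y := P x).
rewrite hdot_hnorm normcR ger0_norm ?sqr_ge0// /snorm -/(qf P x) -/(qf P (P x)).
rewrite -sqrtrM// => h.
have : (hnorm (P x) ^+ 2) ^+ 2 <= qf P x * hnorm (P x) ^+ 2.
  apply: (@le_trans _ _ (qf P x * qf P (P x))); last first.
    by rewrite ler_wpM2l// -qf_id.
  by rewrite -[leRHS](sqr_sqrtr (mulr_ge0 a0 b0)) ler_pXn2r ?nnegrE ?sqr_ge0 ?sqrtr_ge0.
have [->|Px0] := eqVneq (hnorm (P x)) 0; first by rewrite expr0n.
by rewrite [X in X <= _]expr2 ler_pM2r// exprn_gt0// lt_neqAle eq_sym Px0 hnorm_ge0.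
Qed.

Lemma contr_opnorm P : contr P -> opnorm_le P 1.
Proof.
move=> cP; apply/opnormP; split=> // x; rewrite mul1r.
rewrite -(@ler_pXn2r _ 2) ?nnegrE ?hnorm_ge0// -[leRHS]qf_id.
by apply: le_trans (contr_hnorm x cP) _; case: cP.
Qed.

Lemma contr_sub S T : contr S -> contr T -> qle S T -> contr (T - S).
Proof.
move=> [MS sS S0 S1] [MT sT T0 T1] ST; split; [inM|exact: sa_sub|..] => x; rewrite qfB.
  by rewrite qf0 subr_ge0.
by have := S0 x; have := T1 x; rewrite qf0; lra.
Qed.

Lemma qle_positive S T : sa_op S -> sa_op T -> qle S T -> positive_op (T - S).
Proof.
move=> sS sT ST x; rewrite hdotBl !sa_dot_qf// -rmorphB lecR subr_ge0; exact: ST.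
Qed.

Lemma tau_qle S T : M S -> M T -> sa_op S -> sa_op T -> qle S T ->
  Re (tau S) <= Re (tau T).
Proof. by move=> MS MT sS sT ST; apply: (tau_mono hM) => //; exact: qle_positive. Qed.

Definition chain_lim (D : set (H -> H)) T :=
  [/\ contr T, forall S, D S -> qle S T
    & forall x e, 0 < e -> exists2 S, D S &
        forall S', D S' -> qle S S' -> hnorm (S' x - T x) <= e].

(** For S below S' in the chain, S' - S is a positive contraction, so |(S' - S) x|^2 is at most the
    increment of the quadratic form at x, which is small near its supremum. This gives strong
    convergence, and strong closedness puts the limit in [M]. *)
Lemma vigier (D : set (H -> H)) : D !=set0 -> (forall S, D S -> contr S) ->
  (forall S T, D S -> D T -> qle S T \/ qle T S) ->
  exists T, chain_lim D T.
Proof.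
move=> [S0 DS0] Dc tot.
have key x e : 0 < e -> exists2 S, D S &
    forall S', D S' -> qle S S' -> hnorm (S' x - S x) <= e.
  move=> e0; pose A := [set qf S x | S in D].
  have hs : has_sup A.
    split; first by exists (qf S0 x), S0.
    by exists (qf id x) => _ [S DS <-]; case: (Dc _ DS).
  have [_ [S DS <-] hS] := sup_adherent (exprn_gt0 2 e0) hs.
  exists S => // S' DS' SS'.
  have /(contr_hnorm x) := contr_sub (Dc _ DS) (Dc _ DS') SS'.
  rewrite qfB => h; rewrite -(@ler_pXn2r _ 2) ?nnegrE ?hnorm_ge0 ?(ltW e0)//.
  have : qf S' x <= sup A by apply: sup_upper_bound => //; exists S'.
  by move: h hS; rewrite -[(S' - S) x]/(S' x - S x); lra.
have lim x : exists l, forall e, 0 < e -> exists2 S, D S &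
    forall S', D S' -> qle S S' -> hnorm (S' x - l) <= e.
  have i0 n : 0 < n.+1%:R^-1 :> R by rewrite invr_gt0.
  pose s n := projT1 (cid2 (key x _ (i0 n))).
  have Ds n : D (s n) by rewrite /s; case: cid2.
  have hs n S' : D S' -> qle (s n) S' -> hnorm (S' x - s n x) <= n.+1%:R^-1.
    by rewrite /s; case: cid2 => S /= _; exact.
  have [|l hl] := @hcauchy _ H (fun n => s n x).
    move=> e /invS_le[N hN]; exists N => n Nn.
    case: (tot _ _ (Ds N) (Ds n)) => [/(hs N _ (Ds n)) h|/(hs n _ (Ds N)) h].
      by apply: le_trans h _; exact: hN.
    by rewrite hnormB; apply: le_trans h _; exact: hN.
  exists l => e e0; have e20 : 0 < e / 2 by rewrite divr_gt0.
  have [N hN] := invS_le e20; have [K hK] := hl _ e20.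
  exists (s (maxn N K)) => // S' DS' /(hs _ _ DS') h.
  rewrite -(subrKA (s (maxn N K) x)); apply: le_trans (hnormD _ _) _.
  rewrite [leRHS]splitr lerD//; first by apply: le_trans h _; rewrite hN// leq_maxl.
  by rewrite hK// leq_maxr.
pose T x := projT1 (cid (lim x)).
have hT x e : 0 < e -> exists2 S, D S &
    forall S', D S' -> qle S S' -> hnorm (S' x - T x) <= e.
  by move=> e0; rewrite /T; case: cid => l /= /(_ _ e0).
have ub S S' : D S -> D S' -> exists U, [/\ D U, qle S U & qle S' U].
  by move=> DS DS'; case: (tot _ _ DS DS') => h; [exists S'|exists S]; split => //;
    exact: qle_refl.
have hT2 x y e : 0 < e -> forall S, D S -> exists S', [/\ D S', qle S S',
    hnorm (S' x - T x) <= e & hnorm (S' y - T y) <= e].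
  move=> e0 S DS; have [S1 DS1 h1] := hT x _ e0; have [S2 DS2 h2] := hT y _ e0.
  have [U [DU l1 l2]] := ub _ _ DS1 DS2; have [V [DV l3 l4]] := ub _ _ DS DU.
  exists V; split => //; first by apply: h1 => //; exact: qle_trans l4.
  by apply: h2 => //; exact: qle_trans l4.
have hn1 x : hnorm (T x) <= hnorm x.
  apply: (@le_eps _ _ _ 1) => e e0.
  have [S [DS _ h _]] := hT2 x x _ e0 _ DS0.
  have := opnormE x (contr_opnorm (Dc _ DS)); rewrite mul1r => h1.
  rewrite -[T x](subrK (S x)); apply: le_trans (hnormD _ _) _.
  by rewrite addrC mulr1 lerD// hnormB.
have lT : linear T.
  move=> a x y; apply/eqP; rewrite -subr_eq0; apply/eqP/hnorm_eq0.
  apply/eqP; rewrite eq_le hnorm_ge0 andbT.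
  apply: (@le_eps _ _ _ (normc a + 2)) => e e0; rewrite add0r.
  have [S [DS _ hx hy]] := hT2 x y _ e0 _ DS0.
  have [S' [DS' SS' hz _]] := hT2 (a *: x + y) x _ e0 _ DS.
  have [S1 DS1 h1] := hT x _ e0; have [S2 DS2 h2] := hT y _ e0.
  have [S3 DS3 h3] := hT (a *: x + y) _ e0.
  have [U [DU l1 l2]] := ub _ _ DS1 DS2; have [V [DV l3 l4]] := ub _ _ DS3 DU.
  have lV : linear V by case: (Dc _ DV) => MV _ _ _; exact: (M_lin hM MV).
  have -> : T (a *: x + y) - (a *: T x + T y) =
     - (V (a *: x + y) - T (a *: x + y)) + a *: (V x - T x) + (V y - T y).
    by rewrite lV; apply: hdot_inj => w; rewrite !(hdotBl, hdotDl, hdotZl, hdotNl); ring.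
  apply: le_trans (hnormD _ _) _; apply: (@le_trans _ _ ((e + normc a * e) + e)); last first.
    by rewrite mulrDr (mulrC e (normc a)) [e * 2]mulr_natr mulr2n; lra.
  apply: lerD; last by apply: h2 => //; exact: qle_trans l4.
  apply: le_trans (hnormD _ _) _; apply: lerD; first by rewrite hnormN; exact: h3.
  rewrite hnormZ ler_wpM2l ?normc_ge0//; apply: h1 => //; exact: qle_trans l4.
have bT : bounded_op T.
  by split=> //; exists 1; apply/opnormP; split=> // x; rewrite mul1r.
have MT : M T.
  apply: (vn_closed (tvna_vn hM)) => //.
  (* The final segments of the chain generate a filter that converges strongly to T. *)
  pose F := [set B : set (H -> H) | exists2 S, D S & forall S', D S' -> qle S S' -> B S'].
  apply: (@sot_closure_net _ _ _ _ F).
  - apply: Build_ProperFilter_ex => [B [S DS hS]|].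
      by exists S; apply: hS.
    split; first by exists S0.
      move=> P Q [S DS hS] [S' DS' hS']; have [U [DU l1 l2]] := ub _ _ DS DS'.
      exists U => // V DV UV; split; [apply: hS|apply: hS'] => //.
        exact: qle_trans UV.
      exact: qle_trans UV.
    by move=> P Q PQ [S DS hS]; exists S => // S' DS' SS'; apply/PQ/hS.
  - by exists S0 => // S' DS' _; case: (Dc _ DS').
  - by move=> x e e0; have [S DS hS] := hT x _ e0; exists S.
have dotT x y e : 0 < e -> forall S, D S -> exists S', [/\ D S', qle S S',
    normc (hdot (T x) y - hdot (S' x) y) <= e * hnorm y &
    normc (hdot x (T y) - hdot x (S' y)) <= e * hnorm x].
  move=> e0 S DS; have [S' [DS' SS' h1 h2]] := hT2 x y _ e0 _ DS.
  exists S'; split=> //; rewrite -(hdotBl, hdotBr).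
    by apply: le_trans (hdot_le _ _) _; rewrite ler_wpM2r ?hnorm_ge0// hnormB.
  by apply: le_trans (hdot_le _ _) _; rewrite mulrC ler_wpM2r ?hnorm_ge0// hnormB.
have sT : sa_op T.
  move=> x y; apply/eqP; rewrite -subr_eq0; apply/eqP/eq0_normc/eqP.
  rewrite eq_le normc_ge0 andbT.
  apply: (@le_eps _ _ _ (hnorm x + hnorm y)) => e e0; rewrite add0r.
  have [S [DS _ h1 h2]] := dotT x y _ e0 _ DS0.
  have -> : hdot (T x) y - hdot x (T y) =
    (hdot (T x) y - hdot (S x) y) - (hdot x (T y) - hdot x (S y)).
    by have [_ -> _ _] := Dc _ DS; ring.
  by apply: le_trans (le_normcD _ _) _; rewrite normcN mulrDr addrC lerD.
have qT x e : 0 < e -> forall S, D S -> exists2 S', D S' /\ qle S S' &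
    `|qf T x - qf S' x| <= e * hnorm x.
  move=> e0 S DS; have [S' [DS' SS' h1 _]] := dotT x x _ e0 _ DS.
  by exists S' => //; rewrite /qf -ReB; apply: le_trans (normRe_le _) h1.
have ST S : D S -> qle S T.
  move=> DS x; apply: (@le_eps _ _ _ (hnorm x)) => e e0.
  have [S' [DS' SS']] := qT x _ e0 _ DS; rewrite ler_norml => /andP[+ _].
  by have := SS' x; lra.
exists T; split=> //; split=> // x.
  by apply: le_trans (ST _ DS0 x); case: (Dc _ DS0).
apply: (@le_eps _ _ _ (hnorm x)) => e e0.
have [S' [DS' _]] := qT x _ e0 _ DS0; rewrite ler_norml => /andP[_].
by have [_ _ _ /(_ x)] := Dc _ DS'; lra.
Qed.

(** If all traces on the chain stayed below tau T - e, normality would bound tau T by the same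
    number. *)
Lemma chain_lim_tau (D : set (H -> H)) T : D !=set0 ->
  (forall S, D S -> contr S) ->
  (forall S T, D S -> D T -> qle S T \/ qle T S) ->
  chain_lim D T ->
  forall e, 0 < e -> exists2 S, D S & Re (tau T) - e < Re (tau S).
Proof.
move=> D0 Dc tot [cT ub hT] e e0; apply: contrapT => hn.
have [MT sT _ _] := cT.
pose c : C := (Re (tau T) - e)%:C%C.
have tS S : M S -> sa_op S -> tau S = (Re (tau S))%:C%C.
  by move=> MS sS; have := tau_sa_real hM MS sS; case: (tau S) => u v /= ->.
suff : tau T <= c by rewrite tS// lecR; lra.
apply: (tvna_normal hM D0 _ _ _ MT).
- by move=> S /Dc[].
- by move=> S /Dc; exact: contr_pos.
- move=> S1 S2 D1 D2; have [_ s1 _ _] := Dc _ D1; have [_ s2 _ _] := Dc _ D2.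
  case: (tot _ _ D1 D2) => h; [exists S2|exists S1]; split=> //; exact: qle_positive.
- by move=> S DS; apply: qle_positive => //; [case: (Dc _ DS)|exact: ub].
(* T is the least upper bound. A competitor T' is not assumed self-adjoint, but T' - S is positive,
   so <T' x, x> is real and may be compared with the limit of <S x, x>. *)
- move=> T' MT' hT' x.
  have Imz : Im (hdot (T' x) x) = 0.
    have [S DS] := D0; have := hT' _ DS x; rewrite -[(_ \- _) x]/(T' x - S x) hdotBl.
    have [_ sS _ _] := Dc _ DS; rewrite (sa_dot_qf x sS).
    by case: (hdot _ _) => u v; rewrite lecE /= oppr0 addr0 => /andP[/eqP].
  rewrite -[(_ \- _) x]/(T' x - T x) hdotBl (sa_dot_qf x sT) lecE.
  move: Imz; rewrite -/(Re _); case E : (hdot (T' x) x) => [u v] /= ->.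
  rewrite oppr0 addr0 eqxx /= subr_ge0.
  apply: (@le_eps _ _ _ (hnorm x)) => d d0.
  have [S DS hS] := hT x _ d0.
  have := hT' _ DS x; rewrite -[(_ \- _) x]/(T' x - S x) hdotBl.
  have [_ sS _ _] := Dc _ DS; rewrite (sa_dot_qf x sS) E lecE /= => /andP[_].
  have : `|qf S x - qf T x| <= d * hnorm x.
    rewrite -qfB; apply: le_trans (normRe_le _) _; apply: le_trans (hdot_le _ _) _.
    by rewrite ler_wpM2r ?hnorm_ge0//; exact: hS.
  rewrite ler_norml => /andP[+ _]; lra.
- move=> S DS; have [MS sS _ _] := Dc _ DS; rewrite tS// lecR leNgt; apply/negP => h.
  by apply: hn; exists S.
Qed.

(** The upper bound of a chain is its strong limit from [vigier]. Maximality is with respect to the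
    preorder [qle], hence the conclusion [qle T S]. *)
Lemma zorn_contr (X : set (H -> H)) : X !=set0 -> (forall S, X S -> contr S) ->
  (forall D T, D !=set0 -> D `<=` X ->
     (forall S T, D S -> D T -> qle S T \/ qle T S) -> chain_lim D T -> X T) ->
  exists2 S, X S & forall T, X T -> qle S T -> qle T S.
Proof.
move=> [S0 XS0] Xc Xlim.
pose Ty := {S : H -> H | X S}.
pose Rl (a b : Ty) := `[< qle (sval a) (sval b) >].
have [|||t tmax] := @ZL_preorder Ty (exist _ S0 XS0) Rl.
- by move=> t; apply/asboolP.
- by move=> r s t /asboolP h1 /asboolP h2; apply/asboolP; exact: qle_trans h2.
- move=> A tA; have [[a0 Aa0]|nA] := pselect (A !=set0); last first.
    by exists (exist _ S0 XS0) => s As; exfalso; apply: nA; exists s.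
  pose D := [set sval a | a in A].
  have D0 : D !=set0 by exists (sval a0), a0.
  have DX : D `<=` X by move=> _ [a _ <-]; exact: svalP.
  have Dt S T : D S -> D T -> qle S T \/ qle T S.
    move=> [a Aa <-] [b Ab <-].
    by case: (tA _ _ Aa Ab) => /asboolP; [left|right].
  have [T hT] := vigier D0 (fun S DS => Xc _ (DX _ DS)) Dt.
  exists (exist _ T (Xlim _ _ D0 DX Dt hT)) => s As; apply/asboolP => /=.
  by case: hT => _ + _; apply; exists s.
exists (sval t); first exact: svalP.
move=> T XT tT; have := tmax (exist _ T XT); rewrite /Rl /=.
by move=> h; apply/asboolP/h/asboolP.
Qed.

End MonotoneLimits.

(** * 2-norm density of polynomials *)

Lemma rcauchy (R : realType) (u : nat -> R) :
  (forall e, 0 < e -> exists N, forall n, (N <= n)%N -> `|u n - u N| <= e) ->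
  exists l, forall e, 0 < e -> exists N, forall n, (N <= n)%N -> `|u n - l| <= e.
Proof.
move=> cu; have : cvg (u @ \oo).
  apply: cauchy_cvg; suff : @cauchy_ex _ R (u @ \oo) by exact: cauchy_exP.
  move=> e e0; have [N hN] := cu (e / 2) (divr_gt0 e0 (ltr0Sn _ 1)).
  exists (u N); exists N => // n /= Nn; rewrite -ball_normE /= distrC.
  by apply: le_lt_trans (hN _ Nn) _; rewrite ltr_pdivrMr// mulr_natr mulr2n ltrDl.
move=> /cvg_ex[l /= ul]; exists l => e e0.
have /cvgrPdist_le/(_ e e0) [N _ hN] := ul; exists N => n Nn.
by have := hN n Nn; rewrite /= distrC.
Qed.

Lemma normc_le_ReIm (R : realType) (x : R[i]) : normc x <= `|Re x| + `|Im x|.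
Proof.
rewrite -(@ler_pXn2r _ 2) ?nnegrE ?addr_ge0 ?normc_ge0//.
rewrite sqr_normc' sqrrD !real_normK ?num_real// -addrA lerD2l lerDr.
by rewrite mulrn_wge0// mulr_ge0.
Qed.

Lemma normIm_le (R : realType) (x : R[i]) : `|Im x| <= normc x.
Proof.
rewrite -(@ler_pXn2r _ 2) ?nnegrE ?normc_ge0// real_normK ?num_real//.
by rewrite sqr_normc' lerDr sqr_ge0.
Qed.

Lemma ccauchy (R : realType) (u : nat -> R[i]) :
  (forall e, 0 < e -> exists N, forall n, (N <= n)%N -> normc (u n - u N) <= e) ->
  exists l, forall e, 0 < e -> exists N, forall n, (N <= n)%N -> normc (u n - l) <= e.
Proof.
move=> cu.
have ImB (x y : R[i]) : Im (x - y) = Im x - Im y by case: x; case: y.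
have [|a ha] := @rcauchy _ (fun n => Re (u n)).
  move=> e /cu[N hN]; exists N => n /hN; apply: le_trans; rewrite -ReB.
  exact: normRe_le.
have [|b hb] := @rcauchy _ (fun n => Im (u n)).
  move=> e /cu[N hN]; exists N => n /hN; apply: le_trans; rewrite -ImB.
  exact: normIm_le.
exists (a +i* b)%C => e e0; have e20 : 0 < e / 2 by rewrite divr_gt0.
have [N hN] := ha _ e20; have [K hK] := hb _ e20.
exists (maxn N K) => n; rewrite geq_max => /andP[/hN h1 /hK h2].
apply: le_trans (normc_le_ReIm _) _; rewrite ReB ImB /= [leRHS]splitr.
exact: lerD.
Qed.

Section TwoNormDensity.
Variables (R : realType) (H : hilbert R) (M : set (H -> H)).
Variables (tau : (H -> H) -> R[i]).
Hypothesis hM : tracial_vna M tau.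
Local Notation C := (R[i]).
Local Notation n2 := (n2 tau).
Local Notation tdot := (tdot tau).
Local Notation contr := (contr M).
Implicit Types (S T : H -> H).

(* For b in Jset, the map w |-> w b is continuous from the strong operator
   topology to the 2-norm. *)
Definition Jset b := M b /\ exists xi, forall w, M w -> n2 (w \o b) <= hnorm (w xi).

(** Each element of [Jset] comes with its own vector, and two such vectors do not merge into one; so
    sums are treated separately. *)
Inductive Jspan : (H -> H) -> Prop :=
| Jspan0 : Jspan 0
| JspanD b c of Jset b & Jspan c : Jspan (b + c).

Lemma Jset_mul T b : M T -> Jset b -> Jset (T \o b).
Proof.
move=> MT [Mb [xi h]]; split; first by inM.
by exists (T xi) => w Mw; have /h : M (w \o T) by inM.
Qed.

Lemma Jspan_M b : Jspan b -> M b.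
Proof. by elim=> [|{}b c [Mb _] _ Mc]; inM. Qed.

Lemma Jspan_mul T b : M T -> Jspan b -> Jspan (T \o b).
Proof.
move=> MT; have lT := M_lin hM MT; elim=> [|{}b c Jb _ IH].
  rewrite (_ : _ \o _ = 0); first exact: Jspan0.
  by apply/funext => x /=; exact: (lin_0E lT).
by rewrite comp_linD//; apply: JspanD => //; exact: Jset_mul.
Qed.

Lemma chain_lim_qf D T x e : chain_lim M D T -> 0 < e ->
  exists2 S, D S & qf T x <= qf S x + e * hnorm x.
Proof.
move=> [_ _ h] /(h x)[S DS hS]; exists S => //.
have := hS _ DS (@qle_refl _ _ S) => h1.
have : `|qf S x - qf T x| <= e * hnorm x.
  rewrite -qfB; apply: le_trans (normRe_le _) _; apply: le_trans (hdot_le _ _) _.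
  by rewrite ler_wpM2r ?hnorm_ge0.
by rewrite ler_norml => /andP[+ _]; lra.
Qed.

Lemma contr_0 : contr 0.
Proof.
split; [exact: (M_0 hM)|exact: sa_0|exact: qle_refl|].
by move=> x; rewrite qf0 qf_id sqr_ge0.
Qed.

Lemma tau_0 : tau 0 = 0.
Proof. by rewrite -(scale0r 0) (tau_scale hM) ?mul0r//; inM. Qed.

Lemma qf_adjM T x : M T -> qf (adj T \o T) x = hnorm (T x) ^+ 2.
Proof. by move=> MT; rewrite /qf /= -(adj_dotr hM) ?(adjK hM)// -?sqr_hnorm//; inM. Qed.

Lemma sa_adjM T : M T -> sa_op (adj T \o T).
Proof.
move=> MT; apply: (sa_adj hM); inM.
by rewrite (adj_comp hM (M_adj hM MT) MT) (adjK hM MT).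
Qed.

Lemma sa_scale (a : R) T : sa_op T -> sa_op (a%:C%C *: T).
Proof. by move=> sT x y; rewrite hdotZl hdotZr sT conjE /= oppr0. Qed.

Lemma qfZ (a : R) T x : qf (a%:C%C *: T) x = a * qf T x.
Proof. by rewrite /qf hdotZl ReZ. Qed.

(* A maximal x <= y with <x zeta, zeta> <= tau x, where tau y < <y zeta, zeta>,
   leaves a remainder y - x below which tau is dominated by the vector state
   of zeta. *)
Lemma Jset_below y : contr y -> y <> 0 ->
  exists y', [/\ contr y', qle y' y, Jset y' & y' <> 0].
Proof.
move=> cy y0; have [My sy y00 y1] := cy.
have [x0 yx0] : exists x0, y x0 <> 0.
  apply: contrapT => h; apply: y0; apply/funext => x; apply: contrapT => yx.
  by apply: h; exists x.
have q0 : 0 < qf y x0.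
  apply: lt_le_trans (contr_hnorm hM x0 cy); rewrite exprn_gt0// lt_neqAle hnorm_ge0 andbT eq_sym.
  by apply/eqP => /hnorm_eq0.
have [zeta hz] : exists zeta, Re (tau y) < qf y zeta.
  (* Scaling x0 by c >= 1 multiplies the form by c^2 >= c, and c <y x0, x0> = <y x0, x0> + |tau y|
     exceeds tau y. *)
  pose c := 1 + `|Re (tau y)| / qf y x0.
  have c1 : 1 <= c by rewrite lerDl divr_ge0// ltW.
  exists (c%:C%C *: x0); rewrite /qf (lin_scaleE (M_lin hM My)) hdotZl hdotZr mulrA.
  rewrite mulc_conj ReZ normcR real_normK ?num_real// -/(qf y x0).
  apply: lt_le_trans (_ : c * qf y x0 <= _); last first.
    by rewrite ler_wpM2r ?(ltW q0)// expr2 ler_peMr// (le_trans _ c1).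
  rewrite mulrDl divfK ?gt_eqF// mul1r.
  by have := ler_norm (Re (tau y)); lra.
pose X := [set x | [/\ contr x, qle x y & qf x zeta <= Re (tau x)]].
have [||D T [S0 DS0] DX _ DT|x [cx xy xz] xmax] := @zorn_contr _ _ _ _ hM X.
- exists 0; split; [exact: contr_0|by []|by rewrite qf0 tau_0].
- by move=> S [].
- have [cT ST _] := DT; split => //.
    move=> v; apply: (@le_eps _ _ _ (hnorm v)) => e e0.
    have [S /DX[_ Sy _] h] := chain_lim_qf v DT e0.
    by apply: le_trans h _; rewrite lerD2r; exact: Sy.
  apply: (@le_eps _ _ _ (hnorm zeta)) => e e0.
  have [S DS h] := chain_lim_qf zeta DT e0.
  have [[MS sS _ _] Sy Sz] := DX _ DS; have [MT sT _ _] := cT.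
  have := tau_qle hM MS MT sS sT (ST _ DS); lra.
have [Mx sx x00 x1] := cx.
have cy' := contr_sub hM cx cy xy; have [My' sy' y'0 y'1] := cy'.
exists (y - x); split=> //.
- by move=> v; rewrite qfB; have := x00 v; rewrite qf0; lra.
- split=> //; exists ((y - x) zeta) => w Mw.
  have [c c0 hc] := M_bnd hM Mw.
  have Mwy : M (w \o (y - x)) by inM.
  (* This z is |w (y - x)|^2 rescaled to lie below y - x. If the estimate failed for w, then <z
     zeta, zeta> < tau z, so x + z would be admissible; maximality would force z <= 0, contradicting
     tau z > 0. *)
  pose z := (c ^- 2)%:C%C *: (adj (w \o (y - x)) \o (w \o (y - x))).
  have Mz : M z by rewrite /z; inM.
  have qz v : qf z v = c ^- 2 * hnorm (w ((y - x) v)) ^+ 2 by rewrite qfZ qf_adjM.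
  have sz : sa_op z by apply/sa_scale/sa_adjM.
  have z0 : qle 0 z by move=> v; rewrite qf0 qz mulr_ge0 ?sqr_ge0// invr_ge0 sqr_ge0.
  have zy : qle z (y - x).
    move=> v; apply: le_trans (contr_hnorm hM v cy'); rewrite qz ler_pdivrMl ?exprn_gt0//.
    rewrite -exprMn ler_pXn2r ?nnegrE ?mulr_ge0 ?hnorm_ge0 ?(ltW c0)//.
    exact: opnormE.
  rewrite leNgt; apply/negP => hlt.
  have hlt2 : qf z zeta < Re (tau z).
    rewrite qz (tau_scale hM) ?ReZ -?(sqr_n2 hM)//; last by inM.
    by rewrite ltr_pM2l ?invr_gt0 ?exprn_gt0// ltr_pXn2r ?nnegrE ?hnorm_ge0 ?n2_ge0.
  have Xxz : X (x + z).
    have xzy : qle (x + z) y by move=> v; have := zy v; rewrite qfB qfD; lra.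
    split=> //; last by rewrite qfD (tau_add hM)// ReD; lra.
    split; [by inM|exact: sa_add| |exact: qle_trans y1].
    by move=> v; have := x00 v; have := z0 v; rewrite qfD qf0; lra.
  have xxz : qle x (x + z) by move=> v; have := z0 v; rewrite qfD qf0; lra.
  have z00 : qle z 0.
    by move=> v; have := xmax _ Xxz xxz v; rewrite qfD qf0; lra.
  have := tau_qle hM Mz (M_0 hM) sz (@sa_0 _ _) z00; rewrite tau_0 /=.
  by have := z0 zeta; rewrite qf0; lra.
- move=> e; have := congr1 (fun f => qf f zeta) e; rewrite /= qf0 qfB.
  by have := tau_qle hM Mx My sx sy xy; lra.
Qed.

(** P^2 <= P for a positive contraction. *)
Lemma contr_n2 P : contr P -> n2 P ^+ 2 <= Re (tau P).
Proof.
move=> cP; have [MP sP _ _] := cP; rewrite (sqr_n2 hM)//.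
apply: (tau_qle hM) => //; [by inM|exact: sa_adjM|].
by move=> v; rewrite qf_adjM//; exact: (contr_hnorm hM).
Qed.

(** Let x be maximal among the positive contractions that are 2-norm limits of [Jspan]. If id - x
    were nonzero, [Jset_below] would give a nonzero y' in [Jset] below it, and x + y' would be
    larger. For chain limits, normality makes tau (T - S) small, and [contr_n2] turns this into a
    small 2-norm. *)
Lemma Jspan_dense e : 0 < e -> exists2 c, Jspan c & n2 (id - c) <= e.
Proof.
pose X := [set x | contr x /\ forall e, 0 < e -> exists2 c, Jspan c & n2 (x - c) <= e].
have [||D T D0 DX tot DT|x [cx hx] xmax] := @zorn_contr _ _ _ _ hM X.
- exists 0; split; first exact: contr_0.
  move=> d d0; exists 0; first exact: Jspan0.
  by rewrite subrr /n2 (snorm0 (tdot_sdot hM)) ltW.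
- by move=> S [].
- have [cT ST _] := DT; split=> // d d0; have d20 : 0 < d / 2 by rewrite divr_gt0.
  have [S DS hS] := chain_lim_tau hM D0 (fun S DS => proj1 (DX S DS)) tot DT (exprn_gt0 2 d20).
  have [cS /(_ _ d20) [c Jc hc]] := DX _ DS; exists c => //.
  have Mc := Jspan_M Jc; have [MS _ _ _] := cS; have [MT _ _ _] := cT.
  rewrite -(subrKA S); apply: le_trans (n2D hM _ _) _; try inM.
  rewrite [leRHS]splitr lerD//.
  rewrite -(@ler_pXn2r _ 2) ?nnegrE ?n2_ge0 ?(ltW d20)//.
  apply: le_trans (contr_n2 (contr_sub hM cS cT (ST _ DS))) _.
  by rewrite (tau_sub hM)// ReB; move: hS; lra.
have [Mx sx x00 x1] := cx.
have cid : contr id.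
  split; [exact: (M_id hM)|exact: sa_id| |exact: qle_refl].
  by move=> v; rewrite qf0 qf_id sqr_ge0.
have cy := contr_sub hM cx cid x1.
suff : (id - x : H -> H) = 0.
  by move/eqP; rewrite subr_eq0 => /eqP ->; exact: hx.
apply: contrapT => y0; have [y' [cy' yy' Jy' y'0]] := Jset_below cy y0.
have [My' sy' y'00 y'1] := cy'.
have xy'1 : qle (x + y') id by move=> v; have := yy' v; rewrite qfB qfD; lra.
apply: y'0; apply/funext => v; apply: hnorm_eq0; apply/eqP.
rewrite -sqrf_eq0 eq_le sqr_ge0 andbT; apply: le_trans (contr_hnorm hM v cy') _.
have /xmax : X (x + y').
  split.
    split; [by inM|exact: sa_add| |exact: xy'1].
    by move=> u; have := x00 u; have := y'00 u; rewrite qfD qf0; lra.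
  move=> d /hx[c Jc hc]; exists (y' + c); first exact: JspanD.
  by rewrite [x + y']addrC opprD addrACA subrr add0r.
have hxy : qle x (x + y') by move=> u; have := y'00 u; rewrite qfD qf0; lra.
by move=> /(_ hxy v); rewrite qfD; lra.
Qed.

End TwoNormDensity.

(** * Operators commuting with the projection to the 2-norm closure of a *-algebra *)

Section DensityTheorem.
Variables (R : realType) (H : hilbert R) (M : set (H -> H)).
Variables (tau : (H -> H) -> R[i]).
Hypothesis hM : tracial_vna M tau.
Variable A : set (H -> H).
Hypotheses (AM : A `<=` M) (Aid : A id)
  (AD : forall S T, A S -> A T -> A (S + T))
  (AZ : forall c T, A T -> A (c *: T))
  (Acomp : forall S T, A S -> A T -> A (S \o T))
  (Aadj : forall T, A T -> A (adj T)).
Local Notation C := (R[i]).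
Local Notation n2 := (n2 tau).
Local Notation tdot := (tdot tau).
Local Notation Jset := (Jset M tau).
Local Notation Jspan := (Jspan M tau).
Implicit Types (S T u v : H -> H).

Let tS := tdot_sdot hM.

Lemma A_sdot : sdot (A : (H -> H) -> Prop) tdot.
Proof.
split=> //.
- by rewrite -(scale0r id); exact: AZ.
- by move=> x y z /AM Mx /AM My /AM Mz; exact: (sdotDl tS).
- by move=> c x z /AM Mx /AM Mz; exact: (sdotZl tS).
- by move=> x y /AM Mx /AM My; exact: (sdotC tS).
- by move=> x /AM; exact: (sdot_ge0 tS).
Qed.

(* a is an e-approximation of the orthogonal projection of v to the 2-norm
   closure of A. *)
Definition approx_proj e v a :=
  A a /\ forall c, A c -> normc (tdot c a - tdot c v) <= e * n2 c.

Lemma approx_proj_ex e v : M v -> 0 < e -> exists a, approx_proj e v a.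
Proof.
move=> Mv e0.
have [|||a Aa ha] := @approx_riesz _ _ _ _ A_sdot (fun c => tdot c v) (n2 v) _ _ _ e e0.
- by move=> x y /AM Mx /AM My; exact: (sdotDl tS).
- by move=> c x /AM Mx; exact: (sdotZl tS).
- by move=> x /AM Mx; rewrite mulrC; exact: (tdot_le hM).
- by exists a.
Qed.

Lemma approx_proj_n2 e v a : M v -> 0 < e -> approx_proj e v a -> n2 a <= e + n2 v.
Proof.
move=> Mv e0 [Aa /(_ _ Aa)]; have Ma := AM Aa.
rewrite (sdot_snorm tS)// -/(n2 a) => h.
have h2 := tdot_le hM Ma Mv.
have : n2 a ^+ 2 <= (e + n2 v) * n2 a.
  apply: le_trans (_ : normc ((n2 a ^+ 2)%:C%C - tdot a v) + normc (tdot a v) <= _).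
    apply: le_trans (le_normcD _ _); rewrite subrK normcR.
    by rewrite ger0_norm ?sqr_ge0.
  by rewrite mulrDl lerD// mulrC.
have := n2_ge0 tau a; rewrite le_eqVlt => /predU1P[<- _|n0].
  by rewrite addr_ge0 ?n2_ge0 ?ltW.
by rewrite expr2 ler_pM2r.
Qed.

Lemma approx_proj_close e d v a b : M v -> 0 < e -> 0 < d ->
  approx_proj e v a -> approx_proj d v b -> n2 (a - b) <= e + d.
Proof.
move=> Mv e0 d0 [Aa ha] [Ab hb].
have Aab : A (a - b) by exact: (sdB A_sdot).
have Ma := AM Aa; have Mb := AM Ab; have Mab := AM Aab.
have : n2 (a - b) ^+ 2 <= (e + d) * n2 (a - b).
  rewrite (sqr_snorm tS)// (sdotBr tS)//.
  have -> : tdot (a - b) a - tdot (a - b) b =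
    (tdot (a - b) a - tdot (a - b) v) - (tdot (a - b) b - tdot (a - b) v) by ring.
  apply: le_trans (Re_le_normc _) _; apply: le_trans (le_normcD _ _) _.
  by rewrite normcN mulrDl lerD ?ha ?hb.
have := n2_ge0 tau (a - b); rewrite le_eqVlt => /predU1P[<- _|n0].
  by rewrite addr_ge0 ?ltW.
by rewrite expr2 ler_pM2r.
Qed.

(* b = <u, P v>, P being the orthogonal projection to the closure of A *)
Definition is_beta u v b := exists K, forall e a, 0 < e -> e <= 1 ->
  approx_proj e v a -> normc (tdot u a - b) <= e * K.

Lemma is_beta_uniq u v b b' : M v -> is_beta u v b -> is_beta u v b' -> b = b'.
Proof.
move=> Mv [K h] [K' h']; apply/eqP; rewrite -subr_eq0; apply/eqP/eq0_normc/eqP.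
rewrite eq_le normc_ge0 andbT.
apply: (@le_eps _ _ _ (`|K| + `|K'|)) => e e0; rewrite add0r.
pose d := Num.min e 1; have d0 : 0 < d by rewrite lt_min e0 ltr01.
have [a ha] := approx_proj_ex Mv d0.
have -> : b - b' = (tdot u a - b') - (tdot u a - b) by ring.
apply: le_trans (le_normcD _ _) _; rewrite normcN mulrDr addrC.
have dK x : d * x <= e * `|x|.
  apply: le_trans (_ : d * `|x| <= _); first by rewrite ler_wpM2l ?ler_norm ?(ltW d0).
  by rewrite ler_wpM2r// /d ge_min lexx.
have d1 : d <= 1 by rewrite /d ge_min lexx orbT.
by apply: lerD; [apply: le_trans (h _ _ _ _ ha) _|apply: le_trans (h' _ _ _ _ ha) _].
Qed.

Definition beta u v : C := xget 0 [set b | is_beta u v b].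

(** Approximations of precision e and 1/(n+1) differ by at most the sum of both, so <u, a_n> is
    Cauchy and its limit is approached at rate [n2 u]. *)
Lemma betaP u v : M u -> M v -> is_beta u v (beta u v).
Proof.
move=> Mu Mv; suff [b hb] : exists b, is_beta u v b.
  by rewrite /beta; case: xgetP => [c _ //|/(_ b)/(_ hb)].
have i0 n : 0 < n.+1%:R^-1 :> R by rewrite invr_gt0.
pose a n := projT1 (cid (approx_proj_ex Mv (i0 n))).
have aP n : approx_proj n.+1%:R^-1 v (a n) by rewrite /a; case: cid.
have Ma n : M (a n) by case: (aP n) => /AM.
have ab e d x y : 0 < e -> 0 < d -> approx_proj e v x -> approx_proj d v y ->
    normc (tdot u x - tdot u y) <= n2 u * (e + d).
  move=> e0 d0 hx hy; have [Mx My] : M x /\ M y by case: hx => /AM ? _; case: hy => /AM.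
  rewrite -(sdotBr tS)//; apply: le_trans (tdot_le hM _ _) _; try inM.
  by rewrite ler_wpM2l ?n2_ge0//; exact: (approx_proj_close Mv).
have [|b hb] := @ccauchy _ (fun n => tdot u (a n)).
  move=> e e0; have K0 : 0 < n2 u + 1 by rewrite ltr_wpDl ?n2_ge0.
  have [N hN] := invS_le (divr_gt0 (divr_gt0 e0 (ltr0Sn _ 1)) K0).
  exists N => n Nn; apply: le_trans (ab _ _ _ _ (i0 _) (i0 _) (aP n) (aP N)) _.
  apply: le_trans (_ : (n2 u + 1) * (e / 2 / (n2 u + 1) + e / 2 / (n2 u + 1)) <= _); last first.
    by rewrite -mulrDl -splitr mulrC divfK// gt_eqF.
  rewrite ler_pM ?n2_ge0 ?addr_ge0 ?(ltW (i0 _))// ?lerDl//.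
  by rewrite lerD// hN.
exists b, (n2 u) => e x e0 _ hx.
apply: (@le_eps _ _ _ (n2 u + 1)) => d d0.
have [N hN] := hb _ d0; have [K hK] := invS_le d0.
pose n := maxn N K.
have -> : tdot u x - b = (tdot u x - tdot u (a n)) + (tdot u (a n) - b) by ring.
apply: le_trans (le_normcD _ _) _.
have h1 := ab _ _ _ _ e0 (i0 n) hx (aP n); have h2 := hN n (leq_maxl _ _).
have h3 : n2 u * (e + n.+1%:R^-1) <= n2 u * (e + d).
  by rewrite ler_wpM2l ?n2_ge0// lerD2l hK// leq_maxr.
apply: le_trans (lerD (le_trans h1 h3) h2) _; lra.
Qed.

Lemma beta_eq u v b : M u -> M v -> is_beta u v b -> beta u v = b.
Proof. by move=> Mu Mv; exact: (is_beta_uniq Mv (betaP Mu Mv)). Qed.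

Lemma betaDl u u' v : M u -> M u' -> M v -> beta (u + u') v = beta u v + beta u' v.
Proof.
move=> Mu Mu' Mv; apply: beta_eq; [by inM|by []|].
have [K h] := betaP Mu Mv; have [K' h'] := betaP Mu' Mv.
exists (K + K') => e a e0 e1 ha; have Ma : M a by case: ha => /AM.
rewrite (sdotDl tS)// opprD addrACA mulrDr; apply: le_trans (le_normcD _ _) _.
by rewrite lerD ?h ?h'.
Qed.

Lemma betaZl c u v : M u -> M v -> beta (c *: u) v = c * beta u v.
Proof.
move=> Mu Mv; apply: beta_eq; [by inM|by []|].
have [K h] := betaP Mu Mv.
exists (normc c * K) => e a e0 e1 ha; have Ma : M a by case: ha => /AM.
rewrite (sdotZl tS)// -mulrBr normcM mulrCA ler_wpM2l ?normc_ge0//.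
exact: h.
Qed.

Lemma betaBl u u' v : M u -> M u' -> M v -> beta (u - u') v = beta u v - beta u' v.
Proof.
by move=> Mu Mu' Mv; rewrite betaDl// -1?scaleN1r ?betaZl ?mulN1r//; inM.
Qed.

Lemma beta_le u v : M u -> M v -> normc (beta u v) <= n2 u * n2 v.
Proof.
move=> Mu Mv; have [K h] := betaP Mu Mv.
apply: (@le_eps _ _ _ (n2 u + `|K|)) => e e0.
pose d := Num.min e 1; have d0 : 0 < d by rewrite lt_min e0 ltr01.
have d1 : d <= 1 by rewrite /d ge_min lexx orbT.
have de : d <= e by rewrite /d ge_min lexx.
have [a ha] := approx_proj_ex Mv d0; have Ma : M a by case: ha => /AM.
have -> : beta u v = tdot u a - (tdot u a - beta u v) by ring.
apply: le_trans (le_normcD _ _) _; rewrite normcN.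
have h1 := h _ _ d0 d1 ha; have h2 := tdot_le hM Mu Ma.
have h3 : n2 u * n2 a <= n2 u * (d + n2 v).
  by rewrite ler_wpM2l ?n2_ge0//; exact: (approx_proj_n2 Mv d0 ha).
have h4 : d * K <= e * `|K|.
  apply: le_trans (_ : d * `|K| <= _); first by rewrite ler_wpM2l ?ler_norm ?(ltW d0).
  by rewrite ler_wpM2r.
have h5 : n2 u * d <= n2 u * e by rewrite ler_wpM2l ?n2_ge0.
apply: le_trans (lerD (le_trans h2 h3) (le_trans h1 h4)) _; lra.
Qed.

(** The restriction e <= 1 in [is_beta] serves to bound all approximations by a constant, as needed
    wherever two approximations are paired. *)
Lemma approx_proj_n2_1 e v a : M v -> 0 < e -> e <= 1 -> approx_proj e v a ->
  n2 a <= 1 + n2 v.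
Proof. by move=> Mv e0 e1 /(approx_proj_n2 Mv e0)/le_trans; apply; rewrite lerD2r. Qed.

(** Both sides are <P u, P v>: for approximations a of P v and a' of P u, the numbers <u, a>, <a',
    a> and <a', v> agree up to multiples of e. *)
Lemma beta_conj u v : M u -> M v -> beta u v = (beta v u)^*.
Proof.
move=> Mu Mv; apply: beta_eq => //.
have [K h] := betaP Mv Mu.
exists ((1 + n2 v) + (1 + n2 u) + K) => e a e0 e1 ha; have Ma : M a by case: ha => /AM.
have [a' ha'] := approx_proj_ex Mu e0; have Ma' : M a' by case: ha' => /AM.
have -> : tdot u a - (beta v u)^* = (tdot a u - tdot a a')^* +
   (tdot a' a - tdot a' v) + (tdot v a' - beta v u)^*.
  by rewrite ![(_ - _)^*]rmorphB /= -!(sdotC tS)//; ring.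
apply: le_trans (le_normcD _ _) _; rewrite mulrDr lerD//; last first.
  by rewrite normc_conj; exact: h ha'.
apply: le_trans (le_normcD _ _) _; rewrite mulrDr normc_conj normcB lerD//.
  case: (ha') => _ /(_ a); case: (ha) => Aa _ /(_ Aa) h1; apply: le_trans h1 _.
  by rewrite ler_wpM2l ?(ltW e0)//; exact: (approx_proj_n2_1 Mv e0 e1 ha).
case: (ha) => _ /(_ a'); case: (ha') => Aa _ /(_ Aa) h1; apply: le_trans h1 _.
by rewrite ler_wpM2l ?(ltW e0)//; exact: (approx_proj_n2_1 Mu e0 e1 ha').
Qed.

Lemma beta_id v : M v -> beta id v = tdot id v.
Proof.
move=> Mv; apply: beta_eq => //; first by inM.
by exists (n2 id) => e a _ _ [_ /(_ _ Aid)].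
Qed.

Lemma tdot_comp a u w : M a -> M u -> M w -> tdot (a \o u) w = tdot u (adj a \o w).
Proof.
by move=> Ma Mu Mw; rewrite /tdot (adj_comp hM (M_adj hM Ma) Mw) (adjK hM Ma).
Qed.

(* T commutes with the projection to the 2-norm closure of A, stated through
   matrix entries because M need not be complete for the 2-norm. These T form
   a von Neumann algebra containing A, hence containing W*(Y). *)
Definition commP : set (H -> H) := [set T | M T /\ forall u v, Jset u -> Jset v ->
  beta (T \o u) v = beta u (adj T \o v)].

(** [A] is invariant under left multiplication by a and by its adjoint, so products of these with
    approximations remain in [A] and may be tested against other approximations. *)
Lemma commP_A a : A a -> commP a.
Proof.
move=> Aa; have Ma := AM Aa; split=> // u v [Mu _] [Mv _].
have Mav : M (adj a \o v) by inM.
have Mau : M (a \o u) by inM.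
apply: beta_eq; [exact: Mau|exact: Mv|].
have [K h] := betaP Mav Mu; have [r r0 hr] := M_bnd hM Ma.
exists (r * (1 + n2 v) + r * (1 + n2 u) + K) => e w e0 e1 hw.
have Mw : M w by case: hw => /AM.
have [a' ha'] := approx_proj_ex Mu e0; have Ma' : M a' by case: ha' => /AM.
have Maw : M (adj a \o w) by inM.
have Maa' : M (a \o a') by inM.
rewrite (beta_conj Mu Mav) (tdot_comp Ma Mu Mw).
have -> : tdot u (adj a \o w) - (beta (adj a \o v) u)^* =
   (tdot (adj a \o w) u - tdot (adj a \o w) a')^* +
   (tdot (a \o a') w - tdot (a \o a') v) +
   (tdot (adj a \o v) a' - beta (adj a \o v) u)^*.
  rewrite ![(_ - _)^*]rmorphB /= -!(sdotC tS)//.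
  by rewrite (tdot_comp Ma Ma' Mw) (tdot_comp Ma Ma' Mv); ring.
apply: le_trans (le_normcD _ _) _; rewrite mulrDr lerD//; last first.
  by rewrite normc_conj; exact: h ha'.
apply: le_trans (le_normcD _ _) _; rewrite mulrDr normc_conj normcB lerD//.
  have Aaw : A (adj a \o w) by apply: Acomp; [exact: Aadj|case: hw].
  case: (ha') => _ /(_ _ Aaw) h1; apply: le_trans h1 _.
  rewrite ler_wpM2l ?(ltW e0)//; apply: le_trans (n2_mull hM _ Mw (opnorm_adj hM Ma hr)) _; first by inM.
  by rewrite ler_wpM2l ?(ltW r0)//; exact: (approx_proj_n2_1 Mv e0 e1 hw).
have Aaa : A (a \o a') by apply: Acomp => //; case: ha'.
case: (hw) => _ /(_ _ Aaa) h1; apply: le_trans h1 _.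
rewrite ler_wpM2l ?(ltW e0)//; apply: le_trans (n2_mull hM Ma Ma' hr) _.
by rewrite ler_wpM2l ?(ltW r0)//; exact: (approx_proj_n2_1 Mu e0 e1 ha').
Qed.

(** The bound by |T xi| makes phi descend to the subspace of vectors T xi, where [riesz] applies. *)
Lemma riesz_op (phi : (H -> H) -> C) K xi :
  (forall S T, M S -> M T -> phi (S + T) = phi S + phi T) ->
  (forall c T, M T -> phi (c *: T) = c * phi T) ->
  (forall T, M T -> normc (phi T) <= K * hnorm (T xi)) ->
  exists z, forall T, M T -> phi T = hdot (T xi) z.
Proof.
move=> phiD phiZ phiK.
pose E x := exists2 T, M T & T xi = x.
have Eq S T : M S -> M T -> S xi = T xi -> phi S = phi T.
  move=> MS MT e; apply/eqP; rewrite -subr_eq0 -mulN1r -phiZ// -phiD//; try inM.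
  apply/eqP/eq0_normc/eqP; rewrite eq_le normc_ge0 andbT scaleN1r.
  apply: le_trans (phiK _ _) _; first by inM.
  by rewrite -[(S - T) xi]/(S xi - T xi) e subrr hnorm0 mulr0.
pose psi x := if pselect (E x) is left h then phi (projT1 (cid2 h)) else 0.
have psiE T : M T -> psi (T xi) = phi T.
  move=> MT; rewrite /psi; case: pselect => [h|[]]; last by exists T.
  by case: cid2 => S /= MS e; exact: Eq.
have [|||||| z hz] := @riesz _ H E psi K.
- by exists 0 => //; inM.
- by move=> _ _ [S MS <-] [T MT <-]; exists (S + T) => //; inM.
- by move=> c _ [S MS <-]; exists (c *: S) => //; inM.
- move=> _ _ [S MS <-] [T MT <-]; rewrite -[S xi + T xi]/((S + T) xi) !psiE//; try inM.
  exact: phiD.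
- move=> c _ [S MS <-]; rewrite -[c *: S xi]/((c *: S) xi) !psiE//; try inM.
  exact: phiZ.
- by move=> _ [S MS <-]; rewrite psiE//; exact: phiK.
- by exists z => T MT; rewrite -psiE// hz//; exists T.
Qed.

Lemma beta_riesz u v : Jset u -> Jset v ->
  exists xi z, forall T, M T -> beta (T \o u) v = hdot (T xi) z.
Proof.
move=> [Mu [xi hxi]] [Mv _]; exists xi.
apply: (@riesz_op _ (n2 v)).
- move=> S T MS MT; rewrite -betaDl//; inM.
- by move=> c T MT; rewrite -betaZl//; inM.
- move=> T MT; apply: le_trans (beta_le _ _) _ => //; first by inM.
  by rewrite mulrC ler_wpM2l ?n2_ge0 ?hxi.
Qed.

(** Strong closedness is the reason for restricting u and v to [Jset]: by [beta_riesz] the two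
    entries are <T xi, z> and the conjugate of <adj T xi', z'>. The adjoint, which is not strongly
    continuous, is moved across the inner product, and both become strongly continuous in T. *)
Lemma commP_vn : von_neumann commP.
Proof.
split.
- by move=> T [MT _]; exact: (vn_bounded (tvna_vn hM)).
- exact/commP_A/Aid.
- move=> S T [MS hS] [MT hT]; split; first exact: (M_add hM).
  move=> u v Ju Jv; have [Mu Mv] : M u /\ M v by case: Ju; case: Jv.
  rewrite (_ : _ \o u = (S \o u) + (T \o u))//.
  rewrite betaDl//; try inM.
  rewrite hS// hT// -[S \+ T]/(S + T) (adj_add hM)//.
  rewrite (_ : (adj S + adj T) \o v = (adj S \o v) + (adj T \o v))//.
  rewrite [RHS]beta_conj ?betaDl; try inM.
  by rewrite rmorphD /= -!beta_conj//; inM.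
- move=> c T [MT hT]; split; first exact: (M_scale hM).
  move=> u v Ju Jv; have [Mu Mv] : M u /\ M v by case: Ju; case: Jv.
  rewrite (_ : _ \o u = c *: (T \o u))// betaZl; try inM.
  rewrite hT// -[c \*: T]/(c *: T) (adj_scale hM)//.
  rewrite (_ : (c^* *: adj T) \o v = c^* *: (adj T \o v))//.
  rewrite [RHS]beta_conj ?betaZl; try inM.
  by rewrite conjM conjK -beta_conj//; inM.
- move=> S T [MS hS] [MT hT]; split; first exact: (M_comp hM).
  move=> u v Ju Jv; rewrite (adj_comp hM)//.
  have JTu := Jset_mul hM MT Ju; have JSv := Jset_mul hM (M_adj hM MS) Jv.
  exact: etrans (hS _ _ JTu Jv) (hT _ _ Ju JSv).
- move=> T [MT hT]; exists (adj T); last exact: (adjP hM).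
  split; first by inM.
  move=> u v Ju Jv; have [Mu Mv] : M u /\ M v by case: Ju; case: Jv.
  rewrite (adjK hM)// [LHS]beta_conj; try inM.
  by rewrite -hT// -beta_conj//; inM.
- move=> T bT cT; have MT : M T.
    by apply: (vn_closed (tvna_vn hM)) => // B /cT[S [[MS _] BS]]; exists S.
  split=> // u v Ju Jv; have [Mu Mv] : M u /\ M v by case: Ju; case: Jv.
  have [xi [z hz]] := beta_riesz Ju Jv; have [xi' [z' hz']] := beta_riesz Jv Ju.
  have h S : M S -> (beta (S \o u) v = beta u (adj S \o v)) <->
      hdot (S xi) z - hdot (S z') xi' = 0.
    move=> MS; have MS' := M_adj hM MS.
    have MSv : M (adj S \o v) by inM.
    rewrite (hz _ MS) (beta_conj Mu MSv).
    rewrite (hz' _ MS') -hdot_conj -(adj_dot hM z' xi' MS).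
    by split => [->|/eqP]; rewrite ?subrr// subr_eq0 => /eqP.
  apply/h => //; apply/eq0_normc/eqP; rewrite eq_le normc_ge0 andbT.
  apply: (@le_eps _ _ _ (hnorm z + hnorm xi')) => e e0; rewrite add0r.
  have [S [MS hS] hST] := sot_closure cT [:: xi; z'] e0.
  have /h-/(_ MS) hS0 := hS u v Ju Jv.
  have -> : hdot (T xi) z - hdot (T z') xi' =
    hdot (S z' - T z') xi' - hdot (S xi - T xi) z.
    rewrite !hdotBl; apply/eqP; rewrite -subr_eq0; apply/eqP.
    by rewrite -[RHS]hS0; ring.
  apply: le_trans (le_normcD _ _) _; rewrite normcN mulrDr addrC lerD//.
    by apply: le_trans (hdot_le _ _) _; rewrite ler_wpM2r ?hnorm_ge0 ?hST// !inE eqxx.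
  by apply: le_trans (hdot_le _ _) _; rewrite ler_wpM2r ?hnorm_ge0 ?hST// !inE eqxx orbT.
Qed.

Lemma beta_sumJ T u v : commP T -> Jspan u -> Jspan v ->
  beta (T \o u) v = beta u (adj T \o v).
Proof.
move=> [MT hT] Ju Jv; have lT := M_lin hM MT; have MT' := M_adj hM MT.
have lT' := M_lin hM MT'.
have b0 w : M w -> beta 0 w = 0.
  by move=> Mw; rewrite -(scale0r id) betaZl ?mul0r//; inM.
have comp0 S : linear S -> S \o (0 : H -> H) = 0.
  by move=> lS; apply/funext => x /=; exact: lin_0E.
elim: Ju => [|b c Jb Jc IH]; first by rewrite comp0// !b0//; [inM; exact: Jspan_M Jv|exact: Jspan_M Jv].
have [Mb Mc Mv] : [/\ M b, M c & M v] by split; [case: Jb|exact: Jspan_M Jc|exact: Jspan_M Jv].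
rewrite comp_linD// !betaDl//; try inM.
rewrite IH; congr (_ + _) => {IH Jc Mc c}.
elim: Jv Mv => [_|d c Jd Jc IH _].
  by rewrite comp0// !(beta_conj _ (M_0 hM)) ?b0//; inM.
have [Md Mc] : M d /\ M c by split; [case: Jd|exact: Jspan_M Jc].
rewrite comp_linD// beta_conj; try inM.
rewrite [RHS]beta_conj; try inM.
rewrite !betaDl; try inM.
rewrite !rmorphD /= -!(beta_conj _ _); try inM.
by rewrite IH// hT.
Qed.

(** The aim is <T, P T> = <T, T>, which says that T is its own projection. For v in [Jspan],
    approximating id by c in [Jspan] gives beta T v = beta id (adj T v) = <T, v>, since id lies in
    [A]. Then T itself is approximated by T c, again in [Jspan]. *)
Lemma commP_dense T : commP T -> forall e, 0 < e -> exists2 a, A a & n2 (T - a) <= e.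
Proof.
move=> cT; have [MT _] := cT; have MT' := M_adj hM MT.
have [r r0 hr] := M_bnd hM MT.
have h1 v : Jspan v -> beta T v = tdot T v.
  move=> Jv; have Mv := Jspan_M hM Jv.
  have -> : tdot T v = beta id (adj T \o v).
    rewrite beta_id; last by inM.
    by rewrite -tdot_comp//; inM.
  apply/eqP; rewrite -subr_eq0; apply/eqP/eq0_normc/eqP.
  rewrite eq_le normc_ge0 andbT.
  apply: (@le_eps _ _ _ (r * n2 v + n2 (adj T \o v))) => e e0; rewrite add0r.
  have [c Jc hc] := Jspan_dense hM e0; have Mc := Jspan_M hM Jc.
  have -> : beta T v - beta id (adj T \o v) =
      beta (T \o (id - c)) v - beta (id - c) (adj T \o v).
    rewrite (comp_linB _ _ (M_lin hM MT)) !betaBl//; try inM.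
    by rewrite (beta_sumJ cT Jc Jv) -[T \o id]/T opprB addrA subrK.
  apply: le_trans (le_normcD _ _) _; rewrite normcN mulrDr lerD//.
    apply: le_trans (beta_le _ _) _; try inM.
    rewrite mulrA ler_wpM2r ?n2_ge0//; apply: le_trans (n2_mull hM _ _ hr) _; try inM.
    by rewrite mulrC ler_wpM2r ?(ltW r0).
  apply: le_trans (beta_le _ _) _; try inM.
  by rewrite ler_wpM2r ?n2_ge0.
have h2 : beta T T = tdot T T.
  apply/eqP; rewrite -subr_eq0; apply/eqP/eq0_normc/eqP.
  rewrite eq_le normc_ge0 andbT.
  apply: (@le_eps _ _ _ (n2 T * r + n2 T * r)) => e e0; rewrite add0r.
  have [c Jc hc] := Jspan_dense hM e0; have Mc := Jspan_M hM Jc.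
  have JTc := Jspan_mul hM MT Jc.
  have MTc : M (T \o c) by inM.
  have MTd : M (T \o (id - c)) by inM.
  have TE : T = (T \o c) + (T \o (id - c)).
    by rewrite (comp_linB _ _ (M_lin hM MT)) -[T \o id]/T addrC subrK.
  have hd : n2 (T \o (id - c)) <= r * e.
    apply: le_trans (n2_mull hM MT _ hr) _; first by inM.
    by rewrite ler_wpM2l ?(ltW r0).
  have -> : beta T T - tdot T T = beta T (T \o (id - c)) - tdot T (T \o (id - c)).
    rewrite {2 4}TE (sdotDr tS)// beta_conj//; last by rewrite -TE.
    rewrite betaDl// rmorphD /= -!(beta_conj MT)// h1//.
    by ring.
  apply: le_trans (le_normcD _ _) _; rewrite normcN mulrDr lerD//.
    apply: le_trans (beta_le _ _) _ => //.
    by rewrite mulrCA ler_wpM2l ?n2_ge0// mulrC.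
  apply: le_trans (tdot_le hM _ _) _ => //.
  by rewrite mulrCA ler_wpM2l ?n2_ge0// mulrC.
move=> e e0; have [K hK] := betaP MT MT; rewrite h2 in hK.
(* |T - a|^2 = (<a, a> - <a, T>) - (<T, a> - <T, T>), and the two brackets are bounded by d times
   the two summands of K'. *)
pose K' := (1 + n2 T) + `|K|; have K'0 : 0 < K'.
  by rewrite /K' ltr_pwDl ?ltr_wpDr ?n2_ge0.
pose d := Num.min (e ^+ 2 / K') 1.
have d0 : 0 < d by rewrite lt_min ltr01 andbT divr_gt0 ?exprn_gt0.
have d1 : d <= 1 by rewrite /d ge_min lexx orbT.
have [a ha] := approx_proj_ex MT d0; have [Aa haa] := ha; have Ma := AM Aa.
exists a => //; rewrite -(@ler_pXn2r _ 2) ?nnegrE ?n2_ge0 ?(ltW e0)//.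
apply: le_trans (_ : d * K' <= _); last first.
  by rewrite -ler_pdivlMr// /d ge_min lexx.
rewrite (sqr_snorm tS); last by inM.
rewrite (sdotBr tS)// ?(sdotBl tS)//; last by inM.
have -> : tdot T T - tdot a T - (tdot T a - tdot a a) =
  (tdot a a - tdot a T) - (tdot T a - tdot T T) by ring.
apply: le_trans (Re_le_normc _) _; apply: le_trans (le_normcD _ _) _.
rewrite normcN /K' mulrDr lerD//.
  apply: le_trans (haa _ Aa) _; rewrite ler_wpM2l ?(ltW d0)//.
  exact: (approx_proj_n2_1 MT d0 d1 ha).
by apply: le_trans (hK _ _ d0 d1 ha) _; rewrite ler_wpM2l ?ler_norm ?(ltW d0).
Qed.

End DensityTheorem.

(** * Evaluation of non-commutative polynomials *)

Section NCPolyEval.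
Variables (R : realType) (I : choiceType).
Local Notation C := (R[i]).
Local Notation ncp := (ncpoly R I).
Implicit Types (p q : ncp) (w : seq I) (c : C).

(* Sealing mon and ev keeps unification from unfolding them. *)
Fact nc_key : unit. Proof. by []. Qed.

Definition mon c w : ncp := locked_with nc_key (fun c w => << c *g FMonom w >>) c w.

Lemma monE c w : mon c w = << c *g FMonom w >>.
Proof. by rewrite /mon unlock. Qed.

Lemma ncscaleDr c p q : c *: (p + q) = c *: p + c *: q.
Proof. exact: scalerDr. Qed.

Lemma ncscale0 c : c *: (0 : ncp) = 0.
Proof. exact: scaler0. Qed.

Lemma ncmulDl p q r : (p + q) * r = p * r + q * r.
Proof. exact: mulrDl. Qed.

Lemma ncmulDr p q r : r * (p + q) = r * p + r * q.
Proof. exact: mulrDr. Qed.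

Lemma ncmul0 p : p * 0 = 0.
Proof. exact: mulr0. Qed.

Lemma nc0mul p : 0 * p = 0.
Proof. exact: mul0r. Qed.

Lemma ncscaleN1 p : -1 *: p = - p.
Proof. exact: scaleN1r. Qed.

Lemma monD c d w : mon (c + d) w = mon c w + mon d w.
Proof. by rewrite !monE monalgUD. Qed.

Lemma mcoeff_mon c w k : (mon c w)@_k = c *+ (FMonom w == k).
Proof. by rewrite monE; exact: mcoeffU. Qed.

Lemma ncpoly_ind (P : ncp -> Prop) : P 0 ->
  (forall p q, P p -> P q -> P (p + q)) -> (forall c w, P (mon c w)) ->
  forall p, P p.
Proof.
move=> P0 PD Pm p; rewrite (monalgE p); apply: (big_ind P) => // k _.
by rewrite -(fmK k) -monE; exact: Pm.
Qed.

Lemma mon_mul c d w u : mon c w * mon d u = mon (c * d) (w ++ u).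
Proof. by rewrite !monE -(fmmulE (FMonom w) (FMonom u)); exact: fgmulUU. Qed.

Lemma mon1 : (1 : ncp) = mon 1 [::].
Proof. by rewrite monE -fmoneE. Qed.

Lemma monZ c d w : c *: mon d w = mon (c * d) w.
Proof.
apply/malgP => k; rewrite mcoeffZ !mcoeff_mon.
by case: eqP; rewrite ?mulr1n ?mulr0n ?mulr0.
Qed.

(** The common form of [ncstar], [ev] and [ncsnd]: once F is additive in the coefficient, the sum
    may run over any larger finite support, and additivity in p follows. *)
Definition msum (V : zmodType) (F : C -> seq I -> V) p : V :=
  \sum_(k <- msupp p) F p@_k k.

Section Msum.
Variables (V : zmodType) (F : C -> seq I -> V).
Hypothesis FD : forall a b w, F (a + b) w = F a w + F b w.

Lemma msumF0 w : F 0 w = 0.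
Proof. by have /eqP := FD 0 0 w; rewrite addr0 -subr_eq subrr => /eqP. Qed.

Lemma msumEw p (d : {fset {fmonom I}}) : (msupp p `<=` d)%fset ->
  msum F p = \sum_(k <- d) F p@_k k.
Proof.
move=> pd; rewrite /msum (big_fset_incl _ pd)// => k _ /mcoeff_outdom ->.
exact: msumF0.
Qed.

Lemma msumD p q : msum F (p + q) = msum F p + msum F q.
Proof.
have h1 := fsubsetUl (msupp p) (msupp q); have h2 := fsubsetUr (msupp p) (msupp q).
rewrite (msumEw h1) (msumEw h2) (msumEw (msuppD_le p q)) -big_split /=.
by apply: eq_bigr => k _; rewrite mcoeffD FD.
Qed.

Lemma msum_mon c w : msum F (mon c w) = F c w.
Proof.
rewrite monE (msumEw (@msuppU_le _ _ (FMonom w) c)) big_seq_fset1.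
by rewrite mcoeffUU.
Qed.

Lemma msum0 : msum F 0 = 0.
Proof. by rewrite /msum msupp0 big_seq_fset0. Qed.

End Msum.

Lemma ncstarE p : ncstar p = msum (fun c w => mon c^* (rev w)) p.
Proof.
by rewrite /ncstar /msum; apply: eq_bigr => k _; rewrite monE.
Qed.

Lemma ncstarD p q : ncstar (p + q) = ncstar p + ncstar q.
Proof.
rewrite !ncstarE msumD// => a b w.
by rewrite conjD monD.
Qed.

Lemma ncstar_mon c w : ncstar (mon c w) = mon c^* (rev w).
Proof. by rewrite ncstarE msum_mon// => a b u; rewrite conjD monD. Qed.

Section Eval.
Variables (V : lmodType C) (a : I -> V -> V).

Definition wev w v := foldr (fun i u => a i u) v w.

(** The letters act on an arbitrary module, so the same evaluation serves for operators on [H], for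
    column vectors, and for matrices under left multiplication. *)
Definition ev p v :=
  locked_with nc_key (fun p v => \sum_(k <- msupp p) p@_k *: wev k v) p v.

Lemma ev_unlock p v : ev p v = \sum_(k <- msupp p) p@_k *: wev k v.
Proof. by rewrite /ev unlock. Qed.

Lemma evE p v : ev p v = msum (fun c w => c *: wev w v) p.
Proof. exact: ev_unlock. Qed.

Let evF v (b c : C) w : (b + c) *: wev w v = b *: wev w v + c *: wev w v.
Proof. exact: scalerDl. Qed.

Lemma evD p q v : ev (p + q) v = ev p v + ev q v.
Proof. by rewrite !evE msumD. Qed.

Lemma ev_mon c w v : ev (mon c w) v = c *: wev w v.
Proof. by rewrite evE msum_mon. Qed.

Lemma ev0 v : ev 0 v = 0.
Proof. by rewrite evE msum0. Qed.

Lemma ev1 v : ev 1 v = v.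
Proof. by rewrite mon1 ev_mon scale1r. Qed.

Lemma evZ c p v : ev (c *: p) v = c *: ev p v.
Proof.
elim/ncpoly_ind: p => [|p q IHp IHq|d w]; first by rewrite ncscale0 ev0 scaler0.
  rewrite ncscaleDr (evD (c *: p)) (evD p) scalerDr.
  exact: (congr2 +%R IHp IHq).
by rewrite monZ (ev_mon (c * d)) (ev_mon d) scalerA.
Qed.

Lemma evN p v : ev (- p) v = - ev p v.
Proof. by rewrite -ncscaleN1 evZ scaleN1r. Qed.

Lemma evB p q v : ev (p - q) v = ev p v - ev q v.
Proof. by rewrite evD evN. Qed.

Lemma wev_cat w u v : wev (w ++ u) v = wev w (wev u v).
Proof. exact: foldr_cat. Qed.

Hypothesis la : forall i, linear (a i).

Lemma wev_linear w : linear (wev w).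
Proof. by move=> c x y; elim: w => //= i w ->; rewrite la. Qed.

Lemma ev_linear p : linear (ev p).
Proof.
move=> c x y; rewrite !ev_unlock scaler_sumr -big_split /=; apply: eq_bigr => k _.
by rewrite wev_linear scalerDr !scalerA mulrC.
Qed.

Lemma evM p q v : ev (p * q) v = ev p (ev q v).
Proof.
elim/ncpoly_ind: p => [|p p' IHp IHp'|c w]; first by rewrite nc0mul !ev0.
  rewrite ncmulDl (evD (p * q)) (evD p).
  exact: (congr2 +%R IHp IHp').
elim/ncpoly_ind: q => [|q q' IHq IHq'|d u].
- have h0 : ev (mon c w) 0 = 0.
    have := ev_linear (mon c w) (-1) 0 0.
    by rewrite !scaleN1r oppr0 addr0 addNr.
  by rewrite ncmul0 !ev0 h0.
- rewrite ncmulDr (evD (mon c w * q)) (evD q).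
  have := ev_linear (mon c w) 1 (ev q v) (ev q' v); rewrite !scale1r => ->.
  exact: (congr2 +%R IHq IHq').
- rewrite mon_mul !ev_mon wev_cat -scalerA; congr (_ *: _).
  have h := wev_linear w d (wev u v) 0.
  have h0 : wev w 0 = 0.
    have := wev_linear w (-1) 0 0.
    by rewrite !scaleN1r oppr0 addr0 addNr.
  by rewrite addr0 h0 addr0 in h; rewrite h.
Qed.

Variable dot : V -> V -> C.
Hypothesis sd : sdot (fun _ => True) dot.

Lemma ev_adjoint : (forall i x y, dot (a i x) y = dot x (a i y)) ->
  forall p x y, dot (ev p x) y = dot x (ev (ncstar p) y).
Proof.
move=> sa p; elim/ncpoly_ind: p => [|p q IHp IHq|c w] x y.
- rewrite ncstarE msum0 !ev0 -(scale0r 0) (sdotZl sd)// (sdotZr sd)//.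
  by rewrite [0^*]conjc0 !mul0r.
- rewrite ncstarD (evD p) (evD (ncstar p)); by rewrite (sdotDl sd)// (sdotDr sd)// IHp IHq.
rewrite ncstar_mon !ev_mon (sdotZl sd)// (sdotZr sd)// conjK; congr (_ * _).
elim: w x y => [|i w IH] x y /=; first by rewrite /rev.
by rewrite sa IH rev_cons -cats1 wev_cat.
Qed.

Variable K : I -> R.
Hypothesis K0 : forall i, 0 <= K i.
Hypothesis aK : forall i v, snorm dot (a i v) <= K i * snorm dot v.

Lemma wev_bound w v : snorm dot (wev w v) <= (\prod_(i <- w) K i) * snorm dot v.
Proof.
elim: w => [|i w IH] /=; first by rewrite big_nil mul1r.
rewrite big_cons -mulrA; apply: le_trans (aK _ _) _.
by rewrite ler_wpM2l.
Qed.

End Eval.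

Definition pbound (K : I -> R) p : R :=
  \sum_(k <- msupp p) normc p@_k * \prod_(i <- (k : seq I)) K i.

Lemma pbound_ge0 K p : (forall i, 0 <= K i) -> 0 <= pbound K p.
Proof.
move=> K0; apply: sumr_ge0 => k _; rewrite mulr_ge0 ?normc_ge0//.
exact: prodr_ge0.
Qed.

Lemma ev_bound (V : lmodType C) (a : I -> V -> V) (dot : V -> V -> C) (K : I -> R) :
  sdot (fun _ => True) dot -> (forall i, 0 <= K i) ->
  (forall i v, snorm dot (a i v) <= K i * snorm dot v) ->
  forall p v, snorm dot (ev a p v) <= pbound K p * snorm dot v.
Proof.
move=> sd K0 aK p v; rewrite ev_unlock /pbound mulr_suml.
elim: (enum_fset (msupp p)) => [|k s IH].
  by rewrite !big_nil (snorm0 sd).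
rewrite !big_cons; apply: le_trans (snormD sd _ _) _ => //; rewrite lerD//.
rewrite (snormZ sd)// -mulrA ler_wpM2l ?normc_ge0//.
exact: (wev_bound K0 aK).
Qed.

End NCPolyEval.

(** * Kaplansky density with bounds uniform in the dimension *)

Lemma expr_small (R : realType) (x e : R) : 0 <= x -> x < 1 -> 0 < e ->
  exists J, x ^+ J <= e.
Proof.
move=> x0 x1 e0; have /cvgrPdist_le/(_ e e0)[N _ hN] : (fun n => x ^+ n) @ \oo --> (0 : R).
  by apply: cvg_expr; rewrite ger0_norm.
exists N; have := hN N (leqnn _); rewrite sub0r normrN ger0_norm//.
exact: exprn_ge0.
Qed.

Section SelfAdjointCutoff.
Variables (R : realType) (V : lmodType R[i]) (dot : V -> V -> R[i]).
Hypothesis sd : sdot (fun _ => True) dot.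
Variables (F : V -> V) (K L : R).
Hypotheses (F_lin : linear F) (F_sa : forall x y, dot (F x) y = dot x (F y)).
Hypotheses (K0 : 0 <= K) (L0 : 0 < L).
Hypothesis FK : forall x, snorm dot (F x) <= K * snorm dot x.
Local Notation sn := (snorm dot).

Let c := (1 + K ^+ 2 / L ^+ 2)^-1.
Let s := c / L ^+ 2.

Lemma c_gt0 : 0 < c.
Proof. by rewrite invr_gt0 ltr_pwDl// divr_ge0// sqr_ge0. Qed.

Lemma c_le1 : c <= 1.
Proof. by rewrite invf_le1 ?lerDl ?ltr_pwDl ?divr_ge0 ?sqr_ge0. Qed.

Lemma sK2 : s * K ^+ 2 = 1 - c.
Proof.
have D0 : 0 < 1 + K ^+ 2 / L ^+ 2 by rewrite ltr_pwDl// divr_ge0// sqr_ge0.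
have : c * (1 + K ^+ 2 / L ^+ 2) = 1 by rewrite mulVf// gt_eqF.
have -> : s * K ^+ 2 = c * (K ^+ 2 / L ^+ 2) by rewrite /s; ring.
lra.
Qed.

Lemma s_ge0 : 0 <= s.
Proof. by rewrite divr_ge0 ?sqr_ge0// ltW// c_gt0. Qed.

(* 1 - c D, where D = 1 + F^2 / L^2 and 1 <= D <= 1 / c *)
Definition cutE x : V := (1 - c)%:C%C *: x - s%:C%C *: F (F x).

(** In the expansion of |(1 - c) x - s F^2 x|^2 the term s^2 |F^2 x|^2 is at most s (1 - c) |F x|^2,
    because s K^2 = 1 - c, and the cross term absorbs it. *)
Lemma cutE_le x : sn (cutE x) <= (1 - c) * sn x.
Proof.
have c1 := c_le1; have c0 := c_gt0; have s0 := s_ge0.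
have b0 : 0 <= 1 - c by rewrite subr_ge0.
rewrite -(@ler_pXn2r _ 2) ?nnegrE ?mulr_ge0 ?snorm_ge0//.
rewrite /cutE -scaleNr (sqr_snormDZ sd)// (snormZ sd)// normcN !normcR.
rewrite !ger0_norm// (sdotZr sd)// F_sa.
have -> : - s%:C%C * (((1 - c)%:C%C)^* * dot (F x) (F x)) =
   (- (s * (1 - c) * sn (F x) ^+ 2))%:C%C.
  rewrite (sdot_snorm sd)// -[LHS]/(- s%:C%C * ((1 - c)%:C%C^*%C * _)) conjc_real.
  by rewrite -!rmorphM -rmorphN -rmorphM; congr (_%:C)%C; ring.
have h : sn (F (F x)) ^+ 2 <= K ^+ 2 * sn (F x) ^+ 2.
  by rewrite -exprMn ler_pXn2r ?nnegrE ?mulr_ge0 ?snorm_ge0.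
have h2 : s ^+ 2 * sn (F (F x)) ^+ 2 <= s * (1 - c) * sn (F x) ^+ 2.
  have -> : s * (1 - c) * sn (F x) ^+ 2 = s ^+ 2 * (K ^+ 2 * sn (F x) ^+ 2).
    by rewrite -sK2; ring.
  by rewrite ler_wpM2l ?sqr_ge0.
have h3 : 0 <= s * (1 - c) * sn (F x) ^+ 2.
  by rewrite mulr_ge0 ?sqr_ge0// mulr_ge0.
by rewrite /= exprMn; move: h2 h3; set a := _ * sn (F x) ^+ 2; lra.
Qed.

Lemma iter_cutE_le j x : sn (iter j cutE x) <= (1 - c) ^+ j * sn x.
Proof.
elim: j => [|j IH]; first by rewrite expr0 mul1r.
apply: le_trans (cutE_le _) _; rewrite exprS -mulrA ler_wpM2l//.
by rewrite subr_ge0 c_le1.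
Qed.

(** Partial Neumann sum for the inverse of D. *)
Definition cutQ J x : V := c%:C%C *: \sum_(j < J) iter j cutE x.

Lemma geo_sum J : c * \sum_(j < J) (1 - c) ^+ j = 1 - (1 - c) ^+ J.
Proof.
elim: J => [|J IH]; first by rewrite big_ord0 mulr0 expr0 subrr.
by rewrite big_ord_recr /= mulrDr IH exprS; ring.
Qed.

Lemma cutQ_le J x : sn (cutQ J x) <= sn x.
Proof.
have c0 := c_gt0.
rewrite (snormZ sd)// normcR gtr0_norm//.
apply: (@le_trans _ _ (c * \sum_(j < J) (1 - c) ^+ j * sn x)).
  rewrite ler_wpM2l ?(ltW c0)//.
  elim: J => [|J IH]; first by rewrite !big_ord0 (snorm0 sd).
  rewrite !big_ord_recr /=; apply: le_trans (snormD sd _ _) _ => //.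
  by rewrite lerD// iter_cutE_le.
rewrite -mulr_suml mulrA geo_sum ler_piMl ?snorm_ge0// lerBlDr lerDl exprn_ge0//.
by rewrite subr_ge0 c_le1.
Qed.

Lemma flin_add x y : F (x + y) = F x + F y.
Proof. by have := F_lin 1 x y; rewrite !scale1r. Qed.

Lemma flin_0 : F 0 = 0.
Proof. by have := F_lin (-1) 0 0; rewrite !scaleN1r oppr0 addr0 addNr. Qed.

Lemma flin_scale a x : F (a *: x) = a *: F x.
Proof. by have := F_lin a x 0; rewrite flin_0 !addr0. Qed.

(** Since c D = 1 - E with E = [cutE], the product of D with the partial sum telescopes to 1 -
    E^J. *)
Lemma cutQ_tele J x :
  cutQ J x + (L ^- 2)%:C%C *: F (F (cutQ J x)) = x - iter J cutE x.
Proof.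
elim: J => [|J IH].
  by rewrite /cutQ big_ord0 scaler0 !flin_0 scaler0 addr0 subrr.
rewrite /cutQ big_ord_recr /= scalerDr -/(cutQ J x) !flin_add scalerDr addrACA IH.
set y := iter J cutE x; rewrite /cutE rmorphB /= scalerBl scale1r.
rewrite !flin_scale scalerA -rmorphM (_ : L ^- 2 * c = s); last by rewrite mulrC.
by rewrite !opprD !opprK !addrA.
Qed.

(** With q = Q x, <D q, q> = |q|^2 + |F q|^2 / L^2, while D q = x - E^J x has norm at most 2 |x|.
    The bound contains neither K nor J; this is essential, because K grows with the polynomial that
    defines F. *)
Lemma F_cutQ_le J x : sn (F (cutQ J x)) <= 2 * L * sn x.
Proof.
have L00 := ltW L0; have x0 := snorm_ge0 dot x.
rewrite -(@ler_pXn2r _ 2) ?nnegrE ?mulr_ge0 ?snorm_ge0//.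
set q := cutQ J x; have q0 := snorm_ge0 dot q.
have q1 : sn q <= sn x by exact: cutQ_le.
have hE : sn (x - iter J cutE x) <= 2 * sn x.
  rewrite (_ : 2 * sn x = sn x + sn x); last by ring.
  apply: le_trans (snormD sd _ _) _ => //; rewrite (snormN sd)// lerD2l.
  apply: le_trans (iter_cutE_le _ _) _; rewrite ler_piMl// exprn_ile1//.
    by rewrite subr_ge0 c_le1.
  by rewrite gerBl ltW// c_gt0.
have hF : L ^- 2 * sn (F q) ^+ 2 + sn q ^+ 2 <= 2 * sn x * sn x.
  have : normc (dot (x - iter J cutE x) q) <= 2 * sn x * sn x.
    by apply: le_trans (cauchy_schwarz sd _ _) _ => //; rewrite ler_pM// ?snorm_ge0.
  rewrite -cutQ_tele -/q (sdotDl sd)// (@sdotZl _ _ _ _ sd _ (F (F q)))// F_sa !(sdot_snorm sd)//.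
  by rewrite -rmorphM -rmorphD normcR; move/(le_trans (ler_norm _)); rewrite addrC.
have : L ^- 2 * sn (F q) ^+ 2 <= 2 * sn x * sn x.
  by apply: le_trans hF; rewrite lerDl sqr_ge0.
rewrite ler_pdivrMl ?exprn_gt0// => h; apply: le_trans h _.
rewrite !exprMn -subr_ge0.
have -> : 2 ^+ 2 * L ^+ 2 * sn x ^+ 2 - L ^+ 2 * (2 * sn x * sn x) =
   2 * (L * sn x) ^+ 2 by ring.
by rewrite mulr_ge0// sqr_ge0.
Qed.

Lemma cutQ_comm J x : F (cutQ J x) = cutQ J (F x).
Proof.
have FE y : F (cutE y) = cutE (F y).
  by rewrite /cutE flin_add !flin_scale -scaleN1r flin_scale scaleN1r flin_scale.
have FEj j y : F (iter j cutE y) = iter j cutE (F y).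
  by elim: j => //= j IH; rewrite FE IH.
rewrite /cutQ flin_scale; congr (_ *: _).
by elim: J => [|J IH]; rewrite ?big_ord0 ?flin_0// !big_ord_recr /= flin_add IH FEj.
Qed.

End SelfAdjointCutoff.

Section UniversalKaplansky.
Variables (R : realType) (H : hilbert R) (M : set (H -> H)).
Variables (tau : (H -> H) -> R[i]).
Hypothesis hM : tracial_vna M tau.
Variables (J0 : choiceType) (Y : J0 -> H -> H) (Kb : J0 -> R).
Hypotheses (MY : forall i, M (Y i)) (saY : forall i, sa_op (Y i)).
Hypotheses (Kb0 : forall i, 0 <= Kb i) (YK : forall i, opnorm_le (Y i) (Kb i)).
Local Notation C := (R[i]).
Local Notation n2 := (n2 tau).
Local Notation ncp := (ncpoly R J0).
Implicit Types (S T : H -> H) (p q f h : ncp).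

Let lY i : linear (Y i) := M_lin hM (MY i).

Lemma M_ev p : M (ev Y p).
Proof.
elim/ncpoly_ind: p => [|p q Mp Mq|c w].
- by rewrite (_ : ev Y 0 = 0); [inM|apply/funext => v; rewrite ev0].
- by rewrite (_ : ev Y (p + q) = ev Y p + ev Y q); [inM|apply/funext => v; rewrite evD].
rewrite (_ : ev Y (mon c w) = c *: wev Y w); last by apply/funext => v; rewrite ev_mon.
apply: (M_scale hM); elim: w => [|i w IH]; first exact: (M_id hM).
exact: (M_comp hM (MY i) IH).
Qed.

Lemma adj_ev p : adj (ev Y p) = ev Y (ncstar p).
Proof. by apply: adj_eq => x y; exact: (ev_adjoint (hdot_sdot H)). Qed.

(* The quantification over all spaces makes the bound apply at once to H and to
   every C^n. *)
Definition ubounded (L : R) h := forall (V : lmodType C) (a : J0 -> V -> V)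
  (dot : V -> V -> C), sdot (fun _ => True) dot -> (forall i, linear (a i)) ->
  (forall i x y, dot (a i x) y = dot x (a i y)) ->
  (forall i v, snorm dot (a i v) <= Kb i * snorm dot v) ->
  forall v, snorm dot (ev a h v) <= L * snorm dot v.

Lemma plin_ex (b c : C) p q : exists r, forall (V : lmodType C) (a : J0 -> V -> V) v,
  ev a r v = b *: ev a p v + c *: ev a q v.
Proof.
exists (b *: p + c *: q) => V a v; rewrite (evD a (b *: p)).
exact: (congr2 +%R (evZ a b p v) (evZ a c q v)).
Qed.

Lemma pmul_ex p q : exists r, forall (V : lmodType C) (a : J0 -> V -> V),
  (forall i, linear (a i)) -> forall v, ev a r v = ev a p (ev a q v).
Proof. by exists (p * q) => V a la v; exact: evM. Qed.

(** Only sums, compositions and scalars depending on K and L occur in [cutQ], so one polynomial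
    computes it on every space. *)
Lemma cutQ_poly f (K L : R) J : exists q, forall (V : lmodType C) (a : J0 -> V -> V),
  (forall i, linear (a i)) -> forall v, ev a q v = cutQ (ev a f) K L J v.
Proof.
have [ff hff] := pmul_ex f f.
pose c := (1 + K ^+ 2 / L ^+ 2)^-1; pose s := c / L ^+ 2.
have [e he] := plin_ex (1 - c)%:C%C (- s%:C%C) 1 ff.
have eE (V : lmodType C) (a : J0 -> V -> V) : (forall i, linear (a i)) ->
    forall v, ev a e v = cutE (ev a f) K L v.
  by move=> la v; rewrite he ev1 (hff _ _ la) scaleNr.
have ej j : exists g, forall (V : lmodType C) (a : J0 -> V -> V),
    (forall i, linear (a i)) -> forall v, ev a g v = iter j (cutE (ev a f) K L) v.
  elim: j => [|j [g hg]]; first by exists 1 => V a la v; rewrite ev1.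
  have [r hr] := pmul_ex e g; exists r => V a la v.
  by rewrite (hr _ _ la) (hg _ _ la) (eE _ _ la).
elim: J => [|J [q hq]].
  by exists 0 => V a la v; rewrite ev0 /cutQ big_ord0 scaler0.
have [g hg] := ej J; have [r hr] := plin_ex 1 c%:C%C q g.
exists r => V a la v; rewrite hr (hq _ _ la) (hg _ _ la) scale1r.
by rewrite /cutQ big_ord_recr /= scalerDr.
Qed.

Variable B : set (H -> H).
Hypotheses (BM : B `<=` M) (Bid : B id)
  (BD : forall S T, B S -> B T -> B (S + T))
  (BZ : forall c T, B T -> B (c *: T))
  (Bcomp : forall S T, B S -> B T -> B (S \o T)).
Hypothesis Bdense : forall T, B T -> forall e, 0 < e -> exists p, n2 (T - ev Y p) <= e.

(** Averaging p with its involution does not increase the distance to a self-adjoint T, as adjoints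
    preserve the 2-norm, and makes the evaluation symmetric on every space. *)
Lemma sa_dense T : B T -> sa_op T -> forall e, 0 < e ->
  exists p, [/\ n2 (ev Y p - T) <= e & forall (V : lmodType C) (a : J0 -> V -> V)
  (dot : V -> V -> C), sdot (fun _ => True) dot -> (forall i, linear (a i)) ->
  (forall i x y, dot (a i x) y = dot x (a i y)) ->
  forall x y, dot (ev a p x) y = dot x (ev a p y)].
Proof.
move=> BT sT e e0; have [p hp] := Bdense BT e0; have MT := BM BT.
have Mp := M_ev p; have Mp' := M_ev (ncstar p).
exists (2^-1 *: (p + ncstar p)); split.
  have -> : ev Y (2^-1 *: (p + ncstar p)) - T =
      (- 2^-1) *: ((T - ev Y p) + adj (T - ev Y p)).
    rewrite (adj_sub hM)// (adj_sa sT) adj_ev; apply/funext => v.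
    rewrite -[LHS]/(ev Y (2^-1 *: (p + ncstar p)) v - T v) (evZ Y 2^-1) (evD Y p).
    rewrite -[RHS]/(- 2^-1 *: ((T v - ev Y p v) + (T v - ev Y (ncstar p) v))).
    apply: hdot_inj => w; rewrite !(hdotBl, hdotDl, hdotZl, hdotNl).
    by field.
  have MTp : M (T - ev Y p) by inM.
  rewrite (n2Z hM); last by inM.
  apply: (@le_trans _ _ (2^-1 * (n2 (T - ev Y p) + n2 (T - ev Y p)))); last first.
    by rewrite ler_pdivrMl// mulr_natl mulr2n lerD.
  have -> : normc (- 2^-1 : C) = 2^-1.
    by rewrite normcN normcV -(rmorph_nat (real_complex R)) normcR ger0_norm.
  rewrite ler_wpM2l ?invr_ge0// -{2}(n2_adj hM MTp); apply: (n2D hM) => //; inM.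
move=> V a dot sd la sa x y.
have h2 : (2^-1 : C)^* = 2^-1 by rewrite -(rmorph_nat (real_complex R)) -fmorphV; exact: conjc_real.
rewrite !(evZ a 2^-1) !(evD a p) (sdotZl sd)// (sdotZr sd)// h2; congr (_ * _).
rewrite (sdotDl sd)// (sdotDr sd)// (ev_adjoint sd sa) addrC; congr (_ + _).
by rewrite [RHS](sdotC sd I I) (ev_adjoint sd sa p y x) -(sdotC sd I I).
Qed.

(** Iteration for S = T (1 + S^2/16). The constant 16 is L^2 for the cutoff parameter L = 4. For |T|
    <= 1 the norm bound 2 is preserved, as 1 + 4/16 <= 2, and each step contracts by (2 + 2)/16 =
    1/4. *)
Fixpoint fixS T k : H -> H :=
  if k is k'.+1 then T + (16^-1)%:C%C *: (T \o (fixS T k' \o fixS T k')) else 0.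

Lemma B_fixS T k : B T -> B (fixS T k).
Proof.
move=> BT; elim: k => [|k IH] /=; first by rewrite -(scale0r id); exact: BZ.
by apply: BD => //; apply: BZ; apply: Bcomp => //; exact: Bcomp.
Qed.

Lemma fixS_comm T k : B T -> T \o fixS T k = fixS T k \o T.
Proof.
move=> /BM MT; have lT := M_lin hM MT; elim: k => [|k IH].
  by apply/funext => v /=; exact: (lin_0E lT).
rewrite /= (comp_linD _ _ lT) (comp_linZ _ _ lT).
rewrite (_ : (T + _) \o T = (T \o T) + (16^-1)%:C%C *: ((T \o (fixS T k \o fixS T k)) \o T))//.
congr (_ + _ *: _); apply/funext => v /=; congr (T _).
have h u : T (fixS T k u) = fixS T k (T u) by exact: (congr1 (fun f : H -> H => f u) IH).
by rewrite !h.
Qed.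

Lemma sa_fixS T k : B T -> sa_op T -> sa_op (fixS T k).
Proof.
move=> BT sT; elim: k => [|k IH]; first exact: sa_0.
have h u : T (fixS T k u) = fixS T k (T u).
  exact: (congr1 (fun f : H -> H => f u) (fixS_comm k BT)).
rewrite -[fixS T k.+1]/(T + (16^-1)%:C%C *: (T \o (fixS T k \o fixS T k))).
apply: sa_add => //; apply: sa_scale => x y.
move: h IH; set S := fixS T k => h sS.
rewrite -[LHS]/(hdot (T (S (S x))) y) -[RHS]/(hdot x (T (S (S y)))).
by rewrite sT sS sS !h.
Qed.

Lemma fixS_le T k : B T -> opnorm_le T 1 -> opnorm_le (fixS T k) 2.
Proof.
move=> BT T1; elim: k => [|k IH].
  by apply/opnormP; split=> // x; rewrite hnorm0 mulr_ge0 ?hnorm_ge0.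
apply: opnorm_le_trans (opnorm_add T1 (opnorm_scale (16^-1)%:C%C
  (opnorm_comp T1 (opnorm_comp IH IH)))).
rewrite normcR ger0_norm ?invr_ge0//; lra.
Qed.

Lemma fixS_diff T k : B T -> opnorm_le T 1 ->
  opnorm_le (fixS T k.+1 - fixS T k) (4^-1 ^+ k).
Proof.
move=> BT T1; have MT := BM BT; have lT := M_lin hM MT.
elim: k => [|k IH].
  rewrite expr0 (_ : _ - _ = T)//; apply/funext => v /=.
  rewrite -[LHS]/((T v + (16^-1)%:C%C *: T 0) - 0).
  by rewrite (lin_0E lT) scaler0 addr0 subr0.
have MS : M (fixS T k.+1) by apply/BM/B_fixS.
have MS' : M (fixS T k) by apply/BM/B_fixS.
have lS := M_lin hM MS; have lS' := M_lin hM MS'.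
have S2 := fixS_le k.+1 BT T1; have S2' := fixS_le k BT T1.
rewrite -[fixS T k.+2]/(T + (16^-1)%:C%C *: (T \o (fixS T k.+1 \o fixS T k.+1))).
rewrite -{2}[fixS T k.+1]/(T + (16^-1)%:C%C *: (T \o (fixS T k \o fixS T k))).
move: IH; set S := fixS T k.+1 in MS lS S2 *; set S' := fixS T k in MS' lS' S2' * => IH.
have -> : T + (16^-1)%:C%C *: (T \o (S \o S)) - (T + (16^-1)%:C%C *: (T \o (S' \o S'))) =
   (16^-1)%:C%C *: (T \o ((S \o (S - S')) + ((S - S') \o S'))).
  apply/funext => v.
  rewrite -[LHS]/(T v + (16^-1)%:C%C *: T (S (S v)) - (T v + (16^-1)%:C%C *: T (S' (S' v)))).
  rewrite -[RHS]/((16^-1)%:C%C *: T (S (S v - S' v) + (S (S' v) - S' (S' v)))).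
  by rewrite (lin_subE lS) subrKA (lin_subE lT) scalerBr opprD addrACA subrr add0r.
apply: opnorm_le_trans (opnorm_scale (16^-1)%:C%C (opnorm_comp T1
  (opnorm_add (opnorm_comp S2 IH) (opnorm_comp IH S2')))).
rewrite normcR ger0_norm ?invr_ge0// exprS; lra.
Qed.

Lemma M_cut F K J : M F -> M (iter J (cutE F K 4)) /\ M (cutQ F K 4 J).
Proof.
move=> MF; set c := (1 + K ^+ 2 / 4 ^+ 2)^-1.
have h j : M (iter j (cutE F K 4)).
  elim: j => [|j IH]; first exact: (M_id hM).
  have ME : M (cutE F K 4).
    rewrite (_ : cutE F K 4 = (1 - c)%:C%C *: id - (c / 4 ^+ 2)%:C%C *: (F \o F))//; inM.
  exact: (M_comp hM ME IH).
split=> //; rewrite (_ : cutQ F K 4 J = c%:C%C *: (\sum_(j < J) iter j (cutE F K 4))).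
  apply: (M_scale hM); elim: J => [|J IH]; first by rewrite big_ord0; inM.
  by rewrite big_ord_recr /=; inM.
apply/funext => v; rewrite /cutQ.
rewrite -[RHS]/(c%:C%C *: (\sum_(j < J) iter j (cutE F K 4)) v); congr (_ *: _).
elim: J => [|J IH]; first by rewrite !big_ord0.
by rewrite !big_ord_recr /= IH.
Qed.

(** Algebra for [kaplansky1]: F is exchanged for S, first in Q F and then one factor at a time in Q
    F^2 T; what remains is the defect of the fixed point equation and the Neumann remainder. *)
Lemma cutoff_identity (c : C) (v : H) (F Q S T : H -> H) : linear Q ->
  (forall u, T (S u) = S (T u)) ->
  Q (F v) - T v = Q (F v - S v) - Q ((T v + c *: T (S (S v))) - S v) -
    c *: Q (F (F (T v)) - F (S (T v))) - c *: Q (F (S (T v)) - S (S (T v))) -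
    (T v - (Q (T v) + c *: Q (F (F (T v))))).
Proof.
move=> lQ cS; rewrite !cS !(lin_subE lQ) !(lin_addE lQ) !(lin_scaleE lQ).
apply: hdot_inj => w; rewrite !(hdotBl, hdotDl, hdotZl, hdotNl).
by ring.
Qed.

(* With S = T (1 + S^2/16), up to a small error, T is the value at S of
   t / (1 + t^2/16); this bounded function is approximated by polynomials t q(t)
   and applied to a polynomial f close to S. *)
Lemma kaplansky1 T : B T -> sa_op T -> opnorm_le T 1 -> forall e, 0 < e ->
  exists2 h, n2 (ev Y h - T) <= e & ubounded 8 h.
Proof.
move=> BT sT T1 e e0; have MT := BM BT; have lT := M_lin hM MT.
have e40 : 0 < e / 4 by rewrite divr_gt0.
have e80 : 0 < e / 8 by rewrite divr_gt0.
have [k hk] : exists k, (4^-1 : R) ^+ k <= e / 4.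
  by apply: expr_small => //; rewrite ?invr_ge0// invf_lt1// ltr1n.
set S := fixS T k; have BS : B S by exact: B_fixS.
have MS := BM BS; have lS := M_lin hM MS.
have sS : sa_op S by exact: sa_fixS.
have S2 : opnorm_le S 2 by exact: fixS_le.
have [f [hf fsa]] := sa_dense BS sS e80.
pose K := pbound Kb f; have K0 : 0 <= K by exact: pbound_ge0.
set c := (1 + K ^+ 2 / 4 ^+ 2)^-1.
have L0 : (0 : R) < 4 by [].
have c0 : 0 < c := c_gt0 K 4.
have [J hJ] : exists J, (1 - c) ^+ J <= e / 4.
  apply: expr_small => //; last by rewrite ltrBlDr ltrDl.
  by rewrite subr_ge0; exact: c_le1.
have [q hq] := cutQ_poly f K 4 J.
have [h hh] := pmul_ex f q.
exists h; last first.
  move=> V a dot sd la sa aK v; rewrite hh// hq//.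
  have lf := ev_linear la f.
  have fK := ev_bound sd Kb0 aK f.
  apply: le_trans (F_cutQ_le sd lf _ K0 L0 fK J v) _; first exact: fsa.
  by rewrite ler_wpM2r ?snorm_ge0//; lra.
set F := ev Y f; have MF : M F := M_ev f; have lF := M_lin hM MF.
have sF : sa_op F by move=> x y; apply: (fsa _ _ _ (hdot_sdot H)).
have YK' i v : snorm (@hdot R H) (Y i v) <= Kb i * snorm (@hdot R H) v.
  by have /opnormP[_] := YK i; exact.
have FK := ev_bound (hdot_sdot H) Kb0 YK' f.
have [MD MQ] := M_cut K J MF.
set D := iter J _ in MD; set Q := cutQ _ _ _ _ in MQ; have lQ := M_lin hM MQ.
have QFE u : F (Q u) = Q (F u) by exact: (cutQ_comm K 4 lF J u).
have Q1 : opnorm_le Q 1.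
  apply/opnormP; split=> // x; rewrite mul1r.
  exact: (@cutQ_le _ _ _ (hdot_sdot H) F K 4 sF K0 FK J x).
have QF8 : opnorm_le (Q \o F) 8.
  apply/opnormP; split=> // x; rewrite -[(_ \o _) x]/(Q (F x)) -QFE.
  apply: le_trans (@F_cutQ_le _ _ _ (hdot_sdot H) F K 4 lF sF K0 L0 FK J x) _.
  by rewrite ler_wpM2r ?snorm_ge0//; lra.
have D1 : opnorm_le D ((1 - c) ^+ J).
  apply/opnormP; split; first by rewrite exprn_ge0// subr_ge0; exact: c_le1.
  move=> x; exact: (@iter_cutE_le _ _ _ (hdot_sdot H) F K 4 sF K0 FK J x).
set E := fixS T k.+1 - S; have E1 : opnorm_le E (4^-1 ^+ k) by exact: fixS_diff.
have ME : M E by rewrite /E; apply: (M_sub hM) => //; exact/BM/B_fixS.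
pose G := F - S; have MG : M G by rewrite /G; inM.
pose i16 : C := (16^-1)%:C%C.
(* The five errors, in this order, are at most e/8, e/4, e/16, e/64 and e/4, with sum below e. The
   operator bound 8 on Q F enters the third, the bound 2 on S the fourth. *)
have -> : ev Y h - T = (Q \o G) - (Q \o E) - i16 *: ((Q \o F) \o (G \o T)) -
    i16 *: (Q \o (G \o (S \o T))) - (D \o T).
  apply/funext => v.
  rewrite -[LHS]/(ev Y h v - T v) hh// hq// -/F -[cutQ _ _ _ _ v]/(Q v) QFE.
  rewrite -[RHS]/(Q (F v - S v) - Q ((T v + i16 *: T (S (S v))) - S v) -
    i16 *: Q (F (F (T v) - S (T v))) - i16 *: Q (F (S (T v)) - S (S (T v))) - D (T v)).
  have cS u : T (S u) = S (T u) by exact: (congr1 (fun f : H -> H => f u) (fixS_comm k BT)).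
  have tele := cutQ_tele K 4 lF J (T v); rewrite -/Q -/D in tele.
  have -> : D (T v) = T v - (Q (T v) + (4 ^- 2)%:C%C *: F (F (Q (T v)))).
    by rewrite tele opprB addrCA subrr addr0.
  rewrite (lin_subE lF) !QFE (_ : (4 ^- 2)%:C%C = i16); last by rewrite /i16; congr (_%:C)%C; rewrite -natrX.
  exact: (cutoff_identity i16 v F lQ cS).
have n16 : normc i16 = 16^-1 by rewrite normcR ger0_norm ?invr_ge0.
have b1 : n2 (Q \o G) <= e / 8.
  by apply: le_trans (n2_mull hM MQ MG Q1) _; rewrite mul1r.
have b2 : n2 (Q \o E) <= e / 4.
  apply: le_trans (n2_mull hM MQ ME Q1) _; rewrite mul1r.
  by apply: le_trans (n2_le_op hM ME E1) _.
have b3 : n2 (i16 *: ((Q \o F) \o (G \o T))) <= 16^-1 * (8 * (e / 8)).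
  rewrite (n2Z hM) ?n16; last by inM.
  rewrite ler_wpM2l ?invr_ge0//.
  apply: le_trans (n2_mull hM _ _ QF8) _; try inM.
  rewrite ler_wpM2l//; apply: le_trans (n2_mulr hM MT MG T1) _.
  by rewrite mul1r.
have b4 : n2 (i16 *: (Q \o (G \o (S \o T)))) <= 16^-1 * (2 * (e / 8)).
  rewrite (n2Z hM) ?n16; last by inM.
  rewrite ler_wpM2l ?invr_ge0//.
  apply: le_trans (n2_mull hM MQ _ Q1) _; first by inM.
  have ST2 := opnorm_comp S2 T1; rewrite mul1r.
  apply: le_trans (n2_mulr hM _ MG ST2) _; first by inM.
  by rewrite mulr1 ler_wpM2l.
have b5 : n2 (D \o T) <= e / 4.
  apply: le_trans (n2_mulr hM MT MD T1) _; rewrite mul1r.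
  by apply: le_trans (n2_le_op hM MD D1) _.
have s1 := n2_sub_le hM (M_comp hM MQ MG) (M_comp hM MQ ME).
set A1 := (Q \o G) - (Q \o E) in s1 *; have MA1 : M A1 by rewrite /A1; inM.
set A2 := i16 *: _ in b3 *; have MA2 : M A2 by rewrite /A2; inM.
set A3 := i16 *: _ in b4 *; have MA3 : M A3 by rewrite /A3; inM.
have s2 := n2_sub_le hM MA1 MA2.
have MA12 : M (A1 - A2) by inM.
have s3 := n2_sub_le hM MA12 MA3.
have MA123 : M (A1 - A2 - A3) by inM.
have s4 := n2_sub_le hM MA123 (M_comp hM MD MT).
apply: le_trans s4 _; lra.
Qed.

(** Rescaling to norm at most 1. L is fixed before e, so that all approximants of T share one bound
    on matrices. *)
Lemma kaplansky T : B T -> sa_op T -> exists2 L, 0 < L & forall e, 0 < e ->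
  exists2 h, n2 (ev Y h - T) <= e & ubounded L h.
Proof.
move=> BT sT; have MT := BM BT; have [r r0 hr] := M_bnd hM MT.
exists (r * 8); first by rewrite mulr_gt0.
move=> e e0; pose T' := (r^-1)%:C%C *: T.
have T'1 : opnorm_le T' 1.
  apply: opnorm_le_trans (opnorm_scale _ hr).
  by rewrite normcR ger0_norm ?invr_ge0 ?(ltW r0)// mulVf ?gt_eqF.
have [||h hh uh] := @kaplansky1 T' _ _ T'1 (e / r) (divr_gt0 e0 r0).
- exact: BZ.
- exact: sa_scale.
have Mh := M_ev h; have MT' : M T' by rewrite /T'; inM.
exists (r%:C%C *: h).
  have -> : ev Y (r%:C%C *: h) - T = r%:C%C *: (ev Y h - T').
    apply/funext => v; rewrite -[LHS]/(ev Y (r%:C%C *: h) v - T v) (evZ Y r%:C%C).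
    rewrite -[RHS]/(r%:C%C *: (ev Y h v - (r^-1)%:C%C *: T v)) scalerBr scalerA.
    by rewrite -rmorphM divff ?gt_eqF// scale1r.
  rewrite (n2Z hM); last by inM.
  by rewrite normcR ger0_norm ?(ltW r0)// mulrC -ler_pdivlMr.
move=> V a dot sd la sa aK v; rewrite (evZ a r%:C%C) (snormZ sd)// normcR ger0_norm ?(ltW r0)//.
by rewrite -mulrA ler_wpM2l ?(ltW r0)//; exact: uh.
Qed.

End UniversalKaplansky.

(** * Polynomial approximation in the generated von Neumann algebra *)

Section GeneratedAlgebra.
Variables (R : realType) (H : hilbert R) (M : set (H -> H)).
Variables (tau : (H -> H) -> R[i]).
Hypothesis hM : tracial_vna M tau.
Variable Y : nat -> H -> H.
Hypotheses (MY : forall j, M (Y j)) (saY : forall j, sa_op (Y j)).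
Local Notation C := (R[i]).
Local Notation n2 := (n2 tau).
Local Notation B := (Wstar Y).
Implicit Types (S T : H -> H).

Lemma Wstar_M T : B T -> M T.
Proof. by apply => //; exact: (tvna_vn hM). Qed.

Lemma Wstar_gen j : B (Y j).
Proof. by move=> N _; exact. Qed.

Lemma Wstar_id : B id.
Proof. by move=> N vN _; exact: (vn_id vN). Qed.

Lemma Wstar_add S T : B S -> B T -> B (S + T).
Proof. by move=> BS BT N vN NY; apply: (vn_add vN); [exact: BS|exact: BT]. Qed.

Lemma Wstar_scale c T : B T -> B (c *: T).
Proof. by move=> BT N vN NY; apply: (vn_scale vN); exact: BT. Qed.

Lemma Wstar_comp S T : B S -> B T -> B (S \o T).
Proof. by move=> BS BT N vN NY; apply: (vn_comp vN); [exact: BS|exact: BT]. Qed.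

Lemma Wstar_adj T : B T -> B (adj T).
Proof.
move=> BT N vN NY; have [S NS TS] := vn_adjoint vN (BT _ vN NY).
by rewrite (adj_eq TS).
Qed.

Lemma Wstar_dense T : B T -> forall e, 0 < e -> exists p, n2 (T - ev Y p) <= e.
Proof.
move=> BT e e0.
pose A := [set S | exists p, S = ev Y p].
have lY j := M_lin hM (MY j).
have AM : A `<=` M by move=> _ [p ->]; exact: (M_ev hM).
have Aid : A id by exists 1; apply/funext => v; rewrite ev1.
have AD S1 S2 : A S1 -> A S2 -> A (S1 + S2).
  by move=> [p ->] [q ->]; exists (p + q); apply/funext => v; rewrite evD.
have AZ c S : A S -> A (c *: S).
  by move=> [p ->]; exists (c *: p); apply/funext => v; rewrite evZ.
have AC S1 S2 : A S1 -> A S2 -> A (S1 \o S2).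
  by move=> [p ->] [q ->]; exists (p * q); apply/funext => v; rewrite (evM lY).
have Aa S : A S -> A (adj S).
  by move=> [p ->]; exists (ncstar p); exact: (adj_ev saY).
(* [Wstar Y] is contained in every von Neumann algebra that contains [Y], and [commP] is one. *)
have cT : commP M tau A T.
  apply: BT; first exact: (commP_vn hM AM Aid AD AZ AC Aa).
  move=> j; apply: (commP_A hM AM Aid AD AZ AC Aa).
  by exists (mon 1 [:: j]); apply/funext => v; rewrite ev_mon /= scale1r.
have [_ [p ->] hp] := commP_dense hM AM Aid AD AZ cT e0.
by exists p.
Qed.

Lemma Wstar_kaplansky (Kb : nat -> R) T : (forall j, 0 <= Kb j) ->
  (forall j, opnorm_le (Y j) (Kb j)) -> B T -> sa_op T ->
  exists2 L, 0 < L & forall e, 0 < e ->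
    exists2 h, n2 (ev Y h - T) <= e & ubounded Kb L h.
Proof.
move=> Kb0 YK BT sT; apply: (kaplansky hM MY saY Kb0 YK (B := B)) => //.
- exact: Wstar_M.
- exact: Wstar_id.
- exact: Wstar_add.
- exact: Wstar_scale.
- exact: Wstar_comp.
- exact: Wstar_dense.
Qed.

Lemma op_lawE (J : choiceType) (X : J -> H -> H) p : op_law tau X p = tau (ev X p).
Proof. by rewrite /op_law; congr tau; apply/funext => v; rewrite ev_unlock. Qed.

End GeneratedAlgebra.

(** * Matrices with the operator norm and the normalized Hilbert-Schmidt norm *)

Section MatrixSpace.
Variables (R : realType).
Local Notation C := (R[i]).

Definition cdot n (x y : 'cV[C]_n) : C := \sum_i x i 0 * (y i 0)^*.

Lemma cdot_sdot n : sdot (fun _ : 'cV[C]_n => True) (@cdot n).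
Proof.
split=> // [x y z _ _ _|c x z _ _|x y _ _|x _]; rewrite /cdot.
- by rewrite -big_split /=; apply: eq_bigr => i _; rewrite mxE mulrDl.
- by rewrite mulr_sumr; apply: eq_bigr => i _; rewrite mxE mulrA.
- rewrite rmorph_sum; apply: eq_bigr => i _.
  by rewrite [RHS]conjM conjK mulrC.
- by apply: sumr_ge0 => i _; rewrite mulc_conj lecR sqr_ge0.
Qed.

Definition cnorm n (x : 'cV[C]_n) : R := snorm (@cdot n) x.

Lemma sqr_cnorm n (x : 'cV[C]_n) : cnorm x ^+ 2 = \sum_i normc (x i 0) ^+ 2.
Proof.
rewrite (sqr_snorm (cdot_sdot n))// /cdot Re_sum; apply: eq_bigr => i _.
by rewrite mulc_conj.
Qed.

Lemma cnormE n (x : 'cV[C]_n) : sqrtC (\sum_i `|x i 0| ^+ 2) = (cnorm x)%:C%C.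
Proof.
have -> : \sum_i `|x i 0| ^+ 2 = ((cnorm x)%:C%C) ^+ 2.
  rewrite -rmorphXn sqr_cnorm rmorph_sum; apply: eq_bigr => i _.
  by rewrite normcE' -rmorphXn.
by rewrite sqrCK// lecR snorm_ge0.
Qed.

Lemma mx_opnormP n (A : 'M[C]_n) r : mx_opnorm_le A r <->
  0 <= r /\ forall v, cnorm (A *m v) <= r * cnorm v.
Proof.
by split=> -[r0 h]; split=> // v; have := h v; rewrite !cnormE -rmorphM lecR.
Qed.

Lemma adjmxE m n (A : 'M[C]_(m, n)) i j : (map_mx Num.conj A)^T i j = (A j i)^*.
Proof. by rewrite !mxE. Qed.

Lemma cdot_adj n (A : 'M[C]_n) x y : cdot (A *m x) y = cdot x (adjmx A *m y).
Proof.
rewrite /cdot; under eq_bigr do rewrite mxE mulr_suml.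
rewrite exchange_big /=; apply: eq_bigr => j _; rewrite mxE rmorph_sum mulr_sumr.
by apply: eq_bigr => i _; rewrite rmorphM /= adjmxE conjK; ring.
Qed.

Lemma adjmxK n (A : 'M[C]_n) : adjmx (adjmx A) = A.
Proof. by apply/matrixP => i j; rewrite !adjmxE conjK. Qed.

Lemma adjmxM n (A B : 'M[C]_n) : adjmx (A *m B) = adjmx B *m adjmx A.
Proof. by rewrite /adjmx map_mxM trmx_mul. Qed.

Lemma adjmxD n (A B : 'M[C]_n) : adjmx (A + B) = adjmx A + adjmx B.
Proof. by rewrite /adjmx map_mxD linearD. Qed.

Lemma adjmxN n (A : 'M[C]_n) : adjmx (- A) = - adjmx A.
Proof. by rewrite /adjmx map_mxN linearN. Qed.

Lemma adjmxB n (A B : 'M[C]_n) : adjmx (A - B) = adjmx A - adjmx B.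
Proof. by rewrite adjmxD adjmxN. Qed.

Lemma adjmxZ n c (A : 'M[C]_n) : adjmx (c *: A) = c^* *: adjmx A.
Proof. by rewrite /adjmx map_mxZ linearZ. Qed.

Lemma adjmx1 n : adjmx (1%:M : 'M[C]_n) = 1%:M.
Proof. by rewrite /adjmx map_mx1 trmx1. Qed.

Lemma mx_opnorm_adj n (A : 'M[C]_n) r : mx_opnorm_le A r -> mx_opnorm_le (adjmx A) r.
Proof.
move=> /mx_opnormP[r0 hA]; apply/mx_opnormP; split=> // v.
set w := adjmx A *m v.
have w0 : 0 <= cnorm w := snorm_ge0 _ _.
have : cnorm w ^+ 2 <= r * cnorm v * cnorm w.
  rewrite {1}/cnorm (sqr_snorm (cdot_sdot n))// {2}/w -cdot_adj.
  apply: le_trans (Re_le_normc _) _; apply: le_trans (cauchy_schwarz (cdot_sdot n) _ _) _ => //.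
  by rewrite -!/(cnorm _) [leRHS]mulrAC ler_wpM2r ?hA ?snorm_ge0.
move: w0; rewrite le_eqVlt => /predU1P[<- _|w0].
  by rewrite mulr_ge0// snorm_ge0.
by rewrite expr2 ler_pM2r.
Qed.

Lemma mx_opnorm_mul n (A B : 'M[C]_n) r s :
  mx_opnorm_le A r -> mx_opnorm_le B s -> mx_opnorm_le (A *m B) (r * s).
Proof.
move=> /mx_opnormP[r0 hA] /mx_opnormP[s0 hB]; apply/mx_opnormP; split.
  exact: mulr_ge0.
by move=> v; rewrite -mulmxA; apply: le_trans (hA _) _; rewrite -mulrA ler_wpM2l.
Qed.

Lemma mx_opnorm_add n (A B : 'M[C]_n) r s :
  mx_opnorm_le A r -> mx_opnorm_le B s -> mx_opnorm_le (A + B) (r + s).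
Proof.
move=> /mx_opnormP[r0 hA] /mx_opnormP[s0 hB]; apply/mx_opnormP; split.
  exact: addr_ge0.
move=> v; rewrite mulmxDl mulrDl; apply: le_trans (snormD (cdot_sdot n) _ _) _ => //.
by rewrite lerD ?hA ?hB.
Qed.

Lemma mx_opnorm_scale n c (A : 'M[C]_n) r :
  mx_opnorm_le A r -> mx_opnorm_le (c *: A) (normc c * r).
Proof.
move=> /mx_opnormP[r0 hA]; apply/mx_opnormP; split; first by rewrite mulr_ge0// normc_ge0.
move=> v; rewrite -scalemxAl /cnorm (snormZ (cdot_sdot n))// -mulrA ler_wpM2l ?normc_ge0//.
exact: hA.
Qed.

Lemma mx_opnorm_trans n (A : 'M[C]_n) r s :
  r <= s -> mx_opnorm_le A r -> mx_opnorm_le A s.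
Proof.
move=> rs /mx_opnormP[r0 hA]; apply/mx_opnormP; split; first exact: le_trans rs.
by move=> v; apply: le_trans (hA v) _; rewrite ler_wpM2r ?snorm_ge0.
Qed.

Lemma mx_opnorm1 n : mx_opnorm_le (1%:M : 'M[C]_n) 1.
Proof. by apply/mx_opnormP; split=> // v; rewrite mul1mx mul1r. Qed.

Definition mdot n (A B : 'M[C]_n) : C := ntr (adjmx B *m A).

Lemma ntrD n (A B : 'M[C]_n) : ntr (A + B) = ntr A + ntr B.
Proof. by rewrite /ntr mxtraceD mulrDr. Qed.

Lemma ntrZ n c (A : 'M[C]_n) : ntr (c *: A) = c * ntr A.
Proof. by rewrite /ntr mxtraceZ mulrCA. Qed.

Lemma ntr_mulC n (A B : 'M[C]_n) : ntr (A *m B) = ntr (B *m A).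
Proof. by rewrite /ntr mxtrace_mulC. Qed.

Lemma ntr_adj n (A : 'M[C]_n) : ntr (adjmx A) = (ntr A)^*.
Proof.
rewrite /ntr [RHS]conjM fmorphV rmorph_nat; congr (_ * _).
rewrite /mxtrace rmorph_sum; apply: eq_bigr => i _.
by rewrite adjmxE.
Qed.

Lemma mdot_col n (A B : 'M[C]_n) : mdot A B = n%:R^-1 * \sum_j cdot (col j A) (col j B).
Proof.
rewrite /mdot /ntr /mxtrace; congr (_ * _); apply: eq_bigr => j _.
rewrite mxE /cdot; apply: eq_bigr => i _.
by rewrite adjmxE !mxE mulrC.
Qed.

Lemma mdot_sdot n : sdot (fun _ : 'M[C]_n => True) (@mdot n).
Proof.
split=> // [x y z _ _ _|c x z _ _|x y _ _|x _].
- by rewrite /mdot mulmxDr ntrD.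
- by rewrite /mdot -scalemxAr ntrZ.
- by rewrite /mdot -ntr_adj adjmxM adjmxK.
- rewrite mdot_col mulr_ge0 ?invr_ge0//; apply: sumr_ge0 => j _.
  exact: (sdot_ge0 (cdot_sdot n)).
Qed.

Definition hsn n (A : 'M[C]_n) : R :=
  locked_with nc_key (fun A => snorm (@mdot n) A) A.

Lemma hsnE n (A : 'M[C]_n) : hsn A = snorm (@mdot n) A.
Proof. by rewrite /hsn unlock. Qed.

Lemma norm2E n (A : 'M[C]_n) : norm2 A = (hsn A)%:C%C.
Proof.
rewrite hsnE /norm2 -/(mdot A A) (sdot_snorm (mdot_sdot n))// rmorphXn.
by rewrite sqrCK// lecR snorm_ge0.
Qed.

Lemma hsn_ge0 n (A : 'M[C]_n) : 0 <= hsn A.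
Proof. by rewrite hsnE snorm_ge0. Qed.

(** Splitting into columns reduces bounds on left multiplication to the action on vectors. *)
Lemma sqr_hsn n (A : 'M[C]_n) : hsn A ^+ 2 = n%:R^-1 * \sum_j cnorm (col j A) ^+ 2.
Proof.
rewrite hsnE (sqr_snorm (mdot_sdot n))// mdot_col.
have -> : n%:R^-1 = (n%:R^-1)%:C%C :> C by rewrite fmorphV rmorph_nat.
rewrite ReZ Re_sum; congr (_ * _); apply: eq_bigr => j _.
by rewrite (sqr_snorm (cdot_sdot n)).
Qed.

Lemma hsn_mull n (A B : 'M[C]_n) r : mx_opnorm_le A r -> hsn (A *m B) <= r * hsn B.
Proof.
move=> /mx_opnormP[r0 hA].
rewrite -(@ler_pXn2r _ 2) ?nnegrE ?mulr_ge0 ?hsn_ge0// exprMn !sqr_hsn mulrCA.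
rewrite ler_wpM2l ?invr_ge0// mulr_sumr; apply: ler_sum => j _.
rewrite -exprMn ler_pXn2r ?nnegrE ?mulr_ge0 ?snorm_ge0// colE -mulmxA -colE.
exact: hA.
Qed.

Lemma hsn_adj n (A : 'M[C]_n) : hsn (adjmx A) = hsn A.
Proof. by rewrite !hsnE /snorm /mdot adjmxK ntr_mulC. Qed.

Lemma hsn_mulr n (A B : 'M[C]_n) r : mx_opnorm_le A r -> hsn (B *m A) <= r * hsn B.
Proof.
move=> hA; rewrite -hsn_adj adjmxM -(hsn_adj B); apply: hsn_mull.
exact: mx_opnorm_adj.
Qed.

Lemma hsn0 n : hsn (0 : 'M[C]_n) = 0.
Proof. by rewrite hsnE (snorm0 (mdot_sdot n)). Qed.

Lemma hsnD n (A B : 'M[C]_n) : hsn (A + B) <= hsn A + hsn B.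
Proof. by rewrite !hsnE; exact: (snormD (mdot_sdot n)). Qed.

Lemma hsnZ n c (A : 'M[C]_n) : hsn (c *: A) = normc c * hsn A.
Proof. by rewrite !hsnE; exact: (snormZ (mdot_sdot n)). Qed.

Lemma hsnN n (A : 'M[C]_n) : hsn (- A) = hsn A.
Proof. by rewrite !hsnE; exact: (snormN (mdot_sdot n)). Qed.

Lemma hsnB n (A B : 'M[C]_n) : hsn (A - B) = hsn (B - A).
Proof. by rewrite !hsnE; exact: (snormB (mdot_sdot n)). Qed.

Lemma hsn_dist n (B A D : 'M[C]_n) : hsn (A - D) <= hsn (A - B) + hsn (B - D).
Proof. by rewrite -[A - D](subrKA B) hsnD. Qed.

Lemma hsn1_le n : hsn (1%:M : 'M[C]_n) <= 1.
Proof.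
rewrite -(@ler_pXn2r _ 2) ?nnegrE ?hsn_ge0// hsnE (sqr_snorm (mdot_sdot n))//.
rewrite /mdot adjmx1 mulmx1 /ntr mxtrace1.
(* In dimension 0 the normalized trace of the identity is 0, so only an inequality holds. *)
case: n => [|n]; first by rewrite invr0 mul0r /= expr1n.
by rewrite mulVf ?pnatr_eq0//= expr1n.
Qed.

Lemma normc_ntr_le n (A : 'M[C]_n) : normc (ntr A) <= hsn A.
Proof.
have := cauchy_schwarz (mdot_sdot n) (I : True) (I : True) (x := A) (y := 1%:M).
rewrite /mdot adjmx1 mul1mx -!hsnE => /le_trans; apply.
by rewrite ler_piMr ?hsn_ge0//; exact: hsn1_le.
Qed.

Lemma hsn_le_op n (A : 'M[C]_n) r : mx_opnorm_le A r -> hsn A <= r.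
Proof.
move=> hA; have r0 : 0 <= r by case: hA.
rewrite -[A]mulmx1; apply: le_trans (hsn_mull _ hA) _.
by rewrite ler_piMr// hsn1_le.
Qed.

Variable J0 : choiceType.
Local Notation ncp := (ncpoly R J0).

(** Left multiplications applied to the identity matrix; by [mev_mul] the same matrix describes the
    action on column vectors, which transfers [ev_bound] and [ubounded]. *)
Definition mev n (Z : J0 -> 'M[C]_n) (p : ncp) : 'M[C]_n :=
  ev (fun i B => Z i *m B) p 1%:M.

Lemma mx_lawE n (Z : J0 -> 'M[C]_n) p : mx_law Z p = ntr (mev Z p).
Proof. by rewrite /mx_law /mev ev_unlock. Qed.

Lemma mul_linear n k (Z : J0 -> 'M[C]_n) i : linear (fun B : 'M[C]_(n, k) => Z i *m B).
Proof. by move=> c x y; rewrite mulmxDr scalemxAr. Qed.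

Lemma mev_mul n k (Z : J0 -> 'M[C]_n) p (B : 'M[C]_(n, k)) :
  ev (fun i (B : 'M[C]_(n, k)) => Z i *m B) p B = mev Z p *m B.
Proof.
rewrite /mev; elim/ncpoly_ind: p => [|p q IHp IHq|c w].
- by rewrite !ev0 mul0mx.
- by rewrite !(evD _ p) IHp IHq mulmxDl.
rewrite !ev_mon -scalemxAl; congr (_ *: _).
by elim: w => [|i w IH] /=; rewrite ?mul1mx// IH mulmxA.
Qed.

Lemma mevM n (Z : J0 -> 'M[C]_n) p q : mev Z (p * q) = mev Z p *m mev Z q.
Proof. by rewrite {1}/mev (evM (mul_linear Z)) mev_mul. Qed.

Lemma mevD n (Z : J0 -> 'M[C]_n) p q : mev Z (p + q) = mev Z p + mev Z q.
Proof. by rewrite /mev evD. Qed.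

Lemma mevB n (Z : J0 -> 'M[C]_n) p q : mev Z (p - q) = mev Z p - mev Z q.
Proof. by rewrite /mev evB. Qed.

Lemma mevZ n (Z : J0 -> 'M[C]_n) c p : mev Z (c *: p) = c *: mev Z p.
Proof. by rewrite /mev evZ. Qed.

Lemma mev1 n (Z : J0 -> 'M[C]_n) : mev Z 1 = 1%:M.
Proof. by rewrite /mev ev1. Qed.

Lemma mev_adj n (Z : J0 -> 'M[C]_n) p : (forall i, samx (Z i)) ->
  adjmx (mev Z p) = mev Z (ncstar p).
Proof.
move=> saZ; elim/ncpoly_ind: p => [|p q IHp IHq|c w].
- rewrite ncstarE msum0 /mev !ev0; apply/matrixP => i j.
  by rewrite adjmxE mxE [LHS]conjc0 mxE.
- by rewrite ncstarD !(mevD _ _ (ncstar q), mevD _ _ q) adjmxD IHp IHq.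
rewrite ncstar_mon /mev !ev_mon adjmxZ; congr (_ *: _).
elim: w => [|i w IH]; first by rewrite /rev /= adjmx1.
rewrite rev_cons -cats1 wev_cat /= mulmx1 adjmxM IH saZ.
elim: (rev w) => [|j u IHu] /=; first by rewrite mul1mx.
by rewrite -mulmxA IHu.
Qed.

Lemma mx_opnorm_cnorm n (Z : J0 -> 'M[C]_n) (K : J0 -> R) i (v : 'cV[C]_n) :
  mx_opnorm_le (Z i) (K i) ->
  snorm (@cdot n) (Z i *m v) <= K i * snorm (@cdot n) v.
Proof. by move=> /mx_opnormP[_]; exact. Qed.

Lemma mev_bound n (Z : J0 -> 'M[C]_n) (K : J0 -> R) p :
  (forall i, mx_opnorm_le (Z i) (K i)) -> mx_opnorm_le (mev Z p) (pbound K p).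
Proof.
move=> ZK; have K0 i : 0 <= K i by case: (ZK i).
apply/mx_opnormP; split; first exact: pbound_ge0.
move=> v; rewrite -mev_mul; apply: (ev_bound (cdot_sdot n)) => // i u.
exact: mx_opnorm_cnorm.
Qed.

Lemma mev_ubounded n (Z : J0 -> 'M[C]_n) (K : J0 -> R) L h : 0 <= L ->
  (forall i, samx (Z i)) -> (forall i, mx_opnorm_le (Z i) (K i)) ->
  ubounded K L h -> mx_opnorm_le (mev Z h) L.
Proof.
move=> L0 saZ ZK uh; apply/mx_opnormP; split=> // v; rewrite -mev_mul.
apply: (uh _ _ _ (cdot_sdot n)) => [i|i x y|i u].
- exact: mul_linear.
- by rewrite cdot_adj saZ.
- exact: mx_opnorm_cnorm.
Qed.

Lemma sqr_hsn_mev n (Z : J0 -> 'M[C]_n) p : (forall i, samx (Z i)) ->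
  hsn (mev Z p) ^+ 2 = Re (mx_law Z (ncstar p * p)).
Proof.
by move=> saZ; rewrite hsnE (sqr_snorm (mdot_sdot n))// /mdot mev_adj// -mevM mx_lawE.
Qed.

End MatrixSpace.

(** * Laws of operator tuples and of matrix tuples *)

Section OperatorLaw.
Variables (R : realType) (H : hilbert R) (M : set (H -> H)).
Variables (tau : (H -> H) -> R[i]).
Hypothesis hM : tracial_vna M tau.
Variables (J0 : choiceType) (X : J0 -> H -> H).
Hypotheses (MX : forall i, M (X i)) (saX : forall i, sa_op (X i)).

Lemma sqr_n2_ev p : n2 tau (ev X p) ^+ 2 = Re (op_law tau X (ncstar p * p)).
Proof.
rewrite (sqr_n2 hM); last exact: (M_ev hM).
rewrite op_lawE (adj_ev saX); congr (Re (tau _)); apply/funext => v.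
by rewrite (evM (fun i => M_lin hM (MX i))).
Qed.

Lemma normc_tau_op T r : M T -> opnorm_le T r -> normc (tau T) <= r.
Proof. by move=> MT hT; apply: le_trans (normc_tau_le hM MT) (n2_le_op hM MT hT). Qed.

Lemma op_law_mulC (p q : ncpoly R J0) : op_law tau X (p * q) = op_law tau X (q * p).
Proof.
have lX i := M_lin hM (MX i).
have h p' q' : op_law tau X (p' * q') = tau (ev X p' \o ev X q').
  by rewrite op_lawE; congr tau; apply/funext => v; rewrite evM.
have c := tau_comm hM (M_ev hM MX p) (M_ev hM MX q).
exact: etrans (h p q) (etrans c (esym (h q p))).
Qed.

Lemma op_law_is_law (K : J0 -> R) : (forall i, 0 < K i) ->
  (forall i, opnorm_le (X i) (K i)) -> is_law (op_law tau X).
Proof.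
move=> K0 XK; have lX i := M_lin hM (MX i).
have Mev p := M_ev hM MX p.
split.
- move=> c p q; rewrite !op_lawE -(tau_scale hM)// -(tau_add hM)//; last by inM.
  by congr tau; apply/funext => v; rewrite evD; congr (_ + _); exact: evZ.
- rewrite op_lawE (_ : ev X 1 = id) ?(tau_id hM)//.
  by apply/funext => v; rewrite ev1.
- move=> p; rewrite op_lawE (_ : ev X _ = adj (ev X p) \o ev X p); last first.
    by rewrite (adj_ev saX); apply/funext => v; rewrite evM.
  apply: (tvna_positive hM); first by inM.
  exact: (positive_adjM hM).
- exact: op_law_mulC.
exists K; split=> // w; rewrite normcE' lecR op_lawE.
have -> : ev X (ncword R w) = wev X w.
  by apply/funext => v; rewrite /ncword -monE ev_mon scale1r.
apply: normc_tau_op.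
  have := Mev (mon 1 w); congr M; apply/funext => v.
  by rewrite ev_mon scale1r.
apply/opnormP; split; first by apply: prodr_ge0 => i _; exact: ltW.
move=> v; apply: (wev_bound (dot := @hdot R H)) => [i|i u]; first exact: ltW.
by have /opnormP[_] := XK i; exact.
Qed.

End OperatorLaw.

Section MatrixLaw.
Variables (R : realType) (J0 : choiceType) (n : nat).
Variables (Z : J0 -> 'M[R[i]]_n) (K : J0 -> R).

Lemma mx_law_mulC (p q : ncpoly R J0) : mx_law Z (p * q) = mx_law Z (q * p).
Proof.
have h p' q' : mx_law Z (p' * q') = ntr (mev Z p' *m mev Z q').
  by rewrite mx_lawE mevM.
exact: etrans (h p q) (etrans (ntr_mulC _ _) (esym (h q p))).
Qed.

Lemma mx_law_is_law : (0 < n)%N -> (forall i, samx (Z i)) -> (forall i, 0 < K i) ->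
  (forall i, mx_opnorm_le (Z i) (K i)) -> is_law (mx_law Z).
Proof.
move=> n0 saZ K0 ZK; split.
- by move=> c p q; rewrite !mx_lawE mevD ntrD mevZ ntrZ.
- by rewrite mx_lawE mev1 /ntr mxtrace1 mulVf// pnatr_eq0 -lt0n.
- move=> p; rewrite mx_lawE mevM -mev_adj//.
  by rewrite -[ntr _]/(mdot _ _) (sdot_snorm (mdot_sdot R n))// lecR sqr_ge0.
- exact: mx_law_mulC.
exists K; split=> // w; rewrite normcE' lecR mx_lawE.
apply: le_trans (normc_ntr_le _) _; apply: hsn_le_op; apply/mx_opnormP; split.
  by apply: prodr_ge0 => i _; exact: ltW.
move=> v; rewrite -mev_mul /ncword -monE ev_mon scale1r.
apply: (wev_bound (dot := @cdot R n)) => [i|i u]; first exact: ltW.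
exact: mx_opnorm_cnorm.
Qed.

End MatrixLaw.

(** * Embeddings into the ultraproduct *)

Section UltrafilterLimits.
Variables (R : realType) (U : set_system nat).
Hypothesis hU : nonprincipal_ultrafilter U.
Local Notation C := (R[i]).

Lemma ultra_pf : ProperFilter U.
Proof. by case: hU => -[]. Qed.
#[local] Instance ultra_instance0 : ProperFilter U := ultra_pf.

Lemma ultra_or (A : set nat) : U A \/ U (~` A).
Proof. by case: hU => UU _; exact: in_ultra_setVsetC. Qed.

(** A nonprincipal ultrafilter contains the complement of every point, hence every tail. *)
Lemma ultra_ge K : U [set n | (K <= n)%N].
Proof.
elim: K => [|K IH]; first by apply: filterE.
have [|h] := ultra_or [set K]; first by case: hU => _ /(_ K).
apply: filterS2 IH h => n /= Kn nK; rewrite ltn_neqAle Kn andbT eq_sym.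
by apply/eqP.
Qed.

Lemma ucvgP (f : nat -> C) (l : C) : ((f : nat -> C^o) @ U --> (l : C^o)) <->
  forall e, 0 < e -> U [set n | normc (f n - l) <= e].
Proof.
split=> [/cvgrPdist_le h e e0|h].
  have := h e%:C%C; rewrite ltcR => /(_ e0); apply: filterS => n /=.
  by rewrite normcE' lecR normcB.
apply/cvgrPdist_le => e e0.
have [e1 [-> e10]] : exists e1 : R, e = e1%:C%C /\ 0 < e1.
  exists (Re e); move: e0; case: e => a b; rewrite ltcE /= => /andP[/eqP ->].
  by split.
by apply: filterS (h _ e10) => n /=; rewrite normcE' lecR normcB.
Qed.

(** kappa n is the largest k <= n with P k n. The cap n makes the maximum exist, and wherever K <= n
    and P K n hold, which happens along U, it is at least K. *)
Lemma diagonal (P : nat -> nat -> Prop) : (forall k, U [set n | P k n]) ->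
  exists kappa : nat -> nat, forall K, U [set n | (K <= kappa n)%N /\ P (kappa n) n].
Proof.
move=> UP; pose p n k := `[< P k n >] && (k <= n)%N.
have pn n : (exists k, p n k) -> {k | p n k & forall j, p n j -> (j <= k)%N}.
  move=> h; case: (@ex_maxnP (p n) n h) => [k /andP[]//|k pk hk].
  by exists k.
pose kappa n := if pselect (exists k, p n k) is left h then s2val (pn n h) else 0%N.
exists kappa => K; apply: filterS2 (UP K) (ultra_ge K) => n /= PK Kn.
have pK : p n K by rewrite /p Kn andbT; exact/asboolP.
rewrite /kappa; case: pselect => [h|[]]; last by exists K.
by case: (pn n h) => k /= /andP[/asboolP Pk _] hk; split=> //; exact: hk.
Qed.

Lemma ucosetP (a b : mxseq R) : ucoset U a b <-> bounded_mxseq b /\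
  forall e, 0 < e -> U [set n | hsn (b n - a n) <= e].
Proof.
have h : (((fun n => norm2 (b n - a n)) : nat -> C^o) @ U --> (0 : C^o)) <->
    forall e, 0 < e -> U [set n | hsn (b n - a n) <= e].
  rewrite ucvgP; have E n : normc (norm2 (b n - a n) - 0) = hsn (b n - a n).
    by rewrite subr0 norm2E normcR ger0_norm// hsn_ge0.
  by split=> h e /h; apply: filterS => n /=; rewrite E.
by split=> -[bb /h].
Qed.

Lemma ucoset_refl (a : mxseq R) : bounded_mxseq a -> ucoset U a a.
Proof.
move=> ba; apply/ucosetP; split=> // e e0; apply: filterE => n /=.
by rewrite subrr hsn0 ltW.
Qed.

Lemma ucoset_eq (a b : mxseq R) : bounded_mxseq a -> ucoset U a b ->
  ucoset U a = ucoset U b.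
Proof.
move=> ba /ucosetP[bb h].
have sub (a1 b1 : mxseq R) : (forall e, 0 < e -> U [set n | hsn (a1 n - b1 n) <= e]) ->
    ucoset U a1 `<=` ucoset U b1.
  move=> h1 c /ucosetP[bc hc]; apply/ucosetP; split; [exact: bc|move=> e e0].
  have e20 : 0 < e / 2 by rewrite divr_gt0.
  apply: filterS2 (hc _ e20) (h1 _ e20) => n /= h2 h3.
  by apply: le_trans (hsn_dist (a1 n) _ _) _; rewrite [leRHS]splitr lerD.
apply/seteqP; split; apply: sub => // e e0.
by apply: filterS (h _ e0) => n /=; rewrite hsnB.
Qed.

End UltrafilterLimits.

Section EmbeddingExists.
Variables (R : realType) (H : hilbert R) (M : set (H -> H)).
Variables (tau : (H -> H) -> R[i]).
Hypothesis hM : tracial_vna M tau.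
Variables (Y : nat -> H -> H) (Kb : nat -> R).
Hypotheses (MY : forall j, M (Y j)) (saY : forall j, sa_op (Y j)).
Hypotheses (Kb0 : forall j, 0 <= Kb j) (YK : forall j, opnorm_le (Y j) (Kb j)).
Variable U : set_system nat.
Hypothesis hU : nonprincipal_ultrafilter U.
Variable Yn : forall n, nat -> 'M[R[i]]_n.
Hypotheses (saYn : forall n j, samx (Yn n j))
  (YnK : forall n j, mx_opnorm_le (Yn n j) (Kb j)).
Hypothesis law_cv : forall p e, 0 < e ->
  U [set n | normc (mx_law (Yn n) p - op_law tau Y p) <= e].
Local Notation C := (R[i]).
Local Notation n2 := (n2 tau).
Local Notation B := (Wstar Y).
#[local] Instance ultra_instance : ProperFilter U := ultra_pf hU.

Let Mev p : M (ev Y p) := M_ev hM MY p.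

(** The square of the 2-norm is the law at the product of p with its involution, so 2-norms of
    polynomials converge with the laws. *)
Lemma hsn_mev_le p e : 0 < e ->
  U [set n | hsn (mev (Yn n) p) <= n2 (ev Y p) + e].
Proof.
move=> e0; apply: filterS (law_cv (ncstar p * p) (exprn_gt0 2 e0)) => n /= h.
rewrite -(@ler_pXn2r _ 2) ?nnegrE ?addr_ge0 ?hsn_ge0 ?n2_ge0 ?(ltW e0)//.
rewrite sqr_hsn_mev// sqrrD (sqr_n2_ev hM MY saY).
have := le_trans (Re_le_normc _) h; rewrite ReB.
have : 0 <= n2 (ev Y p) * e by rewrite mulr_ge0 ?n2_ge0 ?(ltW e0).
by rewrite -mulr_natl; lra.
Qed.

(* a is a lift of S: by Kaplansky density S is a 2-norm limit of polynomials in
   Y bounded uniformly on matrices, and a diagonal choice of them is bounded. *)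
Definition represents (a : mxseq R) (S : H -> H) := bounded_mxseq a /\
  forall e, 0 < e -> exists2 p, n2 (S - ev Y p) <= e &
    U [set n | hsn (a n - mev (Yn n) p) <= e].

Lemma hsn_mev_diff p q S d e : M S -> 0 < e -> n2 (S - ev Y p) <= d ->
  n2 (S - ev Y q) <= d -> U [set n | hsn (mev (Yn n) p - mev (Yn n) q) <= d + d + e].
Proof.
move=> MS e0 hp hq; apply: filterS (hsn_mev_le (p - q) e0) => n /=.
rewrite mevB => /le_trans; apply; rewrite lerD2r.
have -> : ev Y (p - q) = (S - ev Y q) - (S - ev Y p).
  apply/funext => v; rewrite evB -[RHS]/((S v - ev Y q v) - (S v - ev Y p v)).
  by rewrite opprB [RHS]addrC subrKA.
by apply: le_trans (n2_sub_le hM _ _) _; [inM|inM|exact: lerD].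
Qed.

Lemma represents_uniq a b S : M S -> represents a S -> represents b S ->
  forall e, 0 < e -> U [set n | hsn (b n - a n) <= e].
Proof.
move=> MS [_ ha] [_ hb] e e0; have e50 : 0 < e / 5 by rewrite divr_gt0.
have [p hp hpa] := ha _ e50; have [q hq hqb] := hb _ e50.
have hpq := hsn_mev_diff MS e50 hq hp.
apply: filterS3 hpa hqb hpq => n /= h1 h2 h3.
apply: le_trans (hsn_dist (mev (Yn n) q) _ _) _.
apply: le_trans (lerD h2 (hsn_dist (mev (Yn n) p) _ _)) _.
rewrite [hsn (_ - a n)]hsnB; apply: le_trans (lerD (lexx _) (lerD h3 h1)) _; lra.
Qed.

Lemma represents_cong a b S : represents a S -> bounded_mxseq b ->
  (forall e, 0 < e -> U [set n | hsn (b n - a n) <= e]) -> represents b S.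
Proof.
move=> [_ ha] bb hab; split; [exact: bb|move=> e e0]; have e20 : 0 < e / 2 by rewrite divr_gt0.
have [p hp hpa] := ha _ e20; exists p; first by apply: le_trans hp _; lra.
apply: filterS2 hpa (hab _ e20) => n /= h1 h2.
by apply: le_trans (hsn_dist (a n) _ _) _; rewrite [leRHS]splitr lerD.
Qed.

Lemma represents_id : represents (fun n => 1%:M) id.
Proof.
split; first by exists 1 => n; exact: mx_opnorm1.
move=> e e0; exists 1.
  rewrite (_ : ev Y 1 = id); last by apply/funext => v; rewrite ev1.
  by rewrite subrr /n2 (snorm0 (tdot_sdot hM)) ltW.
by apply: filterE => n /=; rewrite mev1 subrr hsn0 ltW.
Qed.

Lemma represents_gen j : represents (fun n => Yn n j) (Y j).
Proof.
split; first by exists (Kb j) => n.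
move=> e e0; exists (mon 1 [:: j]).
  rewrite (_ : ev Y _ = Y j); last by apply/funext => v; rewrite ev_mon scale1r.
  by rewrite subrr /n2 (snorm0 (tdot_sdot hM)) ltW.
apply: filterE => n /=; rewrite /mev ev_mon scale1r /= mulmx1 subrr.
by rewrite hsn0 ltW.
Qed.

Lemma represents_add a b S T : M S -> M T -> represents a S -> represents b T ->
  represents (fun n => a n + b n) (S + T).
Proof.
move=> MS MT [[ra hra] ha] [[rb hrb] hb]; split.
  by exists (ra + rb) => n; exact: mx_opnorm_add.
move=> e e0; have e20 : 0 < e / 2 by rewrite divr_gt0.
have [p hp hpa] := ha _ e20; have [q hq hqb] := hb _ e20; exists (p + q).
  have -> : S + T - ev Y (p + q) = (S - ev Y p) + (T - ev Y q).
    rewrite addrACA -opprD; congr (_ - _); apply/funext => v; exact: evD.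
  by apply: le_trans (n2D hM _ _) _; [inM|inM|rewrite [leRHS]splitr lerD].
apply: filterS2 hpa hqb => n /= h1 h2; rewrite mevD opprD addrACA.
by apply: le_trans (hsnD _ _) _; rewrite [leRHS]splitr lerD.
Qed.

Lemma represents_scale c a S : M S -> represents a S ->
  represents (fun n => c *: a n) (c *: S).
Proof.
move=> MS [[ra hra] ha]; split.
  by exists (normc c * ra) => n; exact: mx_opnorm_scale.
move=> e e0; have c0 : 0 < normc c + 1 by rewrite ltr_wpDl ?normc_ge0.
have le1 x : x <= e / (normc c + 1) -> normc c * x <= e.
  move=> hx; apply: le_trans (_ : (normc c + 1) * (e / (normc c + 1)) <= _); last first.
    by rewrite mulrC divfK// gt_eqF.
  apply: le_trans (_ : normc c * (e / (normc c + 1)) <= _).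
    by rewrite ler_wpM2l ?normc_ge0.
  by rewrite ler_wpM2r ?divr_ge0 ?(ltW e0) ?(ltW c0)// lerDl.
have [p hp hpa] := ha _ (divr_gt0 e0 c0); exists (c *: p).
  have -> : c *: S - ev Y (c *: p) = c *: (S - ev Y p).
    by apply/funext => v; rewrite -[LHS]/(c *: S v - ev Y (c *: p) v) evZ -scalerBr.
  by rewrite (n2Z hM); [exact: le1|inM].
by apply: filterS hpa => n /= h; rewrite mevZ -scalerBr hsnZ; exact: le1.
Qed.

Lemma represents_adj a S : M S -> represents a S ->
  represents (fun n => adjmx (a n)) (adj S).
Proof.
move=> MS [[ra hra] ha]; split.
  by exists ra => n; exact: mx_opnorm_adj.
move=> e e0; have [p hp hpa] := ha _ e0; exists (ncstar p).
  have Mp := Mev p; rewrite -(adj_ev saY) -(adj_sub hM)// (n2_adj hM)//; inM.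
by apply: filterS hpa => n /= h; rewrite -mev_adj// -adjmxB hsn_adj.
Qed.

(** The order of choices matters: q comes first, its coefficient bound Kq controls q both on
    operators and on all matrices, and p is then chosen with precision divided by Kq. *)
Lemma represents_mul a b S T : M S -> M T -> represents a S -> represents b T ->
  represents (fun n => a n *m b n) (S \o T).
Proof.
move=> MS MT [[ra hra] ha] [[rb hrb] hb]; split.
  by exists (ra * rb) => n; exact: mx_opnorm_mul.
move=> e e0; have [s s0 hs] := M_bnd hM MS.
have ra0 : 0 <= ra by case: (hra 0%N).
pose k := s + ra; have k0 : 0 < k by rewrite ltr_wpDr.
have e20 : 0 < e / 2 by rewrite divr_gt0.
have [q hq hqb] := hb _ (divr_gt0 e20 k0).
pose Kq := pbound Kb q + 1.
have Kq0 : 0 < Kq by rewrite ltr_wpDl// pbound_ge0.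
have qK : opnorm_le (ev Y q) Kq.
  apply/opnormP; split; first exact: ltW.
  move=> v; apply: le_trans (ev_bound (hdot_sdot H) Kb0 _ q v) _.
    by move=> i u; have /opnormP[_] := YK i; exact.
  by rewrite ler_wpM2r ?hnorm_ge0// lerDl.
have [p hp hpa] := ha _ (divr_gt0 e20 Kq0).
have lS := M_lin hM MS; have le_k x y : 0 <= y -> y <= k -> x <= e / 2 / k -> y * x <= e / 2.
  move=> y0 yk hx; apply: le_trans (_ : y * (e / 2 / k) <= _); first by rewrite ler_wpM2l.
  apply: (@le_trans _ _ (k * (e / 2 / k))); last by rewrite mulrC divfK// gt_eqF.
  by rewrite ler_wpM2r// ltW// divr_gt0.
have le_K x : x <= e / 2 / Kq -> Kq * x <= e / 2.
  by move=> hx; rewrite mulrC -ler_pdivlMr.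
exists (p * q).
  have -> : (S \o T) - ev Y (p * q) = (S \o (T - ev Y q)) + ((S - ev Y p) \o ev Y q).
    apply/funext => v.
    rewrite -[RHS]/(S (T v - ev Y q v) + (S (ev Y q v) - ev Y p (ev Y q v))).
    rewrite (lin_subE lS) subrKA -[LHS]/(S (T v) - ev Y (p * q) v).
    by rewrite (evM (fun j => M_lin hM (MY j))).
  apply: le_trans (n2D hM _ _) _; try by inM.
  have MTq : M (T - ev Y q) by inM.
  have MSp : M (S - ev Y p) by inM.
  rewrite [leRHS]splitr lerD//.
    apply: le_trans (n2_mull hM MS MTq hs) _.
    by apply: le_k => //; rewrite ?(ltW s0)// lerDl.
  by apply: le_trans (n2_mulr hM (Mev q) MSp qK) _; exact: le_K.
apply: filterS2 hpa hqb => n /= h1 h2; rewrite mevM.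
have -> : a n *m b n - mev (Yn n) p *m mev (Yn n) q =
    a n *m (b n - mev (Yn n) q) + (a n - mev (Yn n) p) *m mev (Yn n) q.
  by rewrite mulmxBr mulmxBl subrKA.
apply: le_trans (hsnD _ _) _; rewrite [leRHS]splitr lerD//.
  apply: le_trans (hsn_mull _ (hra n)) _.
  by apply: le_k => //; rewrite lerDr ltW.
have qKn : mx_opnorm_le (mev (Yn n) q) Kq.
  by apply: mx_opnorm_trans (mev_bound q (YnK n)); rewrite lerDl.
by apply: le_trans (hsn_mulr _ qKn) _; exact: le_K.
Qed.

Lemma represents_trace a S : M S -> represents a S ->
  forall e, 0 < e -> U [set n | normc (ntr (a n) - tau S) <= e].
Proof.
move=> MS [_ ha] e e0; have e30 : 0 < e / 3 by rewrite divr_gt0.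
have [p hp hpa] := ha _ e30.
apply: filterS2 hpa (law_cv p e30) => n /= h1 h2.
have -> : ntr (a n) - tau S = ntr (a n - mev (Yn n) p) +
    (mx_law (Yn n) p - op_law tau Y p) - tau (S - ev Y p).
  have -> : ntr (a n - mev (Yn n) p) = ntr (a n) - mx_law (Yn n) p.
    by rewrite ntrD -scaleN1r ntrZ mulN1r mx_lawE.
  by rewrite (tau_sub hM MS (Mev p)) op_lawE; ring.
apply: le_trans (le_normcD _ _) _; rewrite normcN.
apply: le_trans (lerD (le_normcD _ _) (normc_tau_le hM _)) _; first by inM.
apply: le_trans (lerD (lerD (le_trans (normc_ntr_le _) h1) h2) hp) _; lra.
Qed.

Lemma represents_sa_ex S : B S -> sa_op S -> exists a, represents a S.
Proof.
move=> BS sS; have MS := Wstar_M hM MY BS.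
have [L L0 hL] := Wstar_kaplansky hM MY saY Kb0 YK BS sS.
have i0 k : 0 < k.+1%:R^-1 :> R by rewrite invr_gt0.
pose h k := projT1 (cid2 (hL _ (i0 k))).
have hn k : n2 (S - ev Y (h k)) <= k.+1%:R^-1.
  by rewrite (n2B hM)//; rewrite /h; case: cid2.
have hu k : ubounded Kb L (h k) by rewrite /h; case: cid2.
(* At level n, h k stands in for all its predecessors, being 3/(i+1)-close to each h i with i <= k.
   [diagonal] then lets the index grow with n. *)
pose P k n := forall i, (i <= k)%N ->
  hsn (mev (Yn n) (h k) - mev (Yn n) (h i)) <= i.+1%:R^-1 + i.+1%:R^-1 + i.+1%:R^-1.
have UP k : U [set n | P k n].
  have : forall m, U [set n | forall i, (i < m)%N -> (i <= k)%N ->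
     hsn (mev (Yn n) (h k) - mev (Yn n) (h i)) <= i.+1%:R^-1 + i.+1%:R^-1 + i.+1%:R^-1].
    elim=> [|m IH]; first by apply: filterE.
    have [mk|km] := leqP m k; last first.
      apply: filterS IH => n /= IH i; rewrite ltnS leq_eqVlt => /predU1P[->|/IH//].
      by move=> mk; move: km; rewrite ltnNge mk.
    have hk : n2 (S - ev Y (h k)) <= m.+1%:R^-1.
      by apply: le_trans (hn k) _; rewrite lef_pV2 ?posrE// ler_nat.
    apply: filterS2 IH (hsn_mev_diff MS (i0 m) hk (hn m)) => n /= IH h1 i.
    by rewrite ltnS leq_eqVlt => /predU1P[->//|/IH].
  by move=> /(_ k.+1); apply: filterS => n /= h1 i ik; apply: h1.
have [kappa hk] := diagonal hU UP.
exists (fun n => mev (Yn n) (h (kappa n))); split.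
  by exists L => n; apply: mev_ubounded (hu _) => //; exact: ltW.
move=> e e0; have e30 : 0 < e / 3 by rewrite divr_gt0.
have [N hN] := invS_le e30; exists (h N).
  by apply: le_trans (hn N) _; apply: le_trans (hN N (leqnn _)) _; lra.
apply: filterS (hk N) => n /= [Nk Pn]; apply: le_trans (Pn N Nk) _.
have := hN N (leqnn _); set x := _^-1; lra.
Qed.

Lemma represents_ex S : B S -> exists a, represents a S.
Proof.
move=> BS; have MS := Wstar_M hM MY BS.
pose S1 := S + adj S; pose S2 := 'i%C *: (S - adj S).
have BS' := Wstar_adj BS.
have BN T : B T -> B (- T) by move=> BT; rewrite -scaleN1r; exact: Wstar_scale.
have B1 : B S1 by exact: Wstar_add.
have B2 : B S2 by apply: Wstar_scale; apply: Wstar_add => //; exact: BN.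
have M1 := Wstar_M hM MY B1; have M2 := Wstar_M hM MY B2.
have s1 : sa_op S1.
  by apply: (sa_adj hM) => //; rewrite /S1 (adj_add hM)// ?(adjK hM)// 1?addrC//; inM.
have s2 : sa_op S2.
  apply: (sa_adj hM) => //; rewrite /S2 (adj_scale hM); last by inM.
  rewrite (adj_sub hM)// ?(adjK hM)//; last by inM.
  by rewrite -opprB scalerN -scaleNr; congr (_ *: _); rewrite conjE; apply/eqP;
    rewrite eq_complex /= oppr0 opprK !eqxx.
have [a1 h1] := represents_sa_ex B1 s1; have [a2 h2] := represents_sa_ex B2 s2.
exists (fun n => (2^-1 : C) *: a1 n + (- (2^-1 * 'i%C)) *: a2 n).
have -> : S = (2^-1 : C) *: S1 + (- (2^-1 * 'i%C)) *: S2.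
  apply/funext => v; apply: hdot_inj => w.
  rewrite -[RHS]/(hdot (2^-1 *: (S v + adj S v) +
    (- (2^-1 * 'i%C)) *: ('i%C *: (S v - adj S v))) w).
  rewrite !(hdotBl, hdotDl, hdotZl, hdotNl) mulrA mulNr -mulrA -expr2 sqr_i.
  by field.
by apply: represents_add; [inM|inM|exact: represents_scale|exact: represents_scale].
Qed.

Definition rep_iota (S : H -> H) : set (mxseq R) := [set a | represents a S].

Lemma rep_iota_coset S a : M S -> represents a S -> rep_iota S = ucoset U a.
Proof.
move=> MS ha; apply/seteqP; split=> b.
  by move=> hb; apply/(ucosetP hU); split; [case: hb|exact: (represents_uniq MS ha hb)].
by move=> /(ucosetP hU)[bb hb]; exact: represents_cong bb hb.
Qed.

Lemma rep_iota_embedding : embedding U tau B rep_iota.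
Proof.
have BM := Wstar_M hM MY; split.
- move=> S BS; have [a ha] := represents_ex BS; exists a; first by case: ha.
  by apply: rep_iota_coset ha; exact: BM.
- exact: represents_id.
- by move=> S T a b /BM MS /BM MT; exact: represents_add.
- by move=> c S a /BM MS; exact: represents_scale.
- by move=> S T a b /BM MS /BM MT; exact: represents_mul.
- by move=> S T a /BM MS _ ST; rewrite -(adj_eq ST); exact: represents_adj.
- by move=> S a /BM MS ha; apply/(ucvgP hU) => e e0; exact: (represents_trace MS ha).
Qed.

Lemma rep_iota_lift : is_lift U rep_iota Y Yn.
Proof.
move=> j; split=> //; first by exists (Kb j) => n.
exact: (rep_iota_coset (MY j) (represents_gen j)).
Qed.

End EmbeddingExists.

(** * Independence of the generators and lifts *)

Section LawNeighborhoods.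
Variables (R : realType) (I : choiceType).
Local Notation C := (R[i]).
Local Notation ncp := (ncpoly R I).
Implicit Types (l k : ncp -> C) (O : set (ncp -> C)).

Definition close_laws l (G : seq ncp) (e : R) : set (ncp -> C) :=
  [set k | is_law k /\ forall p, p \in G -> normc (k p - l p) < e].

Lemma ball_open (z : C^o) (e : R) : open [set u : C^o | normc (u - z) < e].
Proof.
rewrite openE => u /= ue; apply/nbhs_ballP.
exists (e - normc (u - z))%:C%C => /=; first by rewrite ltcR subr_gt0.
move=> v; rewrite /ball /= normcE' ltcR ltrBrDr => h.
apply: le_lt_trans h; rewrite -[v - z](subrKA u) addrC.
by apply: le_trans (le_normcD _ _) _; rewrite addrC (normcB v) lexx.
Qed.

Lemma close_laws_nbhd l G e : is_law l -> 0 < e -> law_nbhd l (close_laws l G e).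
Proof.
move=> ll e0; split; first by split=> // p _; rewrite subrr normc0.
exists [set k : {ptws ncp -> C^o} | forall p, p \in G -> normc (k p - l p) < e].
  elim: G => [|p G IH].
    rewrite (_ : [set _ | _] = setT); first exact: openT.
    by apply/seteqP; split.
  rewrite (_ : [set _ | _] = (proj p @^-1` [set u : C^o | normc (u - l p) < e]) `&`
     [set k | forall q, q \in G -> normc (k q - l q) < e]).
    apply: openI => //; apply: open_comp; last exact: ball_open.
    by move=> k _; exact: (@proj_continuous ncp (fun _ => C^o) p).
  apply/seteqP; split=> k /=.
    by move=> h; split=> [|q qG]; apply: h; rewrite inE ?eqxx// qG orbT.
  by move=> [h1 h2] q; rewrite inE => /predU1P[->|/h2].
by apply/seteqP; split=> k [].
Qed.

Lemma ptws_nbhs_close l (V : set {ptws ncp -> C^o}) : open V -> V l ->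
  exists (G : seq ncp) e, 0 < e /\
    forall k, (forall p, p \in G -> normc (k p - l p) < e) -> V k.
Proof.
move=> oV Vl.
pose D (Ge : seq ncp * R) := 0 < Ge.2.
pose S (Ge : seq ncp * R) := [set k : ncp -> C |
  forall p, p \in Ge.1 -> normc (k p - l p) < Ge.2].
have FF : Filter (filter_from D S).
  apply: filter_from_filter; first by exists ([::], 1); rewrite /D /=.
  move=> [G1 e1] [G2 e2] h1 h2; exists (G1 ++ G2, Num.min e1 e2).
  by rewrite /D /= lt_min; apply/andP; split; [exact: h1|exact: h2].
  move=> k h; split=> p pG; have := h p; rewrite /= mem_cat pG ?orbT lt_min.
    by move=> /(_ isT) /andP[].
  by move=> /(_ isT) /andP[].
suff /(_ V) : filter_from D S --> (l : {ptws ncp -> C^o}).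
  by move=> /(_ (open_nbhs_nbhs (conj oV Vl)))[[G e] e0 h]; exists G, e.
apply/cvg_sup => p A; rewrite nbhsE /= => -[_ [[B oB <-] Bl] BA].
have /nbhs_ballP[e e0 he] := open_nbhs_nbhs (conj oB Bl).
have [e1 [E e10]] : exists e1 : R, e = e1%:C%C /\ 0 < e1.
  exists (Re e); move: e0; case: (e) => a b; rewrite /= ltcE /= => /andP[/eqP ->].
  by split.
exists ([:: p], e1) => // k /= /(_ p); rewrite inE eqxx => /(_ isT) h.
by apply: BA => /=; apply: he; rewrite /ball /= E normcE' ltcR normcB.
Qed.

Lemma lawD l p q : is_law l -> l (p + q) = l p + l q.
Proof. by move=> ll; have := law_linear ll 1 p q; rewrite mul1r (scale1r p). Qed.

Lemma law0 l : is_law l -> l 0 = 0.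
Proof.
by move=> ll; have /eqP := lawD 0 0 ll; rewrite addr0 -subr_eq subrr => /eqP.
Qed.

Lemma lawZ l c p : is_law l -> l (c *: p) = c * l p.
Proof.
move=> ll; have h := law_linear ll c p 0.
transitivity (l (c *: p + 0)); first by congr (l _); rewrite addr0.
by apply: etrans h _; rewrite (law0 ll); exact: addr0.
Qed.

(** Finitely many polynomials involve finitely many words, and b is small against all their
    coefficient sums. Words in countably many letters are countable, which later gives a countable
    basis. *)
Lemma law_nbhd_words l O : law_nbhd l O -> exists (ws : seq (seq I)) (e : R), 0 < e /\
  close_laws l [seq mon 1 w | w <- ws] e `<=` O.
Proof.
move=> [Ol [V oV EO]]; have ll : is_law l by move: Ol; rewrite EO => -[].
have Vl : V l by move: Ol; rewrite EO => -[].
have [G [e [e0 hG]]] := ptws_nbhs_close oV Vl.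
pose wds (p : ncp) : seq (seq I) := [seq (u : seq I) | u : {fmonom I} <- msupp p].
have [b b0 hb] : exists2 b : R, 0 < b & forall p, p \in G ->
    \sum_(u <- msupp p) normc p@_u * b < e.
  elim: (G) => [|p G' [b b0 IH]]; first by exists 1.
  pose s := 1 + \sum_(u <- msupp p) normc p@_u.
  have s0 : 0 < s by rewrite ltr_pwDl// sumr_ge0// => u _; exact: normc_ge0.
  exists (Num.min b (e / s)); first by rewrite lt_min b0 divr_gt0.
  move=> q; rewrite inE => /predU1P[->|qG].
    rewrite -mulr_suml; apply: (@le_lt_trans _ _ ((\sum_(u <- msupp p) normc p@_u) * (e / s))).
      by rewrite ler_wpM2l ?sumr_ge0// => [u _|]; [exact: normc_ge0|rewrite ge_min lexx orbT].
    by rewrite mulrCA -[ltRHS]mulr1 ltr_pM2l// ltr_pdivrMr// mul1r ltrDr.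
  apply: le_lt_trans (IH _ qG); apply: ler_sum => u _.
  by rewrite ler_wpM2l ?normc_ge0// ge_min lexx.
exists (flatten [seq wds p | p <- G]), b; split=> // k [lk hk].
rewrite EO; split=> //; apply: hG => p pG.
have lin_sum (f : ncp -> C) : is_law f -> f p = \sum_(u <- msupp p) p@_u * f (mon 1 u).
  move=> lf; rewrite [X in f X](monalgE p) (big_morph f (fun x y => lawD x y lf) (law0 lf)).
  by apply: eq_bigr => u _; rewrite -(lawZ _ _ lf) monZ mulr1 monE fmK.
rewrite !lin_sum// -sumrB; apply: le_lt_trans (normc_sum _ _) _.
apply: le_lt_trans (hb _ pG); rewrite !big_seq; apply: ler_sum => u up.
rewrite -mulrBr normcM ler_wpM2l ?normc_ge0// ltW// hk//.
apply: map_f; apply/flattenP; exists (wds p); first exact: map_f.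
exact: map_f.
Qed.

End LawNeighborhoods.

Lemma mxseq_ext (R : realType) (a b : mxseq R) : (forall n, a n = b n) -> a = b.
Proof. exact: functional_extensionality_dep. Qed.

Section Snd.
Variables (R : realType) (I J : choiceType).

Definition ncsnd (p : ncpoly R J) : ncpoly R (I + J)%type :=
  msum (fun c w => mon c (map inr w)) p.

Lemma law_sndE (l : ncpoly R (I + J)%type -> R[i]) p : law_snd l p = l (ncsnd p).
Proof.
by congr (l _); apply: eq_bigr => w _; rewrite monE.
Qed.

Lemma ncsnd_mon c w : ncsnd (mon c w) = mon c (map inr w).
Proof. by rewrite /ncsnd msum_mon// => a b u; rewrite monD. Qed.

Lemma ev_ncsnd (V : lmodType R[i]) (a : I + J -> V -> V) p v :
  ev a (ncsnd p) v = ev (fun j => a (inr j)) p v.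
Proof.
elim/ncpoly_ind: p => [|p q IHp IHq|c w].
- by rewrite /ncsnd msum0 !ev0.
- rewrite (_ : ncsnd (p + q) = ncsnd p + ncsnd q) ?(evD _ p) ?(evD _ (ncsnd p)) ?IHp ?IHq//.
  by rewrite /ncsnd msumD// => b c w; rewrite monD.
by rewrite ncsnd_mon !ev_mon; congr (_ *: _); elim: w => //= j w ->.
Qed.

End Snd.
Arguments ncsnd : clear implicits.

(** * Microstate spaces for two generating tuples and two lifts *)

Section LiftIndependence.
Variables (R : realType) (H : hilbert R) (M : set (H -> H)).
Variables (tau : (H -> H) -> R[i]).
Hypothesis hM : tracial_vna M tau.
Variables (m : nat) (X : 'I_m -> H -> H).
Hypothesis hX : forall j, M (X j) /\ sa_op (X j).
Variable U : set_system nat.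
Hypothesis hU : nonprincipal_ultrafilter U.
Variables (B : set (H -> H)) (iota : (H -> H) -> set (mxseq R)).
Hypothesis hiota : embedding U tau B iota.
Local Notation C := (R[i]).
Local Notation n2 := (n2 tau).
#[local] Instance ultra_instance1 : ProperFilter U := ultra_pf hU.

(** An embedding preserves the trace of adj S S, from which the 2-norm is read off. *)
Lemma emb_hsn S a e : (forall T, B T -> M T) -> (forall T, B T -> B (adj T)) ->
  (forall S T, B S -> B T -> B (S \o T)) -> B S -> iota S a -> 0 < e ->
  U [set n | hsn (a n) <= n2 S + e].
Proof.
move=> BM Badj Bcomp BS ia e0; have MS := BM _ BS.
have ia' : iota (adj S \o S) (fun n => adjmx (a n) *m a n).
  apply: (emb_mul hiota) => //; first exact: Badj.
  by apply: (emb_adjoint hiota BS) => //; [exact: Badj|exact: (adjP hM)].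
have /(ucvgP hU) h := emb_trace hiota (Bcomp _ _ (Badj _ BS) BS) ia'.
apply: filterS (h _ (exprn_gt0 2 e0)) => n /= {}h.
rewrite -(@ler_pXn2r _ 2) ?nnegrE ?addr_ge0 ?hsn_ge0 ?n2_ge0 ?(ltW e0)//.
rewrite hsnE (sqr_snorm (mdot_sdot R n))// /mdot sqrrD (sqr_n2 hM)//.
have := le_trans (Re_le_normc _) h; rewrite ReB.
have : 0 <= n2 S * e by rewrite mulr_ge0 ?n2_ge0 ?(ltW e0).
by rewrite -mulr_natl; lra.
Qed.

Variables (W W' : nat -> H -> H).
Hypotheses (sW : forall j, sa_op (W j)) (sW' : forall j, sa_op (W' j)).
Hypotheses (BW : Wstar W = B) (BW' : Wstar W' = B) (BM : forall T, B T -> M T).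
Variables Wn Wn' : forall n, nat -> 'M[C]_n.
Hypotheses (lW : is_lift U iota W Wn) (lW' : is_lift U iota W' Wn').

Let BWj j : B (W j). Proof. by rewrite -BW; exact: Wstar_gen. Qed.
Let BWj' j : B (W' j). Proof. by rewrite -BW'; exact: Wstar_gen. Qed.
Let MW j : M (W j). Proof. exact/BM/BWj. Qed.

Lemma lift_in j (V : nat -> H -> H) Vn : is_lift U iota V Vn ->
  iota (V j) (fun n => Vn n j).
Proof. by move=> /(_ j)[_ bd ->]; exact: ucoset_refl. Qed.

Lemma B_scale c T : B T -> B (c *: T).
Proof. by rewrite -BW; exact: Wstar_scale. Qed.

Lemma B_add S T : B S -> B T -> B (S + T).
Proof. by rewrite -BW; exact: Wstar_add. Qed.

Lemma B_comp S T : B S -> B T -> B (S \o T).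
Proof. by rewrite -BW; exact: Wstar_comp. Qed.

Lemma B_adj T : B T -> B (adj T).
Proof. by rewrite -BW; exact: Wstar_adj. Qed.

Lemma B_id : B id.
Proof. by rewrite -BW; exact: Wstar_id. Qed.

Lemma emb_ev p : B (ev W p) /\ iota (ev W p) (fun n => mev (Wn n) p).
Proof.
elim/ncpoly_ind: p => [|p q [Bp ip] [Bq iq]|c w].
- have -> : ev W 0 = (0 : C) *: (id : H -> H).
    by apply/funext => v; rewrite ev0 -[RHS]/(0 *: v) scale0r.
  split; first exact/B_scale/B_id.
  rewrite (_ : (fun n => _) = fun n => 0 *: 1%:M); last first.
    by apply: mxseq_ext => n; rewrite /mev ev0 scale0r.
  exact: (emb_scale hiota _ B_id (emb_id hiota)).
- have -> : ev W (p + q) = ev W p \+ ev W q by apply/funext => v; rewrite evD.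
  split; first exact: B_add.
  rewrite (_ : (fun n => _) = fun n => mev (Wn n) p + mev (Wn n) q); last first.
    by apply: mxseq_ext => n; rewrite mevD.
  exact: (emb_add hiota).
have -> : ev W (mon c w) = c *: wev W w by apply/funext => v; rewrite ev_mon.
rewrite (_ : (fun n => _) = fun n => c *: wev (fun i A => Wn n i *m A) w 1%:M); last first.
  by apply: mxseq_ext => n; rewrite /mev ev_mon.
suff [Bw iw] : B (wev W w) /\ iota (wev W w) (fun n => wev (fun i A => Wn n i *m A) w 1%:M).
  by split; [exact: B_scale|exact: (emb_scale hiota)].
elim: w => [|j w [Bw iw]]; first by split; [exact: B_id|exact: (emb_id hiota)].
split; first exact: (B_comp (BWj j) Bw).
exact: (emb_mul hiota (BWj j) Bw (lift_in j lW) iw).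
Qed.

Lemma letter_approx j e : 0 < e -> exists2 p, n2 (W' j - ev W p) <= e &
  U [set n | hsn (Wn' n j - mev (Wn n) p) <= e].
Proof.
move=> e0; have e20 : 0 < e / 2 by rewrite divr_gt0.
have BWj'' : Wstar W (W' j) by rewrite BW.
have [p hp] := Wstar_dense hM MW sW BWj'' e20.
exists p; first by apply: le_trans hp _; rewrite ler_pdivrMr// ler_peMr ?ler1n// ltW.
have [Bp ip] := emb_ev p.
have Bd : B (W' j \+ (-1) \*: ev W p) by apply: B_add => //; exact: B_scale.
have id_ : iota (W' j \+ (-1) \*: ev W p) (fun n => Wn' n j + -1 *: mev (Wn n) p).
  apply: (emb_add hiota) => //; [exact: B_scale|exact: lift_in|exact: (emb_scale hiota)].
have Ed : W' j \+ (-1) \*: ev W p = W' j - ev W p.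
  by apply/funext => v; rewrite /= scaleN1r.
have := emb_hsn BM B_adj B_comp Bd id_ e20; apply: filterS => n /=.
by rewrite scaleN1r Ed => /le_trans; apply; rewrite [leRHS]splitr lerD2r.
Qed.

Let MXY (V : nat -> H -> H) : (forall j, M (V j)) -> forall k, M (join X V k).
Proof. by move=> MV [i|j] //=; case: (hX i). Qed.

Let MW' j : M (W' j). Proof. exact/BM/BWj'. Qed.

(* The tail of the word is replaced first, so that the norm of its polynomial
   is known when the first letter is approximated in 2-norm. *)
Lemma word_approx (q : 'I_m -> R) w e : (forall j, 0 < q j) -> 0 < e ->
  exists2 p : ncpoly R ('I_m + nat)%type,
    n2 (ev (join X W) p - wev (join X W') w) <= e &
    U [set n | forall A : 'I_m -> 'M[C]_n, (forall j, mx_opnorm_le (A j) (q j)) ->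
      hsn (mev (join A (Wn n)) p -
           wev (fun k D => join A (Wn' n) k *m D) w 1%:M) <= e].
Proof.
move=> q0; elim: w e => [|k w IH] e e0.
  exists 1.
    rewrite (_ : ev _ 1 = id); last by apply/funext => v; rewrite ev1.
    by rewrite subrr /n2 (snorm0 (tdot_sdot hM)) ltW.
  by apply: filterE => n A _ /=; rewrite mev1 subrr hsn0 ltW.
have Mw : M (wev (join X W') w).
  have := M_ev hM (MXY MW') (mon 1 w); congr M; apply/funext => v.
  by rewrite ev_mon scale1r.
case: k => [i|j].
  have [s s0 hs] := M_bnd hM (hX i).1.
  have c0 : 0 < s + q i by rewrite addr_gt0.
  have [p hp hpU] := IH _ (divr_gt0 e0 c0).
  have le1 x y : 0 <= y -> y <= s + q i -> x <= e / (s + q i) -> y * x <= e.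
    move=> y0 yk hx; apply: le_trans (_ : y * (e / (s + q i)) <= _).
      by rewrite ler_wpM2l.
    by rewrite mulrCA -[leRHS]mulr1 ler_pM2l// ler_pdivrMr// mul1r.
  exists (mon 1 [:: inl i] * p).
    have -> : ev (join X W) (mon 1 [:: inl i] * p) - wev (join X W') (inl i :: w) =
        X i \o (ev (join X W) p - wev (join X W') w).
      apply/funext => v.
      rewrite -[RHS]/(X i (ev _ p v - wev _ w v)) (lin_subE (M_lin hM (hX i).1)).
      rewrite -[LHS]/(ev _ (_ * _) v - _) (evM (fun k => M_lin hM (MXY MW k))).
      by rewrite ev_mon scale1r.
    have Md : M (ev (join X W) p - wev (join X W') w).
      by have Mp := M_ev hM (MXY MW) p; inM.
    apply: le_trans (n2_mull hM (hX i).1 Md hs) _.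
    by apply: le1 hp; rewrite ?(ltW s0)// lerDl ltW.
  apply: filterS hpU => n /= h A Aq.
  rewrite mevM /= -[mev _ (mon 1 _)]/(ev _ _ _) ev_mon scale1r /= mulmx1 -mulmxBr.
  apply: le_trans (hsn_mull _ (Aq i)) _.
  by apply: le1 (h A Aq); rewrite ?(ltW (q0 i))// lerDr ltW.
have [s s0 hs] := M_bnd hM (MW' j).
have [s' hs'] : bounded_mxseq (fun n => Wn' n j) by have [] := lW' j.
have s'0 : 0 <= s' by case: (hs' 0%N).
have c0 : 0 < s + s' by rewrite ltr_pwDl.
have e20 : 0 < e / 2 by rewrite divr_gt0.
have [p hp hpU] := IH _ (divr_gt0 e20 c0).
have /choice[kx hkx] i : exists r, 0 <= r /\ opnorm_le (X i) r.
  by have [r r0 hr] := M_bnd hM (hX i).1; exists r; rewrite ltW.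
have /choice[kw hkw] i : exists r, [/\ 0 <= r, opnorm_le (W i) r &
    forall n, mx_opnorm_le (Wn n i) r].
  have [r r0 hr] := M_bnd hM (MW i).
  have [r1 hr1] : bounded_mxseq (fun n => Wn n i) by have [] := lW i.
  have r10 : 0 <= r1 by case: (hr1 0%N).
  exists (r + r1); split; first by rewrite addr_ge0// ltW.
    by apply: opnorm_le_trans hr; rewrite lerDl.
  by move=> n; apply: mx_opnorm_trans (hr1 n); rewrite lerDr ltW.
pose K := join (fun i => kx i + q i) kw.
have K0 k : 0 <= K k.
  case: k => [i|i] /=; last by case: (hkw i).
  by case: (hkx i) => h _; rewrite addr_ge0// ltW.
pose Kp := pbound K p + 1.
have Kp0 : 0 < Kp by rewrite ltr_wpDl// pbound_ge0.
have [f hf hfU] := letter_approx j (divr_gt0 e20 Kp0).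
have le1 x y : 0 <= y -> y <= s + s' -> x <= e / 2 / (s + s') -> y * x <= e / 2.
  move=> y0 yk hx; apply: le_trans (_ : y * (e / 2 / (s + s')) <= _).
    by rewrite ler_wpM2l.
  by rewrite mulrCA -[leRHS]mulr1 ler_pM2l// ler_pdivrMr// mul1r.
have le2 x : x <= e / 2 / Kp -> Kp * x <= e / 2.
  by move=> hx; rewrite mulrC -ler_pdivlMr.
exists (ncsnd R 'I_m nat f * p).
  have -> : ev (join X W) (ncsnd R 'I_m nat f * p) - wev (join X W') (inr j :: w) =
      (W' j \o (ev (join X W) p - wev (join X W') w)) -
      ((W' j - ev W f) \o ev (join X W) p).
    apply/funext => v; have lX := fun k => M_lin hM (MXY MW k).
    rewrite -[RHS]/(W' j (ev _ p v - wev _ w v) - (W' j (ev _ p v) - ev W f (ev _ p v))).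
    rewrite (lin_subE (M_lin hM (MW' j))).
    rewrite -[LHS]/(ev _ (_ * _) v - W' j (wev _ w v)) (evM lX) ev_ncsnd /=.
    by rewrite opprB [RHS]addrC subrKA.
  have Mp := M_ev hM (MXY MW) p; have Mf := M_ev hM MW f.
  have Md : M (ev (join X W) p - wev (join X W') w) by inM.
  have Mjf : M (W' j - ev W f) by have := MW' j => Mj; inM.
  have M1 : M (W' j \o (ev (join X W) p - wev (join X W') w)) by have := MW' j => Mj; inM.
  have M2 : M ((W' j - ev W f) \o ev (join X W) p) by inM.
  apply: le_trans (n2_sub_le hM M1 M2) _.
  rewrite [leRHS]splitr lerD//.
    apply: le_trans (n2_mull hM (MW' j) Md hs) _.
    by apply: le1 hp; rewrite ?(ltW s0)// lerDl.
  have pK : opnorm_le (ev (join X W) p) Kp.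
    apply/opnormP; split; first exact: ltW.
    move=> v; apply: le_trans (ev_bound (hdot_sdot H) K0 _ p v) _.
      move=> [i|i] u /=.
        have [_ /opnormP[_ h]] := hkx i; apply: le_trans (h u) _.
        by rewrite ler_wpM2r ?hnorm_ge0// lerDl ltW.
      by have [_ /opnormP[_ h] _] := hkw i; exact: h.
    by rewrite ler_wpM2r ?hnorm_ge0// lerDl.
  by apply: le_trans (n2_mulr hM Mp Mjf pK) _; exact: le2.
apply: filterS2 hpU hfU => n /= h1 h2 A Aq.
have EM : mev (join A (Wn n)) (ncsnd R 'I_m nat f) = mev (Wn n) f by rewrite /mev ev_ncsnd.
set D := wev _ w _.
have -> : mev (join A (Wn n)) (ncsnd R 'I_m nat f * p) - Wn' n j *m D =
    Wn' n j *m (mev (join A (Wn n)) p - D) -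
    (Wn' n j - mev (Wn n) f) *m mev (join A (Wn n)) p.
  by rewrite mevM EM mulmxBr mulmxBl opprB [RHS]addrC subrKA.
apply: le_trans (hsnD _ _) _; rewrite hsnN [leRHS]splitr lerD//.
  apply: le_trans (hsn_mull _ (hs' n)) _.
  by apply: le1 (h1 A Aq); rewrite // lerDr ltW.
have pKn : mx_opnorm_le (mev (join A (Wn n)) p) Kp.
  apply: mx_opnorm_trans (mev_bound p (_ : forall k, mx_opnorm_le _ (K k))).
    by rewrite lerDl.
  move=> [i|i] /=; last by case: (hkw i).
  by apply: mx_opnorm_trans (Aq i); rewrite lerDr; case: (hkx i).
by apply: le_trans (hsn_mulr _ pKn) _; exact: le2.
Qed.

(** Every word in X and W' is imitated by a polynomial in X and W, for the operators and, along U,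
    for all A within the cutoff. Closeness of laws on these polynomials then suffices, with three
    errors of size e/4. *)
Lemma microstates_lift_sub (q : 'I_m -> R) O' : (forall j, 0 < q j) ->
  law_nbhd (op_law tau (join X W')) O' ->
  exists2 O, law_nbhd (op_law tau (join X W)) O &
    U [set n | microstates q (Wn n) O `<=` microstates q (Wn' n) O'].
Proof.
move=> q0 /law_nbhd_words[ws [e [e0 hws]]].
have e40 : 0 < e / 4 by rewrite divr_gt0.
pose P w (p : ncpoly R ('I_m + nat)%type) := n2 (ev (join X W) p - wev (join X W') w) <= e / 4
  /\ U [set n | forall A : 'I_m -> 'M[C]_n, (forall j, mx_opnorm_le (A j) (q j)) ->
      hsn (mev (join A (Wn n)) p -
           wev (fun k D => join A (Wn' n) k *m D) w 1%:M) <= e / 4].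
have /choice[pw hpw] w : exists p, P w p.
  by have [p h1 h2] := word_approx w q0 e40; exists p.
have saX (V : nat -> H -> H) : (forall j, sa_op (V j)) -> forall k, sa_op (join X V k).
  by move=> sV [i|j] //=; case: (hX i).
have [K K0 hK] : exists2 K, (forall k, 0 < K k) & forall k, opnorm_le (join X W k) (K k).
  have /choice[K hK] k : exists r, 0 < r /\ opnorm_le (join X W k) r.
    by have [r r0 hr] := M_bnd hM (MXY MW k); exists r.
  by exists K => k; case: (hK k).
have ll := op_law_is_law hM (MXY MW) (saX W sW) K0 hK.
exists (close_laws (op_law tau (join X W)) [seq pw w | w <- ws] (e / 4)).
  exact: close_laws_nbhd.
have hU' : U [set n | forall w, w \in ws -> forall A : 'I_m -> 'M[C]_n,
    (forall j, mx_opnorm_le (A j) (q j)) ->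
      hsn (mev (join A (Wn n)) (pw w) -
           wev (fun k D => join A (Wn' n) k *m D) w 1%:M) <= e / 4].
  elim: (ws) => [|w s IH]; first exact: filterE.
  apply: filterS2 IH (hpw w).2 => n /= h1 h2 u; rewrite inE => /predU1P[->//|].
  exact: h1.
apply: filterS2 hU' (ultra_ge hU 1) => n /= h n0 A [saA Aq [_ hA]].
split=> //; apply: hws; split.
  have /choice[kw hkw] i : exists r, 0 < r /\ mx_opnorm_le (Wn' n i) r.
    have [r1 hr1] : bounded_mxseq (fun n => Wn' n i) by have [] := lW' i.
    have r10 : 0 <= r1 by case: (hr1 0%N).
    exists (r1 + 1); split; first by rewrite ltr_wpDl.
    by apply: mx_opnorm_trans (hr1 n); rewrite lerDl.
  apply: (@mx_law_is_law _ _ _ _ (join q kw)) => //.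
  - by move=> [i|i] //=; have [] := lW' i.
  - by move=> [i|i] //=; have [] := hkw i.
  - by move=> [i|i] //=; have [] := hkw i.
move=> _ /mapP[w win ->].
have {h} := h w win A Aq => h1.
have /hA h2 : pw w \in [seq pw w | w <- ws] by exact: map_f.
have [h3 _] := hpw w.
rewrite !mx_lawE !op_lawE in h2 *.
rewrite [mev _ (mon 1 w)]/mev ev_mon scale1r.
rewrite (_ : ev (join X W') (mon 1 w) = wev (join X W') w); last first.
  by apply/funext => v; rewrite ev_mon scale1r.
have Mw : M (wev (join X W') w).
  have := M_ev hM (MXY MW') (mon 1 w); congr M; apply/funext => v.
  by rewrite ev_mon scale1r.
have Mp := M_ev hM (MXY MW) (pw w).
set D := wev _ w 1%:M in h1 *; set D' := mev _ _ in h1 h2.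
have -> : ntr D - tau (wev (join X W') w) = - ntr (D' - D) +
    (ntr D' - tau (ev (join X W) (pw w))) +
    tau (ev (join X W) (pw w) - wev (join X W') w).
  have -> : ntr (D' - D) = ntr D' - ntr D.
    by rewrite ntrD -scaleN1r ntrZ mulN1r.
  by rewrite (tau_sub hM Mp Mw); ring.
apply: le_lt_trans (le_normcD _ _) _.
apply: le_lt_trans (lerD (le_normcD _ _) (normc_tau_le hM _)) _; first by inM.
rewrite normcN; have := le_trans (normc_ntr_le _) h1; lra.
Qed.

End LiftIndependence.

(** * Lebesgue measure on tuples *)

Section IntegralMono.
Variables (R : realType).
Local Notation mu := (@lebesgue_measure R).

(** The integral of a nonnegative function is a supremum over simple functions below it, so it is
    monotone on arbitrary functions. Hence [lebesgue_tuple] may be compared on sets not known to be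
    measurable, such as microstate spaces. *)
Lemma ge0_integral_mono (f g : R -> \bar R) : (forall x, 0 <= f x)%E ->
  (forall x, f x <= g x)%E -> (\int[mu]_x f x <= \int[mu]_x g x)%E.
Proof.
move=> f0 fg; have g0 x : (0 <= g x)%E by exact: le_trans (f0 x) (fg x).
rewrite !ge0_integralTE//; apply: ereal_sup_le => _ [h hf <-].
by exists h => // x; exact: le_trans (hf x) (fg x).
Qed.

Lemma lebesgue_tuple_ge0 k (S : set (k.-tuple R)) : (0 <= lebesgue_tuple S)%E.
Proof.
elim: k S => [|k IH] S /=; first by rewrite diracE.
by apply: integral_ge0 => x _; exact: IH.
Qed.

Lemma le_lebesgue_tuple k (S T : set (k.-tuple R)) : S `<=` T ->
  (lebesgue_tuple S <= lebesgue_tuple T)%E.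
Proof.
elim: k S T => [|k IH] S T ST /=.
  rewrite !diracE lee_fin ler_nat; case: (boolP (_ \in S)) => // /set_mem h.
  by rewrite mem_set//; exact: ST.
apply: ge0_integral_mono => x; first exact: lebesgue_tuple_ge0.
by apply: IH => v /=; exact: ST.
Qed.

End IntegralMono.

Section SigmaFinitePack.
Context d (T : measurableType d) (R : realType).
Variable m : {measure set T -> \bar R}.
Hypothesis sm : sigma_finite setT m.

Definition sfm_fun : set T -> \bar R := m.
HB.instance Definition _ := Measure.on sfm_fun.
HB.instance Definition _ := Measure_isSigmaFinite.Build d T R sfm_fun sm.

(** Turns the property of sigma-finiteness into the bundled structure from which product measures
    are formed. *)
Lemma sigma_finite_pack : exists m' : {sigma_finite_measure set T -> \bar R},
  m' = m :> (set T -> \bar R).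
Proof. by exists sfm_fun. Qed.

End SigmaFinitePack.

Section LebesgueTuple.
Variables (R : realType).
Local Notation T := (measurableTypeR R).
Local Notation mu := (@lebesgue_measure R).

Definition cons_pair k (p : T * k.-tuple T) : k.+1.-tuple T := cons_tuple p.1 p.2.

Definition uncons k (t : k.+1.-tuple T) : T * k.-tuple T := (thead t, [tuple of behead t]).

Lemma cons_pairK k : cancel (@cons_pair k) (@uncons k).
Proof.
move=> [x v]; rewrite /uncons /cons_pair /=; congr (_, _).
by apply: val_inj.
Qed.

Lemma measurable_cons_pair k : measurable_fun setT (@cons_pair k).
Proof. exact: (measurable_cons measurable_fst measurable_snd). Qed.

Lemma measurable_uncons k : measurable_fun setT (@uncons k).
Proof.
apply: measurable_fun_pair; last exact: measurable_behead.
exact: measurable_tnth.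
Qed.

Lemma measurable_slice k (S : set (k.+1.-tuple T)) x : measurable S ->
  measurable [set v | S (cons_tuple x v)].
Proof.
move=> mS; have mS' : measurable (@cons_pair k @^-1` S).
  by rewrite -[X in measurable X]setTI; exact: measurable_cons_pair.
by have := measurable_xsection x mS'; rewrite xsectionE.
Qed.

(** Inductively, the slice integral is the product of Lebesgue measure with the measure one
    dimension lower, pushed forward along [cons_pair]. *)
Lemma lebesgue_tuple_measure k :
  exists2 m : {measure set (k.-tuple T) -> \bar R}, sigma_finite setT m &
    forall S, measurable S -> m S = lebesgue_tuple S.
Proof.
elim: k => [|k [m sm mE]].
  exists (\d_[tuple])%R => //.
  exists (fun _ => setT); first by rewrite bigcup_const.
  by move=> _; split; [exact: measurableT|exact: ltry].
have [m' mm'] := sigma_finite_pack sm; rewrite -mm' in mE.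
pose pm0 := (pushforward (mu \x m')%E (@cons_pair k) : {measure set (k.+1.-tuple T) -> \bar R}).
have mc := measurable_cons_pair (k := k).
exists (pm0 mc).
  have /sigma_finiteP[F [FT ndF Foo]] := sigma_finiteT mu.
  have /sigma_finiteP[G [GT ndG Goo]] := sigma_finiteT m'.
  exists (fun n => @uncons k @^-1` (F n `*` G n)).
    apply/esym/seteqP; split=> // t _.
    have [n1 _ h1] : (\bigcup_n F n) (@uncons k t).1 by rewrite -FT.
    have [n2 _ h2] : (\bigcup_n G n) (@uncons k t).2 by rewrite -GT.
    exists (maxn n1 n2) => //=; split => /=.
      by apply: (subsetPset _ _ (ndF n1 _ _)) h1; exact: leq_maxl.
    by apply: (subsetPset _ _ (ndG n2 _ _)) h2; exact: leq_maxr.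
  move=> n; have [mF Fn] := Foo n; have [mG Gn] := Goo n; split.
    by rewrite -[X in measurable X]setTI; apply: measurable_uncons => //; exact: measurableX.
  rewrite /pm0 /= /pushforward -comp_preimage (_ : _ \o _ = id) ?preimage_id//; last first.
    by apply/funext => p; exact: cons_pairK.
  by rewrite product_measure1E// lte_mul_pinfty// ge0_fin_numE.
move=> S mS; rewrite /pm0 /= /pushforward /product_measure1 /=.
apply: eq_integral => x _ /=; rewrite xsectionE.
exact: (mE _ (measurable_slice x mS)).
Qed.

Lemma measurable_fun_slice k (S : set (k.+1.-tuple T)) : measurable S ->
  measurable_fun setT (fun x : T => lebesgue_tuple [set v | S (cons_tuple x v)]).
Proof.
move=> mS; have [m sm mE] := lebesgue_tuple_measure k.
have [m' mm'] := sigma_finite_pack sm; rewrite -mm' in mE.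
have mS' : measurable (@cons_pair k @^-1` S).
  by rewrite -[X in measurable X]setTI; exact: measurable_cons_pair.
have := measurable_fun_xsection m' mS'.
rewrite (_ : _ \o _ = fun x : T => lebesgue_tuple [set v | S (cons_tuple x v)])//.
by apply/funext => x /=; rewrite xsectionE; exact: (mE _ (measurable_slice x mS)).
Qed.

(** By uniqueness of Lebesgue measure it is enough to check half-open intervals. *)
Lemma lebesgue_affine (s c : R) (A : set T) : 0 < s -> measurable A ->
  (s%:E * mu ((fun x => s * x + c)%R @^-1` A) = mu A)%E.
Proof.
move=> s0 mA; pose phi : T -> T := fun x => s * x + c.
have mphi : measurable_fun setT phi.
  by apply: measurable_funD => //; exact: measurable_funM.
have s0' : 0 <= s by exact: ltW.
pose pm0 := (mscale (NngNum s0') (pushforward mu phi) : {measure set T -> \bar R}).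
pose pm := pm0 mphi.
have -> // := @lebesgue_measure_unique R pm _ A mA.
move=> _ [[a b] _ <-] /=; rewrite /pm /pm0 /mscale /= /pushforward.
have -> : phi @^-1` `]a, b]%classic = `](a - c) / s, (b - c) / s]%classic.
  apply/seteqP; split=> x /=; rewrite !in_itv /= /phi ltr_pdivrMr// ler_pdivlMr//;
  by rewrite (mulrC x) ltrBlDr lerBrDr.
rewrite !lebesgue_measure_itv /= !lte_fin ltr_pM2r ?invr_gt0// ltrD2r.
case: ifP => _; last by rewrite mule0.
rewrite -!EFinB -EFinM; congr (_%:E).
by rewrite -mulrBl mulrCA divff ?mulr1 ?gt_eqF//; ring.
Qed.

Lemma integral_affine (s c : R) (f : T -> \bar R) : 0 < s ->
  measurable_fun setT f -> (forall x, 0 <= f x)%E ->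
  (s%:E * \int[mu]_x f (s * x + c)%R = \int[mu]_x f x)%E.
Proof.
move=> s0 mf f0; pose phi : T -> T := fun x => s * x + c.
have mphi : measurable_fun setT phi.
  by apply: measurable_funD => //; exact: measurable_funM.
have s0' : 0 <= s by exact: ltW.
pose pm0 := (mscale (NngNum s0') (pushforward mu phi) : {measure set T -> \bar R}).
pose pm := pm0 mphi.
transitivity (\int[pm]_x f x)%E.
  rewrite (ge0_integral_mscale _ _ (NngNum s0'))//; congr (_ * _)%E.
  by rewrite ge0_integral_pushforward.
apply: eq_measure_integral => A mA _; exact: (lebesgue_affine c s0).
Qed.

Definition affine_tuple k (s : R) (c t : k.-tuple T) : k.-tuple T :=
  [tuple s * tnth t i + tnth c i | i < k].

Lemma measurable_affine k s (c : k.-tuple T) : measurable_fun setT (affine_tuple s c).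
Proof.
apply/measurable_fun_tnthP => i.
rewrite (_ : _ \o _ = fun t => s * tnth t i + tnth c i); last first.
  by apply/funext => t /=; rewrite tnth_mktuple.
apply: measurable_funD => //; apply: measurable_funM => //.
exact: measurable_tnth.
Qed.

Lemma lebesgue_tuple_affine k s (c : k.-tuple T) S : 0 < s -> measurable S ->
  ((s ^+ k)%:E * lebesgue_tuple (affine_tuple s c @^-1` S) = lebesgue_tuple S)%E.
Proof.
move=> s0; elim: k c S => [|k IH] c S mS.
  by rewrite mul1e; congr lebesgue_tuple; apply/seteqP; split=> t /=; rewrite [affine_tuple _ _ _]tuple0 [t]tuple0.
pose g (x : T) := lebesgue_tuple [set v | S (cons_tuple x v)].
have g0 x : (0 <= g x)%E by exact: lebesgue_tuple_ge0.
have mg : measurable_fun setT g by exact: measurable_fun_slice.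
rewrite -[RHS](@integral_affine s (thead c) g)// exprS EFinM -muleA; congr (_ * _)%E.
have aff x v : affine_tuple s c (cons_tuple x v) =
    cons_tuple (s * x + thead c) (affine_tuple s [tuple of behead c] v).
  apply: eq_from_tnth => i; rewrite tnth_mktuple; case: (unliftP ord0 i) => [j|] ->.
    rewrite !tnthS tnth_mktuple tnth_behead; congr (_ + tnth c _).
    by apply: val_inj; rewrite /= inordK// ltnS ltn_ord.
  by rewrite !tnth0.
rewrite /= -ge0_integralZl//.
- apply: eq_integral => x _; rewrite /g -(IH [tuple of behead c] _ (measurable_slice _ mS)).
  by congr (_ * lebesgue_tuple _)%E; apply/seteqP; split=> v /=; rewrite aff.
- apply: (measurable_fun_slice (S := affine_tuple s c @^-1` S)).
  by rewrite -[X in measurable X]setTI; exact: measurable_affine.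
- by move=> x _; exact: lebesgue_tuple_ge0.
- by rewrite lee_fin exprn_ge0// ltW.
Qed.

Definition tuple_open k (S : set (k.-tuple R)) := forall t, S t ->
  exists2 e : R, 0 < e & forall u, (forall i, `|tnth u i - tnth t i| < e) -> S u.

(** Such a set is a countable union of cubes with rational centers and radii 1/(N+1). *)
Lemma tuple_open_measurable k (S : set (k.-tuple T)) : tuple_open S -> measurable S.
Proof.
move=> oS.
pose box (cp : k.-tuple rat * nat) : set (k.-tuple T) :=
  [set u | forall i, `|tnth u i - ratr (tnth cp.1 i)| < cp.2.+1%:R^-1].
have -> : S = \bigcup_(cp in [set cp | box cp `<=` S]) box cp.
  apply/seteqP; split=> t; last by move=> [cp h]; exact: h.
  move=> St; have [e e0 he] := oS t St.
  have [N hN] := invS_le (divr_gt0 e0 (ltr0Sn R 1)).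
  have N0 : 0 < N.+1%:R^-1 :> R by rewrite invr_gt0.
  have /choice[c hc] i : exists c : rat, `|tnth t i - ratr c| < N.+1%:R^-1.
    have h : (tnth t i : R) - N.+1%:R^-1 < tnth t i + N.+1%:R^-1.
      by rewrite ltrBlDr -addrA ltrDl addr_gt0.
    have [c /=] := rat_in_itvoo h; rewrite in_itv /= => /andP[h1 h2].
    by exists c; rewrite distrC ltr_distl h1 h2.
  exists ([tuple c i | i < k], N) => [u hu|i /=]; last by rewrite tnth_mktuple.
  apply: he => i; have := hu i; rewrite /= tnth_mktuple => h1.
  rewrite -[_ - _](subrKA (ratr (c i))); apply: le_lt_trans (ler_normD _ _) _.
  rewrite [X in _ + X]distrC.
  by have := hN N (leqnn _); have := hc i; set x := _^-1 in h1 *; lra.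
have -> : \bigcup_(cp in [set cp | box cp `<=` S]) box cp =
    \bigcup_cp (if `[< box cp `<=` S >] then box cp else set0).
  apply/seteqP; split=> t [cp h1 h2]; first by exists cp => //; rewrite asboolT.
  by move: h2; case: asboolP => // h3 h2; exists cp.
apply: countable_bigcupT_measurable => [|cp]; first exact: countableP.
case: ifP => _; last exact: measurable0.
have -> : box cp = \bigcap_(i in [set: 'I_k])
    ((fun t => @tnth k T t i) @^-1` [set x | `|x - ratr (tnth cp.1 i)| < cp.2.+1%:R^-1]).
  by apply/seteqP; split=> t /= h i; [move=> _|]; exact: h.
apply: fin_bigcap_measurable => [|i _]; first exact: finite_finset.
rewrite -[X in measurable X]setTI; apply: measurable_tnth => //.
rewrite (_ : [set x | _] = ball (ratr (tnth cp.1 i) : R) cp.2.+1%:R^-1); last first.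
  by apply/seteqP; split=> x; rewrite /ball /= distrC.
exact: measurable_ball.
Qed.

End LebesgueTuple.

(** * Limits of extended real sequences along an ultrafilter *)

Section UltrafilterLimitsEreal.
Variables (R : realType) (U : set_system nat).
Hypothesis hU : nonprincipal_ultrafilter U.
#[local] Instance ultra_instance2 : ProperFilter U := ultra_pf hU.
Implicit Types f g : nat -> \bar R.
Local Open Scope ereal_scope.

(** An explicit formula for the limit along U, which exists in the extended reals for every sequence
    ([ulimE]). *)
Definition ulim f : \bar R := ereal_sup [set x | U [set n | x <= f n]].

Lemma ulim_lt f x : x < ulim f -> U [set n | x < f n].
Proof.
move=> /ereal_sup_gt[y Uy xy]; apply: filterS Uy => n /= h.
exact: lt_le_trans xy h.
Qed.

Lemma ulim_gt f x : ulim f < x -> U [set n | f n < x].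
Proof.
move=> fx; have [h|] := ultra_or hU [set n | x <= f n].
    have /(lt_le_trans fx) : x <= ulim f by exact: ereal_sup_ubound.
  by rewrite ltxx.
by apply: filterS => n /= /negP; rewrite -ltNge.
Qed.

Lemma ulimE f : lim (f @ U) = ulim f.
Proof.
apply/cvg_lim => // A; have := @ulim_lt f; have := @ulim_gt f.
case: (ulim f) => [r| |] hlt hgt /=; rewrite /nbhs /= /ereal_nbhs => hA.
- have [e e0 he] : exists2 e : R, (0 < e)%R & forall y, (`|r - y| < e)%R -> A y%:E.
    by have /nbhs_ballP[e e0 he] := hA; exists e.
  have h1 : U [set n | f n < (r + e)%:E] by apply: hlt; rewrite lte_fin ltrDl.
  have h2 : U [set n | (r - e)%:E < f n] by apply: hgt; rewrite lte_fin ltrBlDr ltrDl.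
  apply: filterS2 h1 h2 => n /=; case: (f n) => // y; rewrite !lte_fin => h1 h2.
  by apply: he; rewrite distrC ltr_distl h2.
- by have [M [_ hM]] := hA; apply: filterS (hgt M%:E (ltry _)) => n /=; exact: hM.
- by have [M [_ hM]] := hA; apply: filterS (hlt M%:E (ltNyr _)) => n /=; exact: hM.
Qed.

Lemma lim_ultra_ge f x : U [set n | x <= f n] -> x <= lim (f @ U).
Proof. by rewrite ulimE => h; exact: ereal_sup_ubound. Qed.

Lemma lim_ultra_mono f g (e : R) : U [set n | f n <= g n + e%:E] ->
  lim (f @ U) <= lim (g @ U) + e%:E.
Proof.
rewrite !ulimE => h; apply: ge_ereal_sup => y /= hy.
rewrite -leeBlDr//; apply: ereal_sup_ubound => /=.
by apply: filterS2 h hy => n /= h1 h2; rewrite EFinN leeBlDr//; exact: le_trans h2 h1.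
Qed.

Lemma lim_ultra_limn_esup f : lim (f @ U) <= limn_esup f.
Proof.
rewrite ulimE; apply: ge_ereal_sup => y /= hy.
rewrite limn_esup_lim; apply: lime_ge; first exact: is_cvg_esups.
apply: nearW => N; have [n [/= h1 h2]] := filter_ex (filterI hy (ultra_ge hU N)).
by apply: le_trans h1 _; apply: ereal_sup_ubound; exists n.
Qed.

End UltrafilterLimitsEreal.

Section NormalizedLog.
Variables (R : realType) (m n : nat).
Hypothesis n0 : (0 < n)%N.
Local Open Scope ereal_scope.
Implicit Types v w : \bar R.

Let c0 : (0 < ((n%:R ^+ 2)^-1 : R))%R.
Proof. by rewrite invr_gt0 exprn_gt0// ltr0n. Qed.

Lemma le_lne v w : 0 <= v -> v <= w -> lne v <= lne w.
Proof.
move=> v0 vw; rewrite lee_lne// in_itv /= leey andbT//.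
exact: le_trans vw.
Qed.

(** The normalization divides the logarithm by n^2, so a factor exp(e n^2) in volume costs e. *)
Lemma le_normalized_log (e : R) v w : 0 <= v -> (0 <= w) ->
  v <= (expR (e * n%:R ^+ 2))%:E * w ->
  normalized_log m n v <= normalized_log m n w + e%:E.
Proof.
move=> v0 w0 vw; rewrite /normalized_log addeAC leeD2r//.
have [w00|w0'] := eqVneq w 0.
  have -> : v = 0 by apply/eqP; rewrite eq_le v0 andbT; move: vw; rewrite w00 mule0.
  by rewrite w00 le0_lneNy// gt0_muleNy// lee_fin.
have {w0 w0'} w0 : 0 < w by rewrite lt_neqAle eq_sym w0'.
apply: (@le_trans _ _ (((n%:R ^+ 2)^-1)%:E * lne ((expR (e * n%:R ^+ 2))%:E * w))).
  by rewrite lee_pmul2l//; exact: le_lne.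
have hE : (expR (e * n%:R ^+ 2))%:E \in `]0, +oo].
  by rewrite in_itv /= leey andbT lte_fin expR_gt0.
have hw : w \in `]0, +oo] by rewrite in_itv /= leey andbT.
rewrite (lneM hE hw) lne_EFin; last exact: expR_gt0.
rewrite expRK muleDr// [leRHS]addeC; apply: leeD2r.
rewrite -EFinM lee_fin mulrCA mulVf ?mulr1//.
  by rewrite expf_neq0// pnatr_eq0 -lt0n.
Qed.

Lemma normalized_log_mono v w : 0 <= v -> v <= w ->
  normalized_log m n v <= normalized_log m n w.
Proof.
move=> v0 vw; rewrite -[leRHS]adde0; apply: le_normalized_log => //.
  exact: le_trans vw.
by rewrite mul0r expR0 mul1e.
Qed.

Lemma normalized_log_gt (c : R) v : 0 <= v -> (c%:E < normalized_log m n v) =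
  ((expR ((c - m%:R * ln n%:R) * n%:R ^+ 2))%:E < v).
Proof.
move=> v0; rewrite /normalized_log -lteBlDr//.
have [->|v0'] := eqVneq v 0.
  rewrite le0_lneNy// gt0_muleNy ?lte_fin// -EFinB ltNge leNye /=.
  by rewrite ltNge expR_ge0.
have {v0 v0'} v0 : 0 < v by rewrite lt_neqAle eq_sym v0'.
rewrite -EFinB lte_pdivlMl; last by rewrite exprn_gt0// ltr0n.
rewrite -[in RHS](@lneK R v) ?in_itv /= ?leey ?andbT ?ltW//.
by rewrite -EFinM mulrC -[in RHS]/(expeR _%:E) lte_expeR.
Qed.

End NormalizedLog.

(** * Continuity of laws in the matrices, and volume of matrix sets *)

Section MatrixContinuity.
Variables (R : realType).
Local Notation C := (R[i]).

Lemma ntrB n (A B : 'M[C]_n) : ntr (A - B) = ntr A - ntr B.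
Proof. by rewrite ntrD -scaleN1r ntrZ mulN1r. Qed.

Lemma mx_law_dist (J0 : choiceType) n (Z Z' : J0 -> 'M[C]_n) p :
  normc (mx_law Z p - mx_law Z' p) <= hsn (mev Z p - mev Z' p).
Proof. by rewrite !mx_lawE -ntrB; exact: normc_ntr_le. Qed.

Lemma cnorm_ge0 n (x : 'cV[C]_n) : 0 <= cnorm x.
Proof. exact: snorm_ge0. Qed.

Lemma normc_le_cnorm n (x : 'cV[C]_n) i : normc (x i 0) <= cnorm x.
Proof.
rewrite -(@ler_pXn2r _ 2) ?nnegrE ?normc_ge0 ?cnorm_ge0// sqr_cnorm (bigD1 i)//=.
by rewrite lerDl sumr_ge0// => j _; exact: sqr_ge0.
Qed.

Lemma cnorm_le_sum n (x : 'cV[C]_n) : cnorm x <= \sum_i normc (x i 0).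
Proof.
have s0 : 0 <= \sum_i normc (x i 0) by apply: sumr_ge0 => i _; exact: normc_ge0.
rewrite -(@ler_pXn2r _ 2) ?nnegrE ?cnorm_ge0// sqr_cnorm [leRHS]expr2 mulr_suml.
apply: ler_sum => i _; rewrite expr2 ler_wpM2l ?normc_ge0// (bigD1 i)//=.
by rewrite lerDl sumr_ge0// => j _; exact: normc_ge0.
Qed.

Lemma mx_opnorm_entries n (A : 'M[C]_n) e : 0 <= e -> (forall i j, normc (A i j) <= e) ->
  mx_opnorm_le A (n%:R * n%:R * e).
Proof.
move=> e0 Ae; apply/mx_opnormP; split; first by rewrite !mulr_ge0.
move=> v; apply: le_trans (cnorm_le_sum _) _.
apply: (@le_trans _ _ (\sum_(i < n) \sum_(j < n) e * cnorm v)).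
  apply: ler_sum => i _; rewrite mxE; apply: le_trans (normc_sum _ _) _.
  apply: ler_sum => j _; rewrite normcM ler_pM ?normc_ge0 ?Ae//.
  exact: normc_le_cnorm.
rewrite sumr_const card_ord sumr_const card_ord le_eqVlt; apply/orP; left; apply/eqP.
by ring.
Qed.

(** A vector on which A exceeds the norm r still does so for matrices near A. *)
Lemma opnorm_gt_open n (A : 'M[C]_n) r : 0 <= r -> ~ mx_opnorm_le A r ->
  exists2 e, 0 < e & forall A', mx_opnorm_le (A' - A) e -> ~ mx_opnorm_le A' r.
Proof.
move=> r0 nA; have [v hv] : exists v, r * cnorm v < cnorm (A *m v).
  apply: contrapT => h; apply: nA; apply/mx_opnormP; split=> // v.
  by rewrite leNgt; apply/negP => h1; apply: h; exists v.
have v0 : 0 < cnorm v + 1 by rewrite ltr_wpDl// cnorm_ge0.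
have d0 : 0 < cnorm (A *m v) - r * cnorm v by rewrite subr_gt0.
exists ((cnorm (A *m v) - r * cnorm v) / (cnorm v + 1)); first exact: divr_gt0.
move=> A' /mx_opnormP[_ /(_ v)]; rewrite mulmxBl => h2 /mx_opnormP[_ /(_ v)] h1.
have : cnorm (A *m v) <= cnorm (A' *m v) + cnorm (A' *m v - A *m v).
  rewrite -[X in cnorm X <= _](subKr (A' *m v)).
  have := snormD (cdot_sdot R n) (I : True) (I : True) (x := A' *m v)
    (y := - (A' *m v - A *m v)).
  by rewrite (snormN (cdot_sdot R n)).
have : (cnorm (A *m v) - r * cnorm v) / (cnorm v + 1) * cnorm v <
    cnorm (A *m v) - r * cnorm v.
  by rewrite mulrAC ltr_pdivrMr// ltr_pM2l// ltrDl.
rewrite /cnorm in h1 h2 *; lra.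
Qed.

Lemma normc_entry_le n (A : 'M[C]_n) r i j : mx_opnorm_le A r -> normc (A i j) <= r.
Proof.
move=> /mx_opnormP[r0 /(_ (delta_mx j 0))].
have -> : cnorm (delta_mx j 0 : 'cV[C]_n) = 1.
  apply/eqP; rewrite -(@eqrXn2 _ 2) ?cnorm_ge0// sqr_cnorm (bigD1 j)//= big1 => [|l lj].
    by rewrite mxE !eqxx normc1 addr0 !expr1n.
  by rewrite mxE (negPf lj) normc0 expr0n.
by rewrite mulr1 -colE => h; apply: le_trans h; have := normc_le_cnorm (col j A) i; rewrite mxE.
Qed.

(** Letters of a word are exchanged one at a time, with the operator norm on the other letters and
    the 2-norm on the difference; the resulting L is independent of n. *)
Lemma mev_lipschitz (J0 : choiceType) (p : ncpoly R J0) (K : J0 -> R) :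
  (forall k, 0 <= K k) -> exists2 L, 0 <= L &
  forall n (Z Z' : J0 -> 'M[C]_n) d, 0 <= d -> (forall k, mx_opnorm_le (Z k) (K k)) ->
    (forall k, mx_opnorm_le (Z' k) (K k)) -> (forall k, hsn (Z k - Z' k) <= d) ->
    hsn (mev Z p - mev Z' p) <= L * d.
Proof.
move=> K0; elim/ncpoly_ind: p => [|p q [L1 L10 h1] [L2 L20 h2]|c w].
- by exists 0 => // n Z Z' d _ _ _ _; rewrite /mev !ev0 subrr hsn0 mul0r.
- exists (L1 + L2) => [|n Z Z' d d0 ZK Z'K Zd]; first exact: addr_ge0.
  rewrite !(mevD _ p) opprD addrACA mulrDl; apply: le_trans (hsnD _ _) _.
  by rewrite lerD ?h1 ?h2.
suff [L L0 hL] : exists2 L, 0 <= L &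
  forall n (Z Z' : J0 -> 'M[C]_n) d, 0 <= d -> (forall k, mx_opnorm_le (Z k) (K k)) ->
    (forall k, mx_opnorm_le (Z' k) (K k)) -> (forall k, hsn (Z k - Z' k) <= d) ->
    hsn (mev Z (mon 1 w) - mev Z' (mon 1 w)) <= L * d.
  exists (normc c * L) => [|n Z Z' d d0 ZK Z'K Zd]; first by rewrite mulr_ge0 ?normc_ge0.
  have := hL n Z Z' d d0 ZK Z'K Zd; rewrite /mev !ev_mon !scale1r -scalerBr hsnZ -mulrA.
  by apply: ler_wpM2l; exact: normc_ge0.
elim: w => [|k w [L L0 IH]].
  by exists 0 => // n Z Z' d _ _ _ _; rewrite /mev !ev_mon subrr hsn0 mul0r.
exists (K k * L + pbound K (mon 1 w)) => [|n Z Z' d d0 ZK Z'K Zd].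
  by rewrite addr_ge0 ?mulr_ge0 ?pbound_ge0.
have {}IH := IH n Z Z' d d0 ZK Z'K Zd.
have hb := mev_bound (mon 1 w) Z'K; move: IH hb.
rewrite /mev !ev_mon !scale1r /=; set D := wev _ w _; set D' := wev _ w _ => IH hb.
have -> : Z k *m D - Z' k *m D' = Z k *m (D - D') + (Z k - Z' k) *m D'.
  by rewrite mulmxBr mulmxBl subrKA.
apply: le_trans (hsnD _ _) _; rewrite mulrDl lerD//.
  by apply: le_trans (hsn_mull _ (ZK k)) _; rewrite -mulrA ler_wpM2l.
by apply: le_trans (hsn_mulr _ hb) _; rewrite ler_wpM2l ?pbound_ge0.
Qed.

End MatrixContinuity.

Section NuBasics.
Variables (R : realType) (m n : nat).
Local Notation C := (R[i]).
Local Notation T := (measurableTypeR R).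
Local Notation coord := (@tuple_of_coord R m n).
Local Notation mxtup := ('I_m -> 'M[C]_n).
Implicit Types (A D : mxtup) (S : set mxtup).

Lemma le_nu S1 S2 : S1 `<=` S2 -> (nu S1 <= nu S2)%E.
Proof. by move=> h; apply: le_lebesgue_tuple => t; exact: h. Qed.

Lemma nu_ge0 S : (0 <= nu S)%E.
Proof. exact: lebesgue_tuple_ge0. Qed.

Lemma coord_affine s c t k : coord (affine_tuple s c t) k = s%:C%C *: coord t k + coord c k.
Proof.
rewrite /tuple_of_coord -sa_of_coord_linear; congr sa_of_coord.
by apply/funext => i; apply/funext => j; rewrite tnth_mktuple.
Qed.

Lemma coord_surj D : (forall k, samx (D k)) -> exists c, coord c = D.
Proof.
move=> saD; have /choice[a ha] k := sa_of_coord_surj (saD k).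
pose c := [tuple (mxvec (\matrix_(k < m, l < n * n) mxvec (\matrix_(i, j) a k i j) 0 l)) 0 i
  | i < (m * (n * n))].
exists c; apply/funext => k; rewrite -ha; congr sa_of_coord.
by apply/funext => i; apply/funext => j; rewrite tnth_mktuple mxvecE mxE mxvecE mxE.
Qed.

Definition nu_measurable S := measurable (coord @^-1` S : set ((m * (n * n)).-tuple T)).

Lemma nu_affine s D S : 0 < s -> (forall k, samx (D k)) -> nu_measurable S ->
  ((s ^+ (m * (n * n)))%:E * nu ([set A | S (fun k => s%:C%C *: A k + D k)%R]) = nu S)%E.
Proof.
move=> s0 saD mS; have [c <-] := coord_surj saD.
rewrite -[RHS](lebesgue_tuple_affine c s0 mS); congr (_ * lebesgue_tuple _)%E.
apply/seteqP; split=> t /=; congr S; apply/funext => k; by rewrite coord_affine.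
Qed.

(** The union bound is applied to the measurable cover, and S is compared with it by
    monotonicity. *)
Lemma nu_union (E : choiceType) (s : seq E) (F : E -> set mxtup) S c :
  (forall e, nu_measurable (F e)) -> (forall e, nu (F e) <= c)%E ->
  (forall A, S A -> exists2 e, e \in s & F e A) ->
  (nu S <= (size s)%:R%:E * c)%E.
Proof.
move=> mF Fc SF; have [mu _ muE] := lebesgue_tuple_measure R (m * (n * n)).
pose G (s : seq E) := [set t | exists2 e, e \in s & F e (coord t)].
have mG s1 : measurable (G s1 : set ((m * (n * n)).-tuple T)).
  elim: s1 => [|e s1 IH].
    by rewrite (_ : G _ = set0)//; apply/seteqP; split=> t // [].
  rewrite (_ : G _ = (coord @^-1` F e) `|` G s1); first by apply: measurableU => //; exact: mF.
  apply/seteqP; split=> t.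
    by move=> [e']; rewrite inE => /predU1P[->|h] Fe; [left|right; exists e'].
  move=> [h|[e' h1 h2]]; first by exists e => //; rewrite mem_head.
  by exists e' => //; rewrite inE h1 orbT.
apply: (@le_trans _ _ (lebesgue_tuple (G s))).
  by apply: le_lebesgue_tuple => t /SF.
elim: s {SF} => [|e s IH].
  rewrite mul0e -muE// (_ : G _ = set0) ?measure0//.
  by apply/seteqP; split=> t // [].
rewrite -muE//; apply: (@le_trans _ _ (mu ((coord @^-1` F e) `|` G s))).
  apply: le_measure; rewrite ?inE//; first by apply: measurableU => //; exact: mF.
  by move=> t [e']; rewrite inE => /predU1P[->|h] Fe; [left|right; exists e'].
have h : (mu ((coord @^-1` F e) `|` G s) <= mu (coord @^-1` F e) + mu (G s))%E.
  by apply: measureU2; [exact: mF|exact: mG].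
apply: le_trans h _; rewrite (muE _ (mF e)) (muE _ (mG s)) [size _]/= -addn1 natrD EFinD ge0_muleDl ?lee_fin// ?mul1e.
by rewrite addeC leeD//; exact: Fc.
Qed.

Definition mx_open S := forall A, S A -> exists2 e : R, 0 < e &
  forall A', (forall k, mx_opnorm_le (A' k - A k) e) -> S A'.

Lemma coord_small (t : (m * (n * n)).-tuple R) e k i j : 0 <= e ->
  (forall l, `|tnth t l| <= e) ->
  normc (coord t k i j) <= (Num.sqrt n%:R + 2 * Num.sqrt (n%:R / 2)) * e.
Proof.
move=> e0 te; set s1 := Num.sqrt _; set s2 := Num.sqrt _.
have s10 : 0 <= s1 by exact: sqrtr_ge0.
have s20 : 0 <= s2 by exact: sqrtr_ge0.
have h (a b : R) : `|a| <= e -> `|b| <= e -> normc (s2%:C%C * (a +i* b)%C) <= (s1 + 2 * s2) * e.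
  move=> ha hb; rewrite normcM normcR (ger0_norm s20).
  have := normc_le_ReIm (a +i* b)%C => /= h1.
  apply: le_trans (_ : s2 * (e + e) <= _).
    by rewrite ler_wpM2l//; apply: le_trans h1 _; exact: lerD.
  by have := mulr_ge0 s10 e0; lra.
rewrite /tuple_of_coord mxE; case: ifP => _.
  rewrite normcR normrM (ger0_norm s10) mulrDl; apply: ler_wpDr.
    by rewrite !mulr_ge0.
  by rewrite ler_wpM2l.
by case: ifP => _; apply: h; rewrite ?normrN.
Qed.

Lemma mx_open_measurable S : mx_open S -> nu_measurable S.
Proof.
move=> oS; apply: tuple_open_measurable => t St; have [e e0 he] := oS _ St.
pose c := n%:R * n%:R * (Num.sqrt n%:R + 2 * Num.sqrt (n%:R / 2)) + 1 : R.
have c0 : 0 < c by rewrite ltr_wpDl// !mulr_ge0// addr_ge0// ?mulr_ge0// sqrtr_ge0.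
have ec0 : 0 < e / c by rewrite divr_gt0.
exists (e / c) => // u hu; apply: he => k.
have -> : coord u k - coord t k = coord (affine_tuple (-1) u t) k.
  by rewrite coord_affine [RHS]addrC (_ : (-1)%:C%C = -1) ?scaleN1r// rmorphN1.
apply: mx_opnorm_trans (mx_opnorm_entries _ (e := (Num.sqrt n%:R + 2 * Num.sqrt (n%:R / 2)) * (e / c)) _).
- rewrite mulrA mulrCA -[leRHS]mulr1 ler_pM2l// ler_pdivrMr// mul1r.
  by rewrite /c lerDl.
- by rewrite mulr_ge0 ?(ltW ec0)// addr_ge0 ?mulr_ge0// sqrtr_ge0.
move=> i j; apply: coord_small; first exact: ltW.
by move=> l; rewrite tnth_mktuple mulN1r addrC; exact: ltW.
Qed.

Lemma opball_measurable (r : 'I_m -> R) : (forall k, 0 <= r k) ->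
  nu_measurable [set A | forall k, mx_opnorm_le (A k) (r k)].
Proof.
move=> r0; rewrite /nu_measurable -[X in measurable X]setCK; apply: measurableC.
rewrite (_ : ~` _ = coord @^-1` (~` [set A | forall k, mx_opnorm_le (A k) (r k)]))//.
apply: mx_open_measurable => A /= /existsNP[k] nk.
have [e e0 he] := opnorm_gt_open (r0 k) nk.
by exists e => // A' hA' /(_ k); exact: he.
Qed.

Lemma mx_law_open (Z : nat -> 'M[C]_n) (G : seq (ncpoly R ('I_m + nat)%type))
    (z : ncpoly R ('I_m + nat)%type -> C) e :
  mx_open [set A | forall p, p \in G -> normc (mx_law (join A Z) p - z p) < e].
Proof.
move=> A hA; have /choice[K hK] (D : 'M[C]_n) : exists r, 0 <= r /\ mx_opnorm_le D r.
  have [r [r0 hr]] : exists r, 0 <= r /\ forall i j, normc (D i j) <= r.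
    exists (\sum_i \sum_j normc (D i j)); split.
      by apply: sumr_ge0 => i _; apply: sumr_ge0 => j _; exact: normc_ge0.
    move=> i j; rewrite (bigD1 i)//= (bigD1 j)//= -addrA lerDl.
    rewrite addr_ge0// sumr_ge0// => i' _; first exact: normc_ge0.
    by apply: sumr_ge0 => j' _; exact: normc_ge0.
  by exists (n%:R * n%:R * r); split; [rewrite !mulr_ge0|exact: mx_opnorm_entries].
pose Kb := join (fun k => K (A k) + 1) (fun j => K (Z j)).
have Kb0 k : 0 <= Kb k.
  case: k => [k|k] /=; last by case: (hK (Z k)).
  by rewrite addr_ge0//; case: (hK (A k)).
elim: G hA => [_|p G IH hA]; first by exists 1; [exact: ltr01|move=> A' _ p; rewrite in_nil].
have [e1 e10 h1] : exists2 e1 : R, 0 < e1 & forall A', (forall k, mx_opnorm_le (A' k - A k) e1) ->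
    forall q, q \in G -> normc (mx_law (join A' Z) q - z q) < e.
  by apply: IH => q qG; apply: hA; rewrite inE qG orbT.
have [L L0 hL] := mev_lipschitz p Kb0.
have g0 : 0 < e - normc (mx_law (join A Z) p - z p).
  by rewrite subr_gt0; apply: hA; rewrite mem_head.
set g := e - _ in g0; have L1 : 0 < L + 1 by rewrite ltr_wpDl.
exists (Num.min e1 (Num.min 1 (g / (L + 1)))).
  by rewrite !lt_min e10 ltr01 divr_gt0.
move=> A' hA' q; rewrite inE => /predU1P[->{q}|]; last first.
  apply: h1 => k; apply: mx_opnorm_trans (hA' k).
  by rewrite ge_min lexx.
set d := Num.min 1 (g / (L + 1)) in hA'.
have d0 : 0 <= d by rewrite le_min ler01 divr_ge0 ?(ltW g0) ?(ltW L1).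
have hd k : mx_opnorm_le (A' k - A k) d.
  by apply: mx_opnorm_trans (hA' k); rewrite ge_min lexx orbT.
have d1 : d <= 1 by rewrite ge_min lexx.
have dg : L * d < g.
  apply: (@le_lt_trans _ _ (L * (g / (L + 1)))).
    by rewrite ler_wpM2l// ge_min lexx orbT.
  by rewrite mulrCA -[ltRHS]mulr1 ltr_pM2l// ltr_pdivrMr// mul1r ltrDl.
have h2 : hsn (mev (join A' Z) p - mev (join A Z) p) <= L * d.
  apply: hL => // -[k|k] /=.
  - rewrite -[A' k](subrK (A k)) addrC; case: (hK (A k)) => _ hk.
    by apply: mx_opnorm_trans (mx_opnorm_add hk (hd k)); rewrite lerD2l.
  - by case: (hK (Z k)).
  - by case: (hK (A k)) => _; apply: mx_opnorm_trans; rewrite lerDl.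
  - by case: (hK (Z k)).
  - exact: hsn_le_op.
  - by rewrite subrr hsn0.
rewrite -[_ - _](subrKA (mx_law (join A Z) p)); apply: le_lt_trans (le_normcD _ _) _.
by have := le_trans (mx_law_dist (join A' Z) (join A Z) p) h2; rewrite /g in dg; lra.
Qed.

End NuBasics.

(** * Removal of the operator norm cutoff *)

Section Spectral.
Variables (R : realType).
Local Notation C := (R[i]).

Definition dgm n (f : 'I_n -> R) : 'M[C]_n := diag_mx (\row_i (f i)%:C%C).

Lemma dgmE n (f : 'I_n -> R) i j : dgm f i j = (f i)%:C%C *+ (i == j).
Proof. by rewrite !mxE. Qed.

Lemma dgm_sa n (f : 'I_n -> R) : samx (dgm f).
Proof.
apply/matrixP => i j; rewrite adjmxE !dgmE eq_sym; have [->|_] := eqVneq i j.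
  by rewrite conjE; apply/eqP; rewrite eq_complex /= oppr0 !eqxx.
by rewrite !mulr0n [LHS]conjc0.
Qed.

Lemma dgmM n (f g : 'I_n -> R) : dgm f *m dgm g = dgm (fun i => f i * g i).
Proof. by rewrite mulmx_diag; congr diag_mx; apply/rowP => i; rewrite !mxE rmorphM. Qed.

Lemma dgm_mulE n (f : 'I_n -> R) (v : 'cV[C]_n) i : (dgm f *m v) i 0 = (f i)%:C%C * v i 0.
Proof. by rewrite mul_diag_mx !mxE. Qed.

Lemma cnorm_dgm n (f : 'I_n -> R) r (v : 'cV[C]_n) : (forall i, `|f i| <= r) ->
  cnorm (dgm f *m v) <= r * cnorm v.
Proof.
move=> fr; case: n f v fr => [|n] f v fr.
  by rewrite [v]flatmx0 mulmx0 /cnorm (snorm0 (cdot_sdot R 0)) mulr0.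
have r0 : 0 <= r by apply: le_trans (fr ord0).
rewrite -(@ler_pXn2r _ 2) ?nnegrE ?mulr_ge0 ?cnorm_ge0// exprMn !sqr_cnorm mulr_sumr.
apply: ler_sum => i _; rewrite dgm_mulE normcM normcR exprMn ler_wpM2r ?sqr_ge0//.
by rewrite ler_pXn2r ?nnegrE.
Qed.

Section Unitary.
Variables (n : nat) (P : 'M[C]_n).
Hypotheses (PP : adjmx P *m P = 1%:M) (PP' : P *m adjmx P = 1%:M).

Definition fdiag f : 'M[C]_n := adjmx P *m dgm f *m P.

Lemma cnorm_unitary v : cnorm (P *m v) = cnorm v.
Proof. by rewrite /cnorm /snorm cdot_adj mulmxA PP mul1mx. Qed.

Lemma cnorm_unitary_adj v : cnorm (adjmx P *m v) = cnorm v.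
Proof. by rewrite /cnorm /snorm cdot_adj adjmxK mulmxA PP' mul1mx. Qed.

Lemma fdiag_sa f : samx (fdiag f).
Proof. by rewrite /samx /fdiag !adjmxM adjmxK dgm_sa mulmxA. Qed.

Lemma fdiag_opnorm f r : 0 <= r -> (forall i, `|f i| <= r) -> mx_opnorm_le (fdiag f) r.
Proof.
move=> r0 fr; apply/mx_opnormP; split=> // v.
rewrite /fdiag -!mulmxA cnorm_unitary_adj.
by rewrite -(cnorm_unitary v); exact: cnorm_dgm.
Qed.

Lemma fdiagM f g : fdiag f *m fdiag g = fdiag (fun i => f i * g i).
Proof.
rewrite /fdiag -!mulmxA; congr (_ *m _); rewrite (mulmxA P) PP' mul1mx.
by rewrite mulmxA dgmM.
Qed.

Lemma fdiagB f g : fdiag f - fdiag g = fdiag (fun i => f i - g i).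
Proof.
rewrite /fdiag -mulmxBl -mulmxBr; congr (_ *m _ *m _).
by rewrite -raddfB /=; congr diag_mx; apply/rowP => i; rewrite !mxE rmorphB.
Qed.

Lemma ntr_fdiag f : ntr (fdiag f) = (n%:R^-1 * \sum_i f i)%:C%C.
Proof.
rewrite /ntr /fdiag -mulmxA mxtrace_mulC -mulmxA PP' mulmx1 mxtrace_diag.
rewrite rmorphM /= fmorphV rmorph_nat; congr (_ * _).
by rewrite rmorph_sum; apply: eq_bigr => i _; rewrite mxE.
Qed.

Lemma sqr_hsn_fdiag f : hsn (fdiag f) ^+ 2 = n%:R^-1 * \sum_i f i ^+ 2.
Proof.
rewrite hsnE (sqr_snorm (mdot_sdot R n))// /mdot fdiag_sa fdiagM ntr_fdiag /=.
by congr (_ * _); apply: eq_bigr => i _; rewrite expr2.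
Qed.

Lemma fdiag_eig_le f r i : mx_opnorm_le (fdiag f) r -> `|f i| <= r.
Proof.
move=> /mx_opnormP[r0 /(_ (adjmx P *m delta_mx i 0))]; rewrite /fdiag -!mulmxA (mulmxA P) PP' mul1mx !cnorm_unitary_adj => h.
have e1 : cnorm (delta_mx i 0 : 'cV[C]_n) = 1.
  apply/eqP; rewrite -(@eqrXn2 _ 2) ?cnorm_ge0// sqr_cnorm (bigD1 i)//= big1 => [|j ji].
    by rewrite mxE !eqxx normc1 addr0 !expr1n.
  by rewrite mxE (negPf ji) normc0 expr0n.
rewrite e1 mulr1 in h; apply: le_trans h; apply: le_trans (normc_le_cnorm _ i).
by rewrite dgm_mulE mxE !eqxx mulr1 normcR.
Qed.

Definition mpow (A : 'M[C]_n) k := iter k (mulmx A) 1%:M.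

Lemma mpow_fdiag f k : mpow (fdiag f) k = fdiag (fun i => f i ^+ k).
Proof.
elim: k => [|k IH] /=.
  rewrite /fdiag (_ : dgm _ = 1%:M) ?mulmx1 ?PP//.
  by apply/matrixP => i j; rewrite dgmE !mxE expr0.
rewrite IH fdiagM; congr fdiag; apply/funext => i; by rewrite exprS.
Qed.

End Unitary.

Lemma sa_spectral n (A : 'M[C]_n) : samx A -> exists P lam,
  [/\ adjmx P *m P = 1%:M, P *m adjmx P = 1%:M & A = fdiag P lam].
Proof.
move=> saA; have adjE (B : 'M[C]_n) : map_mx Num.conj (B^T) = adjmx B.
  by rewrite /adjmx map_trmx.
have /orthomx_spectralP : A \is normalmx.
  by apply/normalmxP; rewrite adjE saA.
have /unitarymxP := spectral_unitarymx A.
have := invmx_unitary (spectral_unitarymx A); have := spectral_unit A.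
set P := spectralmx A; set d := spectral_diag A; rewrite adjE.
move=> uP -> PP' EA; have PP : adjmx P *m P = 1%:M by exact: mulmx1C.
have Ed : diag_mx d = P *m A *m adjmx P.
  by rewrite EA !mulmxA PP' mul1mx -mulmxA PP' mulmx1.
exists P, (fun i => Re (d 0 i)); split; [exact: PP|exact: PP'|].
rewrite [LHS]EA /fdiag.
congr (_ *m _ *m _); congr diag_mx; apply/rowP => i; rewrite mxE.
have /matrixP/(_ i i) : samx (diag_mx d) by rewrite /samx Ed !adjmxM adjmxK saA mulmxA.
rewrite adjmxE !mxE eqxx mulr1n conjE; case: (d 0 i) => a b /eqP.
rewrite eq_complex /= => /andP[_ /eqP h].
by apply/eqP; rewrite eq_complex /= eqxx; apply/eqP; lra.
Qed.

(** Markov's inequality for the even power sum of the eigenvalues. *)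
Lemma sum_pow_outliers n (lam : 'I_n -> R) s k : 0 <= s ->
  #|[set i | s < `|lam i|]%SET|%:R * s ^+ (2 * k) <= \sum_i lam i ^+ (2 * k).
Proof.
move=> s0; rewrite (bigID [pred i | i \in [set i | s < `|lam i|]%SET])/=.
rewrite -[leLHS]addr0 lerD//; last first.
  by apply: sumr_ge0 => i _; rewrite exprM exprn_ge0 ?sqr_ge0.
rewrite -sum1_card natr_sum mulr_suml; apply: ler_sum => i; rewrite inE mul1r => si.
rewrite exprM [leRHS]exprM -(real_normK (num_real (lam i))).
by rewrite lerXn2r ?nnegrE ?exprn_ge0// lerXn2r ?nnegrE// ltW.
Qed.

Lemma outliers_le n (lam : 'I_n -> R) s k c : 0 < s ->
  n%:R^-1 * \sum_i lam i ^+ (2 * k) <= c ->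
  n%:R^-1 * #|[set i | s < `|lam i|]%SET|%:R <= c / s ^+ (2 * k).
Proof.
move=> s0 h; rewrite ler_pdivlMr ?exprn_gt0// -mulrA; apply: le_trans h.
by rewrite ler_wpM2l// sum_pow_outliers// ltW.
Qed.

Lemma clamp_dist_le (x r : R) : 0 < r -> `|x - Num.max (- r) (Num.min x r)| <= `|x|.
Proof.
move=> r0; case: (leP x r) => h1; case: (leP (- r) _) => h2; case: (ger0P x) => h3;
by rewrite ler_norml; apply/andP; split; lra.
Qed.

Lemma clamp_dist_small (x r d : R) : 0 < r -> 0 <= d -> `|x| <= r + d ->
  `|x - Num.max (- r) (Num.min x r)| <= d.
Proof.
move=> r0 d0; rewrite !ler_norml => /andP[h1 h2].
by case: (leP x r) => h3; case: (leP (- r) _) => h4; apply/andP; split; lra.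
Qed.

(** A' has the eigenvalues clamped to [-r, r]. Those within r (1 + kappa) move by at most kappa r;
    the others move by at most K, and their proportion is controlled by the moment. A' is chosen
    before kappa, k and c, so one clamped lift serves every precision. *)
Lemma clamp_ex n (A : 'M[C]_n) K r : samx A -> mx_opnorm_le A K -> 0 < r ->
  exists2 A', samx A' /\ mx_opnorm_le A' r &
    forall kappa k c, 0 < kappa -> Re (ntr (mpow A (2 * k))) <= c ->
      hsn (A - A') ^+ 2 <= (kappa * r) ^+ 2 + K ^+ 2 * (c / (r * (1 + kappa)) ^+ (2 * k)).
Proof.
move=> saA; have [P [lam [PP PP' ->]]] := sa_spectral saA => hK r0.
have lamK i := fdiag_eig_le PP' i hK.
pose cl x := Num.max (- r) (Num.min x r) : R.
exists (fdiag P (fun i => cl (lam i))).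
  split; first exact: fdiag_sa.
  apply: fdiag_opnorm; rewrite ?(ltW r0)// => i.
  by rewrite ler_norml /cl le_max lexx /= ge_max ge_min lexx orbT andbT; lra.
move=> kappa k c k0; rewrite mpow_fdiag// ntr_fdiag//= => hc.
rewrite fdiagB sqr_hsn_fdiag//.
have s0 : 0 < r * (1 + kappa) by rewrite mulr_gt0// addr_gt0.
have := outliers_le s0 hc; set S := [set i | _]%SET => hS.
apply: (@le_trans _ _ (n%:R^-1 * \sum_(i < n) ((kappa * r) ^+ 2 + K ^+ 2 * (i \in S)%:R))).
  rewrite ler_wpM2l ?invr_ge0//; apply: ler_sum => i _; rewrite inE.
  have b0 x y : `|x| <= y -> x ^+ 2 <= y ^+ 2 :> R.
    move=> xy; rewrite -(real_normK (num_real x)) lerXn2r ?nnegrE//.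
    exact: le_trans xy.
  case: ltP => hi; rewrite ?mulr1 ?mulr0 ?addr0.
    apply: le_trans (_ : K ^+ 2 <= _); last by rewrite lerDr sqr_ge0.
    by apply: b0; apply: le_trans (lamK i); exact: clamp_dist_le.
  by apply: b0; apply: clamp_dist_small => //; [exact: mulr_ge0 (ltW k0) (ltW r0)|lra].
rewrite big_split /= sumr_const card_ord -mulr_sumr mulrDr lerD//.
  rewrite -[X in _ * X <= _]mulr_natl mulrA; case: (n) => [|n']; first by rewrite invr0 !mul0r sqr_ge0.
  by rewrite mulVf ?mul1r ?pnatr_eq0.
rewrite mulrCA ler_wpM2l ?sqr_ge0//; apply: le_trans hS.
rewrite (_ : \sum_(i < n) _ = #|S|%:R)// -sum1_card natr_sum [RHS]big_mkcond.
by apply: eq_bigr => i _; case: (i \in S).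
Qed.

(** [None] marks an eigenvalue inside the cutoff and [Some b] an outlier, with b true for a
    nonnegative one. *)
Definition sgn3 n := {ffun 'I_n -> option bool}.

Definition sgn_val (o : option bool) : R :=
  if o is Some b then if b then 1 else -1 else 0.

Definition sgmx n (s : sgn3 n) : 'M[C]_n := dgm (fun i => sgn_val (s i)).

Definition sgn_supp n (s : sgn3 n) : {set 'I_n} := [set i | s i != None]%SET.

Definition signed_gram n (s : sgn3 n) (W : 'M[C]_n) := adjmx W *m sgmx s *m W.

Lemma signed_gram_sa n (s : sgn3 n) W : samx (signed_gram s W).
Proof. by rewrite /samx /signed_gram !adjmxM adjmxK dgm_sa mulmxA. Qed.

(** Changing one factor W at a time turns a net for W into a net for the self-adjoint outlying
    parts. *)
Lemma signed_gram_dist n (s : sgn3 n) W W' q e : mx_opnorm_le W q -> mx_opnorm_le W' q ->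
  mx_opnorm_le (W - W') e ->
  mx_opnorm_le (signed_gram s W - signed_gram s W') (2 * q * e).
Proof.
move=> hW hW' he.
have hs : mx_opnorm_le (sgmx s) 1.
  apply/mx_opnormP; split=> // v; apply: cnorm_dgm => i.
  by case: (s i) => [[]|] /=; rewrite ?normrN ?normr1 ?normr0.
rewrite (_ : _ - _ = adjmx (W - W') *m sgmx s *m W + adjmx W' *m sgmx s *m (W - W')).
  rewrite (_ : 2 * q * e = e * 1 * q + q * 1 * e); last by ring.
  apply: mx_opnorm_add.
    by apply: mx_opnorm_mul hW; apply: mx_opnorm_mul hs; exact: mx_opnorm_adj.
  by apply: mx_opnorm_mul he; apply: mx_opnorm_mul hs; exact: mx_opnorm_adj.
by rewrite adjmxB !mulmxBl mulmxBr subrKA.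
Qed.

(* W carries the spectral part of A outside [-s, s]; sg records the signs of the
   eigenvalues and the support, whose size is bounded by the even moments. *)
Lemma outlier_part n (A : 'M[C]_n) q s : samx A -> mx_opnorm_le A (q ^+ 2) -> 0 <= q -> 0 < s ->
  exists (sg : sgn3 n) W, [/\ mx_opnorm_le W q,
    forall i j, i \notin sgn_supp sg -> W i j = 0,
    mx_opnorm_le (A - signed_gram sg W) s,
    hsn (signed_gram sg W) ^+ 2 <= q ^+ 4 * (n%:R^-1 * #|sgn_supp sg|%:R) &
    forall k c, Re (ntr (mpow A (2 * k))) <= c ->
      n%:R^-1 * #|sgn_supp sg|%:R <= c / s ^+ (2 * k)].
Proof.
move=> saA; have [P [lam [PP PP' ->]]] := sa_spectral saA => hq q0 s0.
have lamK i := fdiag_eig_le PP' i hq.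
pose sg : sgn3 n := [ffun i => if s < `|lam i| then Some (0 <= lam i) else None].
have suppE : sgn_supp sg = [set i | s < `|lam i|]%SET.
  by apply/setP => i; rewrite !inE ffunE; case: ifP.
pose g i := if i \in sgn_supp sg then Num.sqrt `|lam i| else 0.
exists sg, (dgm g *m P).
have EW : signed_gram sg (dgm g *m P) =
    fdiag P (fun i => if i \in sgn_supp sg then lam i else 0).
  rewrite /signed_gram adjmxM dgm_sa /fdiag !mulmxA -!(mulmxA (adjmx P)) !dgmM.
  congr (_ *m (dgm _ *m _)); apply/funext => i; rewrite /g suppE inE ffunE.
  case: ifP => _; last by rewrite mulr0.
  rewrite mulrAC -expr2 sqr_sqrtr//; case: (ger0P (lam i)) => h /=; first by rewrite mulr1.
  by rewrite mulrN1 opprK.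
split.
- apply/mx_opnormP; split=> // v; rewrite -mulmxA -(cnorm_unitary PP v).
  apply: cnorm_dgm => i; rewrite /g; case: ifP => _; last by rewrite normr0.
  rewrite ger0_norm ?sqrtr_ge0//.
  apply: le_trans (_ : Num.sqrt (q ^+ 2) <= _); last by rewrite sqrtr_sqr ger0_norm.
  exact: ler_wsqrtr.
- move=> i j iS; rewrite mul_diag_mx !mxE /g (negPf iS) mul0r//.
- rewrite EW fdiagB; apply: fdiag_opnorm; rewrite ?(ltW s0)// => i.
  rewrite suppE inE; case: ltP => h; first by rewrite subrr normr0 ltW.
  by rewrite subr0.
- rewrite EW sqr_hsn_fdiag// mulrCA ler_wpM2l ?invr_ge0//.
  rewrite -sum1_card natr_sum mulr_sumr [leRHS]big_mkcond /=; apply: ler_sum => i _.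
  case: ifP => _; last by rewrite expr0n.
  rewrite mulr1 (_ : 4 = 2 * 2)%N// exprM -(real_normK (num_real (lam i))).
  by rewrite lerXn2r ?nnegrE ?sqr_ge0.
by move=> k c; rewrite mpow_fdiag// ntr_fdiag//= suppE; exact: outliers_le.
Qed.

End Spectral.

(** * Nets for operator norm balls in linearly parametrized matrix spaces *)

Section Packing.
Variables (R : realType) (n k : nat) (f : k.-tuple R -> 'M[R[i]]_n) (L : R).
Hypothesis L0 : 0 <= L.
Hypothesis f_affine : forall s c t, f (affine_tuple s c t) = s%:C%C *: f t + f c.
Hypothesis f_small : forall t e, 0 <= e -> (forall i, `|tnth t i| <= e) ->
  mx_opnorm_le (f t) (L * e).
Hypothesis f_coord : forall t r i, mx_opnorm_le (f t) r -> `|tnth t i| <= r.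
Local Notation T := (measurableTypeR R).

Let z0 : k.-tuple R := [tuple 0 | i < k].

Let f_z0 : f z0 = 0.
Proof.
have := f_affine 1 z0 z0; rewrite (_ : affine_tuple _ _ _ = z0); last first.
  by apply: eq_from_tnth => i; rewrite !tnth_mktuple mulr0 addr0.
by rewrite rmorph1 scale1r => /eqP; rewrite -subr_eq subrr eq_sym => /eqP.
Qed.

Let fB u t : f u - f t = f (affine_tuple (-1) u t).
Proof. by rewrite f_affine (_ : (-1)%:C%C = -1) ?rmorphN1// scaleN1r addrC. Qed.

Definition cball c rho : set (k.-tuple R) := [set t | mx_opnorm_le (f t - f c) rho].

Lemma cball_measurable c rho : 0 <= rho -> measurable (cball c rho : set (k.-tuple T)).
Proof.
move=> r0; rewrite -[X in measurable X]setCK; apply: measurableC.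
apply: tuple_open_measurable => t /= nt; have [e e0 he] := opnorm_gt_open r0 nt.
have L1 : 0 < L + 1 by rewrite ltr_wpDl.
exists (e / (L + 1)); first exact: divr_gt0.
move=> u hu; apply: he; rewrite opprD addrACA subrr addr0 fB.
apply: mx_opnorm_trans (f_small (e := e / (L + 1)) _ _).
- by rewrite mulrCA -[leRHS]mulr1 ler_pM2l// ler_pdivrMr// mul1r lerDl.
- by rewrite divr_ge0// ltW.
by move=> i; rewrite tnth_mktuple mulN1r addrC; exact: ltW.
Qed.

Local Notation vol := (lebesgue_tuple (cball z0 1)).

Lemma cball_vol c rho : 0 < rho -> lebesgue_tuple (cball c rho) = ((rho ^+ k)%:E * vol)%E.
Proof.
move=> r0; have mc := cball_measurable c (ltW r0).
rewrite -(lebesgue_tuple_affine c r0 mc); congr (_ * lebesgue_tuple _)%E.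
apply/seteqP; split=> t; rewrite /cball /= f_affine addrK f_z0 subr0.
  move=> h; rewrite -[f t]scale1r -(mulVf (_ : rho%:C%C != 0 :> R[i])); last first.
    by rewrite eq_complex /= eqxx andbT gt_eqF.
  rewrite -scalerA; have := mx_opnorm_scale (rho%:C%C^-1) h.
  by rewrite -fmorphV normcR ger0_norm ?invr_ge0 ?(ltW r0)// mulVf// gt_eqF.
move=> h; have := mx_opnorm_scale (rho%:C%C) h.
by rewrite normcR ger0_norm ?(ltW r0)// mulr1.
Qed.

(** The unit ball contains a small cube by [f_small] and lies in a cube of side 2 by [f_coord], so
    its volume is positive and finite and can be cancelled. *)
Lemma unit_vol : exists2 v : R, 0 < v & vol = v%:E.
Proof.
have L1 : 0 < L + 1 by rewrite ltr_wpDl.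
have d0 : 0 < (L + 1)^-1 by rewrite invr_gt0.
have le1 : ((\prod_(i < k) ((L + 1)^-1 - - (L + 1)^-1))%:E <= vol)%E.
  rewrite -(lebesgue_tuple_box (a := fun _ => - (L + 1)^-1)); last by move=> i; lra.
  apply: le_lebesgue_tuple => t ht; rewrite /cball /= f_z0 subr0.
  apply: mx_opnorm_trans (f_small (ltW d0) _); first by rewrite ler_pdivrMr// mul1r lerDl.
  by move=> i; have := ht i; rewrite in_itv /= ler_norml.
have le2 : (vol <= (\prod_(i < k) (1 - - 1 : R))%:E)%E.
  rewrite -(lebesgue_tuple_box (a := fun _ => - 1)); last by move=> i; lra.
  apply: le_lebesgue_tuple => t; rewrite /cball /= f_z0 subr0 => ht i.
  by rewrite in_itv /= -ler_norml; exact: f_coord.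
have p0 : 0 < \prod_(i < k) ((L + 1)^-1 - - (L + 1)^-1) by apply: prodr_gt0 => i _; lra.
case: vol le1 le2 => [v| |] //; rewrite !lee_fin => h1 h2.
by exists v => //; exact: lt_le_trans h1.
Qed.

Fixpoint separated (eta : R) (s : seq (k.-tuple R)) : Prop := if s is c :: s' then
  (forall c', c' \in s' -> ~ mx_opnorm_le (f c - f c') eta) /\ separated eta s' else True.

(* Volume comparison: the balls of radius eta/2 around the points are disjoint
   and lie in the ball of radius q + eta/2. *)
Lemma separated_size eta q s : 0 < eta -> 0 <= q -> separated eta s ->
  (forall c, c \in s -> mx_opnorm_le (f c) q) ->
  (size s)%:R <= (1 + 2 * q / eta) ^+ k.
Proof.
move=> e0 q0 ss sq; have e20 : 0 < eta / 2 by rewrite divr_gt0.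
have [v v0 vE] := unit_vol; have [mu _ muE] := lebesgue_tuple_measure R k.
pose G (s : seq (k.-tuple R)) := [set t | exists2 c, c \in s & cball c (eta / 2) t].
have GS c s1 : G (c :: s1) = cball c (eta / 2) `|` G s1.
  apply/seteqP; split=> t.
    by move=> [c']; rewrite inE => /predU1P[->|h] Fe; [left|right; exists c'].
  move=> [h|[c' h1 h2]]; first by exists c => //; rewrite mem_head.
  by exists c' => //; rewrite inE h1 orbT.
have mB c := cball_measurable c (ltW e20).
have mG s1 : measurable (G s1 : set (k.-tuple T)).
  elim: s1 => [|c s1 IH].
    by rewrite (_ : G _ = set0)//; apply/seteqP; split=> t // [].
  by rewrite GS; apply: measurableU => //; exact: mB.
have lower : (((size s)%:R * (eta / 2) ^+ k * v)%:E <= lebesgue_tuple (G s))%E.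
  elim: s ss {sq} => [|c s1 IH] /=; first by move=> _; rewrite !mul0r lebesgue_tuple_ge0.
  move=> [h1 h2]; rewrite GS -muE; last by apply: measurableU; [exact: mB|exact: mG].
  have -> : mu (cball c (eta / 2) `|` G s1) = (mu (cball c (eta / 2)) + mu (G s1))%E.
    apply: measureU; [exact: mB|exact: mG|].
    apply/seteqP; split=> // t [/= tc [c' c's tc']]; apply: (h1 _ c's).
    rewrite -[_ - _](subrKA (f t)) (splitr eta); apply: mx_opnorm_add; last exact: tc'.
    by have := mx_opnorm_scale (-1) tc; rewrite scaleN1r opprB normcN normc1 mul1r.
  rewrite (muE _ (mB c)) (muE _ (mG s1)) cball_vol// vE -addn1 natrD mulrDl mulrDl.
  by rewrite mul1r EFinD addeC -EFinM leeD2l// IH.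
have q20 : 0 < q + eta / 2 by rewrite ltr_wpDl.
have upper : (lebesgue_tuple (G s) <= ((q + eta / 2) ^+ k * v)%:E)%E.
  rewrite EFinM -vE -(cball_vol z0 q20); apply: le_lebesgue_tuple => t [c cs tc].
  rewrite /cball /= f_z0 subr0 -[f t](subrK (f c)) addrC.
  by apply: mx_opnorm_add; [exact: sq|exact: tc].
have := le_trans lower upper; rewrite lee_fin ler_pM2r// => h.
have -> : 1 + 2 * q / eta = (q + eta / 2) / (eta / 2).
  by field; rewrite gt_eqF.
by rewrite expr_div_n ler_pdivlMr ?exprn_gt0.
Qed.

(** A separated set of maximal size is a net; [separated_size] bounds the sizes, so a maximum
    exists. *)
Lemma net_ex eta q : 0 < eta -> 0 <= q -> exists s : seq (k.-tuple R),
  [/\ (size s)%:R <= (1 + 2 * q / eta) ^+ k,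
      forall c, c \in s -> mx_opnorm_le (f c) q &
      forall t, mx_opnorm_le (f t) q -> exists2 c, c \in s & mx_opnorm_le (f t - f c) eta].
Proof.
move=> e0 q0.
pose P N := exists s, [/\ size s = N, separated eta s &
  forall c, c \in s -> mx_opnorm_le (f c) q].
have P0 : exists N, `[< P N >] by exists 0%N; apply/asboolP; exists [::].
have Pb N : `[< P N >] -> (N <= Num.bound ((1 + 2 * q / eta) ^+ k))%N.
  move=> /asboolP[s [<- ss sq]]; rewrite -(ler_nat R).
  apply: le_trans (separated_size e0 q0 ss sq) _; apply/ltW.
  by apply: le_lt_trans (archi_boundP _); rewrite ?exprn_ge0// addr_ge0// divr_ge0 ?mulr_ge0// ltW.
case: (ex_maxnP P0 Pb) => N /asboolP[s [sN ss sq]] hN.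
exists s; split=> //; first exact: (separated_size e0 q0 ss sq).
move=> t tq; apply: contrapT => h.
have /hN : `[< P N.+1 >].
  apply/asboolP; exists (t :: s); split; first by rewrite /= sN.
    by split=> // c cs tc; apply: h; exists c.
  by move=> c; rewrite inE => /predU1P[->|/sq].
by rewrite ltnn.
Qed.

End Packing.

(** * Nets of self-adjoint matrices with few outliers *)

Section OutlierNet.
Variables (R : realType) (n : nat).
Local Notation C := (R[i]).

Section Support.
Variable S : {set 'I_n}.
Local Notation I0 := {x : 'I_n * 'I_n * bool | x.1.1 \in S}.
Local Notation k := #|{: I0}|.

(** The boolean selects the real ([false]) or imaginary ([true]) part of an entry. Only rows in [S]
    carry coordinates, 2 n #|S| in number, which keeps the nets small. *)
Definition scoord (t : k.-tuple R) (x : 'I_n * 'I_n * bool) : R :=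
  if insub x is Some y then tnth t (enum_rank (y : I0)) else 0.

Definition smx (t : k.-tuple R) : 'M[C]_n :=
  \matrix_(i, j) (scoord t (i, j, false) +i* scoord t (i, j, true))%C.

Lemma card_scoord : k = (#|S| * n * 2)%N.
Proof.
rewrite card_sig; transitivity #|finset.setX (finset.setX S [set: 'I_n]%SET) [set: bool]%SET|.
  by apply: eq_card => -[[i j] b]; rewrite !inE /= !andbT.
by rewrite !cardsX !cardsT card_ord card_bool.
Qed.

Lemma smx_affine s c t : smx (affine_tuple s c t) = s%:C%C *: smx t + smx c.
Proof.
apply/matrixP => i j; rewrite !mxE.
have h x : scoord (affine_tuple s c t) x = s * scoord t x + scoord c x.
  by rewrite /scoord; case: insub => [y|]; rewrite ?tnth_mktuple// mulr0 addr0.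
by rewrite !h; apply/eqP; rewrite eq_complex /=; apply/andP; split; apply/eqP; ring.
Qed.

Lemma smx_small t e : 0 <= e -> (forall i, `|tnth t i| <= e) ->
  mx_opnorm_le (smx t) (n%:R * n%:R * 2 * e).
Proof.
move=> e0 te; rewrite -mulrA; apply: mx_opnorm_entries; first by rewrite mulr_ge0.
have h x : `|scoord t x| <= e by rewrite /scoord; case: insub => [y|]; rewrite ?normr0.
move=> i j; rewrite mxE; apply: le_trans (normc_le_ReIm _) _ => /=.
by rewrite mulrDl mul1r lerD.
Qed.

Lemma smx_coord t r i : mx_opnorm_le (smx t) r -> `|tnth t i| <= r.
Proof.
have [[[[a b] c] aS] ->] : exists y : I0, i = enum_rank y by exists (enum_val i); rewrite enum_valK.
move=> /(normc_entry_le a b); rewrite mxE => h; apply: le_trans h.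
have sc : scoord t (a, b, c) = tnth t (enum_rank (exist _ (a, b, c) aS : I0)).
  rewrite /scoord; case: insubP => [y _ yE|]; last by rewrite /= aS.
  by congr (tnth t (enum_rank _)); exact: val_inj.
by rewrite -sc; case: (c); [have := normIm_le | have := normRe_le] => /(_ _ (_ +i* _)%C); exact.
Qed.

Lemma smx_surj (W : 'M[C]_n) : (forall i j, i \notin S -> W i j = 0) -> exists t, smx t = W.
Proof.
move=> WS; pose v (x : I0) := let: (i, j, b) := val x in
  if b then Im (W i j) else Re (W i j).
exists [tuple v (enum_val i) | i < k]; apply/matrixP => i j; rewrite mxE.
have h b : scoord [tuple v (enum_val i) | i < k] (i, j, b) = if b then Im (W i j) else Re (W i j).
  rewrite /scoord; case: insubP => [y _ yE|/= iS].
    by rewrite tnth_mktuple enum_rankK /v yE.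
  by rewrite WS//; case: b.
by rewrite !h; case: (W i j).
Qed.

End Support.

(** There are 3^n sign patterns. One with at most delta n outliers has a net in at most 2 delta n^2
    real dimensions; the others receive the empty net. *)
Lemma outlier_net q eta delta : 0 < q -> 0 < eta -> 0 <= delta ->
  exists s : seq 'M[C]_n, [/\ forall D, D \in s -> samx D,
   (size s)%:R <= 3 ^+ n * expR (2 * delta * ln (1 + 2 * q / eta) * n%:R ^+ 2) :> R &
   forall (sg : sgn3 n) W, mx_opnorm_le W q ->
     (forall i j, i \notin sgn_supp sg -> W i j = 0) ->
     n%:R^-1 * #|sgn_supp sg|%:R <= delta ->
     exists2 D, D \in s & mx_opnorm_le (signed_gram sg W - D) (2 * q * eta)].
Proof.
move=> q0 e0 d0.
have x1 : 1 < 1 + 2 * q / eta by rewrite ltrDl divr_gt0// mulr_gt0.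
have x0 : 0 < 1 + 2 * q / eta by apply: lt_trans x1.
set E := expR _.
have /choice[net hnet] (sg : sgn3 n) : exists s : seq 'M[C]_n,
    [/\ forall D, D \in s -> samx D, (size s)%:R <= E &
     n%:R^-1 * #|sgn_supp sg|%:R <= delta -> forall W, mx_opnorm_le W q ->
     (forall i j, i \notin sgn_supp sg -> W i j = 0) ->
     exists2 D, D \in s & mx_opnorm_le (signed_gram sg W - D) (2 * q * eta)].
  have [hd|hd] := leP (n%:R^-1 * #|sgn_supp sg|%:R) delta; last first.
    by exists [::]; split=> //; exact: expR_ge0.
  have L0 : 0 <= n%:R * n%:R * 2 :> R by rewrite !mulr_ge0.
  have [s [s1 s2 s3]] := net_ex L0 (@smx_affine (sgn_supp sg)) (@smx_small _)
    (@smx_coord _) e0 (ltW q0).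
  exists [seq signed_gram sg (smx c) | c <- s]; split.
  - by move=> _ /mapP[c _ ->]; exact: signed_gram_sa.
  - rewrite size_map; apply: le_trans s1 _; rewrite card_scoord.
    rewrite -[X in X ^+ _](lnK x0) -expRM_natr ler_expR mulrC.
    rewrite (_ : 2 * delta * _ * _ = (2 * delta * n%:R ^+ 2) * ln (1 + 2 * q / eta)); last by ring.
    rewrite ler_wpM2r ?ln_ge0 ?(ltW x1)// !natrM.
    have [n00|n0] := posnP n.
      have -> : (n%:R : R) = 0 by rewrite n00.
      by rewrite expr0n /= !mulr0 mul0r.
    have nR0 : 0 < n%:R :> R by rewrite ltr0n.
    rewrite (_ : 2 * delta * _ = (delta * n%:R) * n%:R * 2); last by ring.
    rewrite ler_pM2r// ler_pM2r//; move: hd.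
    by rewrite mulrC ler_pdivrMr.
  move=> _ W hW /smx_surj[t tW]; rewrite -tW in hW *; have [c cs hc] := s3 _ hW.
  exists (signed_gram sg (smx c)); first exact: map_f.
  by apply: signed_gram_dist hc; [exact: hW|exact: s2].
exists (flatten [seq net sg | sg <- enum {: sgn3 n}]); split.
- by move=> D /flattenP[_ /mapP[sg _ ->]]; have [h _ _] := hnet sg; exact: h.
- have -> : 3 ^+ n = #|{: sgn3 n}|%:R :> R.
    by rewrite card_ffun card_option card_bool card_ord natrX.
  rewrite cardE; elim: (enum _) => [|sg l IH] /=; first by rewrite mul0r.
  rewrite size_cat natrD -addn1 natrD mulrDl mul1r addrC lerD//.
  by have [_ h _] := hnet sg.
move=> sg W hW hS hd; have [_ _ h] := hnet sg.
have [D Ds hD] := h hd W hW hS; exists D => //.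
by apply/flattenP; exists (net sg) => //; apply: map_f; rewrite mem_enum.
Qed.

End OutlierNet.

(** * Comparison of the volumes for two operator norm cutoffs *)

Section Cutoff.
Variables (R : realType).
Local Notation C := (R[i]).

Lemma fin_lower_bound (J : finType) (f : J -> R) : (forall j, 0 < f j) ->
  exists2 e, 0 < e & forall j, e <= f j.
Proof.
move=> f0; have s0 : 0 <= \sum_j (f j)^-1 by apply: sumr_ge0 => j _; rewrite invr_ge0 ltW.
exists (1 + \sum_j (f j)^-1)^-1; first by rewrite invr_gt0 ltr_pwDl.
move=> j; rewrite -[leRHS]invrK lef_pV2 ?posrE ?invr_gt0 ?ltr_pwDl//.
rewrite (bigD1 j)//= addrCA lerDl addr_ge0// sumr_ge0// => i _.
by rewrite invr_ge0 ltW.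
Qed.

Lemma mev_lipschitz_seq (J0 : choiceType) (G : seq (ncpoly R J0)) (K : J0 -> R) :
  (forall k, 0 <= K k) -> exists2 L, 0 <= L &
  forall n (Z Z' : J0 -> 'M[C]_n) d p, 0 <= d -> (forall k, mx_opnorm_le (Z k) (K k)) ->
    (forall k, mx_opnorm_le (Z' k) (K k)) -> (forall k, hsn (Z k - Z' k) <= d) ->
    p \in G -> hsn (mev Z p - mev Z' p) <= L * d.
Proof.
move=> K0; elim: G => [|p G [L L0 IH]].
  by exists 0; [exact: lexx|move=> n Z Z' d p _ _ _ _; rewrite in_nil].
have [L' L'0 hL'] := mev_lipschitz p K0; exists (L + L'); first exact: addr_ge0.
move=> n Z Z' d q d0 hZ hZ' hd; rewrite mulrDl inE => /predU1P[->|qG].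
  apply: le_trans (hL' n Z Z' d d0 hZ hZ' hd) _.
  by rewrite lerDr mulr_ge0.
apply: le_trans (IH n Z Z' d q d0 hZ hZ' hd qG) _.
by rewrite lerDl mulr_ge0.
Qed.

Lemma mx_law_moment (J0 : choiceType) n (Z : J0 -> 'M[C]_n) i k :
  mx_law Z (mon 1 (nseq k i)) = ntr (mpow (Z i) k).
Proof.
rewrite mx_lawE /mev ev_mon scale1r; congr ntr.
by elim: k => //= k ->.
Qed.

Lemma nu_affine_measurable m n s D (S : set ('I_m -> 'M[C]_n)) :
  (forall k, samx (D k)) -> nu_measurable S ->
  nu_measurable [set A | S (fun k => s%:C%C *: A k + D k)].
Proof.
move=> saD mS; have [c cD] := coord_surj saD.
rewrite /nu_measurable (_ : _ @^-1` _ = affine_tuple s c @^-1` (@tuple_of_coord R m n @^-1` S)).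
  by rewrite -[X in measurable X]setTI; exact: measurable_affine.
apply/seteqP; split=> t /=; congr S; apply/funext => k; by rewrite coord_affine cD.
Qed.

Lemma nu_affine_inv m n s D (S : set ('I_m -> 'M[C]_n)) : 0 < s ->
  (forall k, samx (D k)) -> nu_measurable S ->
  (nu ([set A | S (fun k => s%:C%C *: A k + D k)%R]) = ((s^-1 ^+ (m * (n * n)))%:E * nu S))%E.
Proof.
move=> s0 saD mS; rewrite -(nu_affine s0 saD mS) muleA -EFinM -exprMn mulVf ?gt_eqF//.
by rewrite expr1n mul1e.
Qed.

(** The factor 2 in the moment bound is the slack left by closeness of laws, so the proportion of
    outliers beyond r (1 + kappa) is at most 2 / (1 + kappa)^(2k). The square root of q appears
    because W carries square roots of eigenvalues. *)
Lemma cutoff_matrix n (A : 'M[C]_n) (s : seq 'M[C]_n) q r kappa delta eta k :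
  0 < q -> 0 < r -> 0 < kappa -> 0 <= delta -> 2 * Num.sqrt q * eta = kappa * r ->
  (forall (sg : sgn3 n) W, mx_opnorm_le W (Num.sqrt q) ->
     (forall i j, i \notin sgn_supp sg -> W i j = 0) ->
     n%:R^-1 * #|sgn_supp sg|%:R <= delta ->
     exists2 D, D \in s & mx_opnorm_le (signed_gram sg W - D) (2 * Num.sqrt q * eta)) ->
  samx A -> mx_opnorm_le A q -> Re (ntr (mpow A (2 * k))) <= 2 * r ^+ (2 * k) ->
  2 * ((1 + kappa) ^+ (2 * k))^-1 <= delta ->
  exists D, [/\ D \in s, mx_opnorm_le (A - D) (r * (1 + 2 * kappa)) &
    hsn D <= q * Num.sqrt delta + kappa * r].
Proof.
move=> q0 r0 k0 d0 He hs saA hA hmom hk.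
have sq : Num.sqrt q ^+ 2 = q by rewrite sqr_sqrtr// ltW.
have s0 : 0 < r * (1 + kappa) by rewrite mulr_gt0// addr_gt0.
rewrite -sq in hA; have [sg [W [hW hWS h1 h2 h3]]] := outlier_part saA hA (sqrtr_ge0 _) s0.
have hd : n%:R^-1 * #|sgn_supp sg|%:R <= delta.
  apply: le_trans (h3 _ _ hmom) _; apply: le_trans hk.
  rewrite exprMn; have a0 : r ^+ (2 * k) != 0 by rewrite expf_neq0// gt_eqF.
  move: (r ^+ _) a0 => a a0.
  by rewrite [2 * a]mulrC -mulf_div divff// mul1r.
have [D Ds hD] := hs sg W hW hWS hd; rewrite He in hD.
exists D; split=> //.
  rewrite -[A - D](subrKA (signed_gram sg W)).
  rewrite (_ : r * (1 + 2 * kappa) = r * (1 + kappa) + kappa * r); last by ring.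
  exact: mx_opnorm_add.
apply: (@le_trans _ _ (hsn (signed_gram sg W) + hsn (D - signed_gram sg W))).
  by rewrite -[X in hsn X <= _](subrK (signed_gram sg W)) addrC; exact: hsnD.
rewrite lerD//; last by rewrite hsnB; exact: hsn_le_op.
rewrite -(@ler_pXn2r _ 2) ?nnegrE ?hsn_ge0// ?mulr_ge0 ?sqrtr_ge0// ?(ltW q0)//.
apply: le_trans h2 _; rewrite exprMn sqr_sqrtr// (_ : 4 = 2 * 2)%N// exprM sq.
by rewrite ler_wpM2l ?sqr_ge0.
Qed.

Variables (m : nat) (l : ncpoly R ('I_m + nat)%type -> C) (r q : 'I_m -> R) (K : nat -> R).
Hypothesis ll : is_law l.
Hypotheses (r0 : forall j, 0 < r j) (q0 : forall j, 0 < q j) (K0 : forall j, 0 < K j).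
Hypothesis l_moment : forall j k, Re (l (mon 1 (nseq (2 * k) (inl j)))) <= r j ^+ (2 * k).

(* Each A splits as D + (A - D) with D in a net of exp(o(n^2)) low rank matrices
   and A - D of norm at most r (1 + 2 kappa); then translate, rescale and sum. *)
Lemma cutoff O eps : law_nbhd l O -> 0 < eps ->
  exists2 O', law_nbhd l O' & exists N, forall n, (N <= n)%N -> forall Z : nat -> 'M[C]_n,
    (forall j, samx (Z j)) -> (forall j, mx_opnorm_le (Z j) (K j)) ->
    (nu (microstates q Z O') <=
     (expR (eps * n%:R ^+ 2))%:E * nu (microstates r Z O))%E.
Proof.
move=> /law_nbhd_words[ws [e [e0]]]; set G := [seq _ | w <- ws] => hG eps0.
pose Kb := join (fun j => q j + r j) K.
have Kb0 k : 0 <= Kb k.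
  by case: k => [j|j] /=; [have := q0 j; have := r0 j; lra|exact: ltW].
have [L L0 hL] := mev_lipschitz_seq G Kb0.
have L1 : 0 < L + 1 by rewrite ltr_wpDl.
(* A change of the matrices by d in 2-norm moves the laws tested by G by at most e/2. *)
pose d := e / 2 / (L + 1).
have d0 : 0 < d by rewrite !divr_gt0.
have Ld : L * d <= e / 2.
  rewrite /d mulrCA -[leRHS]mulr1 ler_wpM2l ?divr_ge0 ?(ltW e0)//.
  by rewrite ler_pdivrMr// mul1r lerDl.
pose B := 1 + \sum_j (q j + r j).
have qrB j : q j + r j <= B.
  rewrite /B (bigD1 j)//= addrCA lerDl addr_ge0// sumr_ge0// => i _.
  by have := q0 i; have := r0 i; lra.
have B0 : 0 < B.
  by rewrite ltr_pwDl// sumr_ge0// => i _; have := q0 i; have := r0 i; lra.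
(* The first bound keeps the part of the 2-norm change due to kappa below d/2. The second keeps the
   dilation factor (1 + 2 kappa)^(m n^2) below exp(eps n^2 / 3). *)
pose kappa := Num.min (d / (6 * B)) (eps / 3 / (2 * m%:R + 1)).
have m1 : 0 < 2 * m%:R + 1 :> R by rewrite ltr_wpDl// mulr_ge0.
have k0 : 0 < kappa by rewrite lt_min !divr_gt0// mulr_gt0.
have kB : kappa * (6 * B) <= d.
  by rewrite -ler_pdivlMr ?mulr_gt0// ge_min lexx.
have km : 2 * m%:R * kappa <= eps / 3.
  apply: le_trans (_ : (2 * m%:R + 1) * kappa <= _).
    by rewrite ler_wpM2r ?(ltW k0)// lerDl.
  by rewrite mulrC -ler_pdivlMr// ge_min lexx orbT.
pose eta j := kappa * r j / (2 * Num.sqrt (q j)).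
have sq0 j : 0 < Num.sqrt (q j) by rewrite sqrtr_gt0.
have eta0 j : 0 < eta j by rewrite divr_gt0 ?mulr_gt0.
have etaE j : 2 * Num.sqrt (q j) * eta j = kappa * r j.
  by rewrite /eta mulrC divfK// gt_eqF// mulr_gt0.
pose lam j := ln (1 + 2 * Num.sqrt (q j) / eta j).
have lam0 j : 0 <= lam j.
  by rewrite ln_ge0// lerDl divr_ge0 ?mulr_ge0// ltW.
pose Lam := 1 + \sum_j lam j.
have lamL j : lam j <= Lam.
  by rewrite /Lam (bigD1 j)//= addrCA lerDl addr_ge0// sumr_ge0.
have Lam0 : 0 < Lam by rewrite ltr_pwDl// sumr_ge0.
(* Likewise, the outliers change the 2-norm by at most d/2, and the nets contribute at most exp(2 m
   delta Lam n^2) <= exp(eps n^2 / 3). *)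
pose delta := Num.min ((d / (2 * B)) ^+ 2) (eps / 3 / ((2 * m%:R + 1) * Lam)).
have delta0 : 0 < delta by rewrite lt_min exprn_gt0 !divr_gt0// mulr_gt0.
have dB : Num.sqrt delta * (2 * B) <= d.
  rewrite -ler_pdivlMr ?mulr_gt0//.
  apply: le_trans (_ : Num.sqrt ((d / (2 * B)) ^+ 2) <= _).
    by apply: ler_wsqrtr; rewrite ge_min lexx.
  by rewrite sqrtr_sqr ger0_norm// divr_ge0 ?(ltW d0)// mulr_ge0// ltW.
have dm : 2 * m%:R * (delta * Lam) <= eps / 3.
  apply: le_trans (_ : (2 * m%:R + 1) * (delta * Lam) <= _).
    by rewrite ler_wpM2r ?mulr_ge0 ?(ltW delta0) ?(ltW Lam0)// lerDl.
  rewrite mulrCA -ler_pdivlMr; last by rewrite mulr_gt0.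
  by rewrite ge_min lexx orbT.
have [k hk] : exists k, 2 * ((1 + kappa) ^+ (2 * k))^-1 <= delta.
  have x0 : 0 <= ((1 + kappa) ^+ 2)^-1 by rewrite invr_ge0 sqr_ge0.
  have x1 : ((1 + kappa) ^+ 2)^-1 < 1.
    by rewrite invf_lt1 ?exprn_gt0 ?addr_gt0// expr2; have := mulr_gt0 k0 k0; lra.
  have [J hJ] := expr_small x0 x1 (divr_gt0 delta0 (ltr0Sn R 1)).
  by exists J; rewrite exprM -exprVn mulrC -ler_pdivlMr.
(* Closeness e1 keeps each tested moment below twice r^(2k). *)
have [e1 e10 he1] := fin_lower_bound (fun j => exprn_gt0 (2 * k) (r0 j)).
pose e' := Num.min (e / 2) e1.
have e'e1 : e' <= e1 by rewrite ge_min lexx orbT.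
have e'e : e' <= e / 2 by rewrite ge_min lexx.
have e'0 : 0 < e' by rewrite lt_min e10 divr_gt0.
exists (close_laws l (G ++ [seq mon 1 (nseq (2 * k) (inl j)) | j <- enum 'I_m]) e').
  exact: close_laws_nbhd.
(* The last third of eps absorbs the 3^(m n) sign patterns, since 3 <= exp 2. *)
have [N hN] : exists N, forall n, (N <= n)%N -> (0 < n)%N /\ 2 * m%:R <= eps / 3 * n%:R.
  exists (Num.bound (2 * m%:R / (eps / 3))).+1 => n Nn; split; first exact: leq_trans Nn.
  rewrite [leRHS]mulrC -ler_pdivrMr ?divr_gt0//; apply: ltW.
  apply: lt_le_trans (archi_boundP _) _; first by rewrite !divr_ge0// ?mulr_ge0// ltW.
  by rewrite ler_nat; exact: ltnW.
exists N => n /hN[n0 mn] Z saZ ZK.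
have /choice[net hnet] j := outlier_net n (sq0 j) (eta0 j) (ltW delta0).
(* M gives nets of different sizes a common index set; an index out of range selects the matrix 0,
   which is again self-adjoint. *)
pose M := \max_j size (net j).
pose E := {ffun 'I_m -> 'I_M}.
pose Dm (f : E) j : 'M[C]_n := nth 0 (net j) (f j).
pose c := (1 + 2 * kappa)^-1.
have c1 : 0 < 1 + 2 * kappa by rewrite addr_gt0// mulr_gt0.
have c0 : 0 < c by rewrite invr_gt0.
pose T := [set A : 'I_m -> 'M[C]_n | forall j, mx_opnorm_le (A j) (r j)] `&`
  [set A | forall p, p \in G -> normc (mx_law (join A Z) p - l p) < e].
(* A belongs to F f when c (A - D) lies in T for the net elements D selected by f. These sets cover
   the microstates and are translated dilates of T. *)
pose F (f : E) := [set A | T (fun j => c%:C%C *: A j + - (c%:C%C *: Dm f j))].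
have saD f j : samx (Dm f j).
  rewrite /Dm; have [h|h] := ltnP (f j) (size (net j)).
    by have [hsa _ _] := hnet j; apply: hsa; exact: mem_nth.
  by rewrite nth_default// /samx; apply/matrixP => i i'; rewrite adjmxE !mxE [LHS]conjc0.
have saD' f j : samx (- (c%:C%C *: Dm f j)).
  rewrite /samx adjmxN adjmxZ saD; congr (- (_ *: _)); rewrite conjE.
  by apply/eqP; rewrite eq_complex /= oppr0 !eqxx.
have mT1 : nu_measurable [set A : 'I_m -> 'M[C]_n | forall j, mx_opnorm_le (A j) (r j)].
  by apply: opball_measurable => j; exact: ltW.
have mT2 : nu_measurable [set A : 'I_m -> 'M[C]_n |
    forall p, p \in G -> normc (mx_law (join A Z) p - l p) < e].
  by apply: mx_open_measurable; exact: mx_law_open.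
have mT : nu_measurable T by apply: measurableI; [exact: mT1|exact: mT2].
have nuF f : nu (F f) = (((1 + 2 * kappa) ^+ (m * (n * n)))%:E * nu T)%E.
  by rewrite -[1 + 2 * kappa]invrK; exact: (nu_affine_inv c0 (saD' f) mT).
have nuF_le f : (nu (F f) <= ((1 + 2 * kappa) ^+ (m * (n * n)))%:E * nu T)%E.
  exact: (eq_ind_r (fun v => (v <= _)%E) (lexx _) (nuF f)).
have nuT : (nu T <= nu (microstates r Z O))%E.
  apply: le_lebesgue_tuple => t [hT1 hT2]; split=> [j|j|]; [exact: sa_of_coord_sa|exact: hT1|].
  apply: hG; split; last exact: hT2.
  apply: (@mx_law_is_law _ _ _ _ (join r K)) => //.
  - by move=> [j|j] /=; [exact: sa_of_coord_sa|exact: saZ].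
  - by move=> [j|j] /=; [exact: r0|exact: K0].
  - by move=> [j|j] /=; [exact: hT1|exact: ZK].
have cover A : microstates q Z (close_laws l (G ++ [seq mon 1 (nseq (2 * k) (inl j)) | j <- enum 'I_m]) e') A ->
  exists2 f, f \in enum {: E} & F f A.
  move=> [saA Aq [lA hA]].
  have /choice[D hD] j : exists D, [/\ D \in net j,
      mx_opnorm_le (A j - D) (r j * (1 + 2 * kappa)) &
      hsn D <= q j * Num.sqrt delta + kappa * r j].
    have [_ _ hn] := hnet j.
    apply: (cutoff_matrix (q0 j) (r0 j) k0 (ltW delta0) (etaE j) hn (saA j) (Aq j) _ hk).
    have /hA : mon 1 (nseq (2 * k) (inl j)) \in
        G ++ [seq mon 1 (nseq (2 * k) (inl j)) | j <- enum 'I_m].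
      by rewrite mem_cat; apply/orP; right; apply: map_f; rewrite mem_enum.
    rewrite mx_law_moment => h.
    have := lt_le_trans (le_lt_trans (Re_le_normc _) h) (le_trans e'e1 (he1 j)).
    rewrite ReB; move: (l_moment j k); rewrite -/(C) mulr_natl mulr2n => h1 h2.
    by rewrite -lerBlDr; apply: le_trans (ltW h2); rewrite lerD2l lerN2.
  have ltM j : (index (D j) (net j) < M)%N.
    apply: (@leq_trans (size (net j))); first by rewrite index_mem; case: (hD j).
    exact: (leq_bigmax j).
  exists [ffun j => Ordinal (ltM j)]; first by rewrite mem_enum.
  have DE j : Dm [ffun j => Ordinal (ltM j)] j = D j.
    by rewrite /Dm ffunE /= nth_index//; case: (hD j).
  rewrite /F /=; set A' := (fun j => _); have A'E j : A' j = c%:C%C *: (A j - D j).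
    by rewrite /A' DE scalerBr.
  have A'r j : mx_opnorm_le (A' j) (r j).
    rewrite A'E; have [_ h _] := hD j; have := mx_opnorm_scale c%:C%C h.
    by rewrite normcR ger0_norm ?(ltW c0)// mulrCA mulVf ?mulr1// gt_eqF.
  split=> // p pG.
  (* D is small in 2-norm although not in operator norm, and 1 - c <= 2 kappa. *)
  have hd j : hsn (A' j - A j) <= d.
    have -> : A' j - A j = - (c%:C%C *: D j) - (1 - c)%:C%C *: A j.
      rewrite A'E rmorphB rmorph1 scalerBl scale1r scalerBr opprB addrAC.
      exact: addrC.
    apply: le_trans (hsnD _ _) _; rewrite !hsnN !hsnZ !normcR.
    have cle1 : c <= 1 by rewrite invf_le1// lerDl mulr_ge0// ltW.
    have c1k : 1 - c <= 2 * kappa.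
      have -> : 1 - c = 2 * kappa * c by rewrite /c; field; rewrite gt_eqF.
      by rewrite ler_piMr// mulr_ge0// ltW.
    rewrite (ger0_norm (ltW c0)) ger0_norm ?subr_ge0//.
    have [_ _ hDj] := hD j.
    have h1 : c * hsn (D j) <= B * Num.sqrt delta + kappa * B.
      apply: (@le_trans _ _ (hsn (D j))); first by rewrite ler_piMl// hsn_ge0.
      apply: le_trans hDj _; rewrite lerD//.
        by rewrite ler_wpM2r ?sqrtr_ge0//; apply: le_trans (qrB j); rewrite lerDl ltW.
      by rewrite ler_wpM2l ?(ltW k0)//; apply: le_trans (qrB j); rewrite lerDr ltW.
    have h2 : (1 - c) * hsn (A j) <= 2 * kappa * B.
      apply: ler_pM; rewrite ?subr_ge0 ?hsn_ge0//.
      by apply: le_trans (hsn_le_op (Aq j)) _; apply: le_trans (qrB j); rewrite lerDl ltW.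
    by clear - h1 h2 dB kB; lra.
  have h1 : hsn (mev (join A' Z) p - mev (join A Z) p) <= L * d.
    apply: hL => //; first exact: ltW.
    - move=> [j|j] /=; last exact: ZK.
      by apply: mx_opnorm_trans (A'r j); rewrite lerDr ltW.
    - move=> [j|j] /=; last exact: ZK.
      by apply: mx_opnorm_trans (Aq j); rewrite lerDl ltW.
    - by move=> [j|j] //=; rewrite subrr hsn0 ltW.
  have /hA : p \in G ++ [seq mon 1 (nseq (2 * k) (inl j)) | j <- enum 'I_m].
    by rewrite mem_cat pG.
  move=> h2; have h3 := le_trans (mx_law_dist (join A' Z) (join A Z) p) h1.
  have h4 := lt_le_trans h2 e'e.
  rewrite -[_ - _](subrKA (mx_law (join A Z) p)); apply: le_lt_trans (le_normcD _ _) _.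
  by rewrite [ltRHS]splitr; apply: ler_ltD h4; exact: le_trans h3 Ld.
have mF f : nu_measurable (F f) by apply: nu_affine_measurable => // j; exact: saD'.
apply: le_trans (nu_union mF nuF_le cover) _.
rewrite muleA -EFinM; apply: lee_pmul => //.
- by rewrite lee_fin mulr_ge0// exprn_ge0// ltW.
- exact: nu_ge0.
rewrite lee_fin -cardE card_ffun !card_ord natrX.
pose b := expR (2 * n%:R + 2 * (delta * Lam) * n%:R ^+ 2).
have Mb : M%:R <= b.
  rewrite /M; elim/big_ind: _ => [|x y hx hy|j _]; first exact: expR_ge0.
    by case: (leqP x y) => _.
  have [_ hj _] := hnet j; apply: le_trans hj _; rewrite /b expRD.
  apply: ler_pM; rewrite ?exprn_ge0 ?expR_ge0//.
    rewrite mulrC expRM_natl lerXn2r ?nnegrE ?expR_ge0//.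
    by apply: le_trans (expR_ge1Dx 2); rewrite -natr1 addrC.
  rewrite ler_expR ler_wpM2r ?sqr_ge0// -mulrA ler_wpM2l//.
  by apply: ler_wpM2l; [exact: ltW|exact: lamL].
apply: (@le_trans _ _ (b ^+ m * expR (2 * kappa) ^+ (m * (n * n)))).
  apply: ler_pM; rewrite ?exprn_ge0 ?(ltW c1)//.
    by rewrite lerXn2r ?nnegrE ?expR_ge0.
  by rewrite lerXn2r ?nnegrE ?expR_ge0 ?(ltW c1)//; exact: expR_ge1Dx.
rewrite -!expRM_natr -expRD ler_expR !natrM.
have nR0 : 0 <= n%:R ^+ 2 :> R by rewrite sqr_ge0.
have := ler_wpM2r nR0 dm; have := ler_wpM2r nR0 km.
have := ler_wpM2r (ler0n R n) mn; rewrite -expr2 in nR0 *.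
by rewrite !expr2; lra.
Qed.

End Cutoff.

(** * Comparison of the two entropies *)

Section EntropyOfEmbeddings.
Variables (R : realType) (H : hilbert R) (M : set (H -> H)).
Variables (tau : (H -> H) -> R[i]).
Hypothesis hM : tracial_vna M tau.
Variables (m : nat) (X : 'I_m -> H -> H) (Y : nat -> H -> H).
Hypothesis hX : forall j, M (X j) /\ sa_op (X j).
Hypothesis hY : forall j, M (Y j) /\ sa_op (Y j).
Local Notation C := (R[i]).
Local Notation B := (Wstar Y).
Local Notation l := (op_law tau (join X Y)).

Let MY j : M (Y j). Proof. by case: (hY j). Qed.
Let saY j : sa_op (Y j). Proof. by case: (hY j). Qed.
Let BM T : B T -> M T. Proof. exact: (Wstar_M hM MY). Qed.
Let MXY k : M (join X Y k). Proof. by case: k => j /=; [case: (hX j)|]. Qed.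
Let saXY k : sa_op (join X Y k). Proof. by case: k => j /=; [case: (hX j)|]. Qed.

Lemma op_moment (J0 : choiceType) (V : J0 -> H -> H) i s k : (forall j, M (V j)) ->
  opnorm_le (V i) s -> Re (op_law tau V (mon 1 (nseq k i))) <= s ^+ k.
Proof.
move=> MV hs; apply: le_trans (Re_le_normc _) _; rewrite op_lawE.
apply: (normc_tau_op hM (M_ev hM MV _)).
rewrite (_ : ev V _ = wev V (nseq k i)); last by apply/funext => v; rewrite ev_mon scale1r.
elim: k => [|k IH]; first exact: opnorm_id.
by rewrite exprS; exact: opnorm_comp.
Qed.

Section Embedding.
Variables (U : set_system nat) (iota : (H -> H) -> set (mxseq R)).
Hypothesis hU : nonprincipal_ultrafilter U.
Hypothesis hiota : embedding U tau B iota.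
#[local] Instance ultra_instance3 : ProperFilter U := ultra_pf hU.

(** Averaging a representative with its adjoint gives self-adjoint matrices in the same class,
    because Y_j is self-adjoint. *)
Lemma sa_lift_ex : exists Yn, is_lift U iota Y Yn.
Proof.
have h j : exists b : mxseq R, [/\ forall n, samx (b n), bounded_mxseq b & iota (Y j) = ucoset U b].
  have BY : B (Y j) by exact: Wstar_gen.
  have [a ba ia] := emb_in hiota BY.
  have aY : iota (Y j) a by rewrite ia; exact: ucoset_refl.
  have aY' := emb_adjoint hiota BY BY (@saY j) aY.
  have bY : iota (Y j) (fun n => (2^-1 : C) *: (a n + adjmx (a n))).
    have := emb_scale hiota (2^-1) (Wstar_add BY BY) (emb_add hiota BY BY aY aY').
    congr iota; apply/funext => v.
    rewrite -[LHS]/((2^-1 : C) *: (Y j v + Y j v)) -[Y j v + Y j v]mulr2n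
      -[Y j v *+ 2]scaler_nat scalerA.
    by rewrite mulVf ?scale1r// pnatr_eq0.
  have bb := bY; rewrite ia in bb.
  exists (fun n => (2^-1 : C) *: (a n + adjmx (a n))); split.
  - move=> n; rewrite /samx adjmxZ adjmxD adjmxK addrC; congr (_ *: _).
    by rewrite fmorphV rmorph_nat.
  - by case/(ucosetP hU): bb.
  - by rewrite ia; exact: (ucoset_eq hU ba bb).
have /choice[b hb] := h.
by exists (fun n j => b j n) => j; have [h1 h2 h3] := hb j.
Qed.

(** Clamping does not leave the class: the even moments of a lift converge to those of Y_j, which
    are at most r'^(2k), so eigenvalues beyond r' (1 + kappa) become rare. *)
Lemma clamped_lift_ex (r' : nat -> R) : (forall j, 0 < r' j) ->
  (forall j, opnorm_le (Y j) (r' j)) ->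
  exists2 Yn, is_lift U iota Y Yn & forall n j, mx_opnorm_le (Yn n j) (r' j).
Proof.
move=> r0 Yr; have [Yn lY] := sa_lift_ex.
have /choice[K hK] j : exists K, forall n, mx_opnorm_le (Yn n j) K by have [_ [K hK] _] := lY j; exists K.
have saYn n j : samx (Yn n j) by have [h _ _] := lY j.
have h n j := clamp_ex (saYn n j) (hK j n) (r0 j).
pose Zn n j := projT1 (cid2 (h n j)).
have saZ n j : samx (Zn n j) by rewrite /Zn; case: cid2 => ? [].
have Zr n j : mx_opnorm_le (Zn n j) (r' j) by rewrite /Zn; case: cid2 => ? [].
have ZY n j kappa k c : 0 < kappa -> Re (ntr (mpow (Yn n j) (2 * k))) <= c ->
      hsn (Yn n j - Zn n j) ^+ 2 <=
      (kappa * r' j) ^+ 2 + K j ^+ 2 * (c / (r' j * (1 + kappa)) ^+ (2 * k)).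
  by rewrite /Zn; case: cid2 => ? /= _; exact.
exists Zn; last exact: Zr.
move=> j; split; [move=> n; exact: saZ|by exists (r' j) => n|].
have [_ bY ->] := lY j; apply: (ucoset_eq hU bY); apply/(ucosetP hU).
split; first by exists (r' j) => n.
move=> e e0; have e2 : 0 < e ^+ 2 / 2 by rewrite divr_gt0 ?exprn_gt0.
(* Then kappa r' = e/2, so the eigenvalues inside contribute at most e^2/2; k makes the outliers
   contribute at most e^2/2. *)
pose kappa := e / (2 * r' j).
have k0 : 0 < kappa by rewrite divr_gt0 ?mulr_gt0.
have kr : (kappa * r' j) ^+ 2 <= e ^+ 2 / 2.
  have -> : kappa * r' j = e / 2 by rewrite /kappa invfM mulrA divfK ?gt_eqF.
  by rewrite expr_div_n ler_wpM2l ?sqr_ge0// lef_pV2 ?posrE// expr2; lra.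
have x0 : 0 <= ((1 + kappa) ^+ 2)^-1 by rewrite invr_ge0 sqr_ge0.
have x1 : ((1 + kappa) ^+ 2)^-1 < 1.
  by rewrite invf_lt1 ?exprn_gt0 ?addr_gt0// expr2; have := mulr_gt0 k0 k0; lra.
have K1 : 0 < 2 * K j ^+ 2 + 1 by rewrite ltr_wpDl// mulr_ge0// sqr_ge0.
have [k hk] := expr_small x0 x1 (divr_gt0 e2 K1).
have rk0 : 0 < r' j ^+ (2 * k) by rewrite exprn_gt0.
have [Bp ip] := emb_ev hU hiota (erefl _) lY (mon 1 (nseq (2 * k) j)).
have /(ucvgP hU)/(_ _ rk0) := emb_trace hiota Bp ip; apply: filterS => n /= hn.
have hmom : Re (ntr (mpow (Yn n j) (2 * k))) <= 2 * r' j ^+ (2 * k).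
  rewrite -mx_law_moment mx_lawE.
  have := op_moment (2 * k) MY (Yr j); rewrite op_lawE => h1.
  have := le_trans (Re_le_normc _) hn; rewrite ReB.
  by move: h1; set x := Re _; set y := Re _; lra.
rewrite hsnB -(@ler_pXn2r _ 2) ?nnegrE ?hsn_ge0 ?(ltW e0)//.
apply: le_trans (ZY n j kappa k _ k0 hmom) _.
rewrite [leRHS]splitr; apply: lerD kr _.
have -> : 2 * r' j ^+ (2 * k) / (r' j * (1 + kappa)) ^+ (2 * k) = 2 * ((1 + kappa) ^+ 2)^-1 ^+ k.
  rewrite exprMn exprVn -exprM [2 * _]mulrC -mulf_div divff ?mul1r//.
  by rewrite gt_eqF.
apply: le_trans (_ : (2 * K j ^+ 2 + 1) * ((1 + kappa) ^+ 2)^-1 ^+ k <= _).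
  by rewrite mulrA (mulrC (K j ^+ 2)) ler_wpM2r ?exprn_ge0// lerDl.
by rewrite mulrC -ler_pdivlMr.
Qed.

Lemma chi_lift_le W W' Wn Wn' : (forall j, sa_op (W j)) ->
  Wstar W = B -> Wstar W' = B -> is_lift U iota W Wn -> is_lift U iota W' Wn' ->
  (chi_lift (op_law tau (join X W)) U Wn <= chi_lift (op_law tau (join X W')) U Wn')%E.
Proof.
move=> sW BW BW' lW lW'; apply: ge_ereal_sup => _ [q q0 <-].
apply: le_trans; last by apply: ereal_sup_ubound; exists q.
apply: le_ereal_inf_tmp => _ [V hV <-].
have [V' hV' hsub] := microstates_lift_sub hM hX hU hiota sW BW BW' BM lW lW' q0 hV.
apply: (@le_trans _ _ (lim ((fun n => normalized_log m n
  (nu (microstates q (Wn n) V'))) @ U))).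
  by apply: ereal_inf_lbound; exists V'.
rewrite -[leRHS]adde0; apply: lim_ultra_mono => //.
apply: filterS2 hsub (ultra_ge hU 1) => n /= h n0; rewrite adde0.
by apply: normalized_log_mono => //; [exact: nu_ge0|exact: le_nu].
Qed.

(** [xget] chooses from a set with one value: [chi_lift_le], used in both directions, equates the
    values of any two generating tuples and lifts. *)
Lemma chi_embE Yn : is_lift U iota Y Yn -> chi_emb tau X B U iota = chi_lift l U Yn.
Proof.
move=> lY; rewrite /chi_emb; apply: xget_subset1.
  exists Y, Yn; split=> // j; split; first exact: saY.
  by apply: (vn_bounded (tvna_vn hM)).
move=> _ _ [W [Wn [hW BW lW ->]]] [W' [Wn' [hW' BW' lW' ->]]].
by apply/eqP; rewrite eq_le; apply/andP; split; apply: chi_lift_le => // j;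
  [case: (hW j)|case: (hW' j)].
Qed.

End Embedding.

Variables (r : 'I_m -> R) (r' : nat -> R).
Hypothesis hr : norm_bounds X Y r r'.

Let r0 j : 0 < r j. Proof. by case: hr. Qed.
Let r'0 j : 0 < r' j. Proof. by case: hr. Qed.
Let Xr j : opnorm_le (X j) (r j). Proof. by case: hr. Qed.
Let Yr j : opnorm_le (Y j) (r' j). Proof. by case: hr. Qed.

Lemma law_is_law : is_law l.
Proof.
by apply: (op_law_is_law hM MXY saXY (K := join r r')) => -[j|j] /=.
Qed.

Lemma mx_law_snd n (A : 'I_m -> 'M[C]_n) (Z : nat -> 'M[C]_n) :
  law_snd (mx_law (join A Z)) = mx_law Z.
Proof.
by apply/funext => p; rewrite law_sndE !mx_lawE /mev ev_ncsnd.
Qed.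

(** If a microstate A exists, the law of (A, Z) witnesses that the law of Z lies in the projection
    of O. Otherwise the volume is 0, which [sup_nu] includes. *)
Lemma nu_microstates_le n (Z : nat -> 'M[C]_n) O : (forall j, samx (Z j)) ->
  (forall j, mx_opnorm_le (Z j) (r' j)) ->
  (nu (microstates r Z O) <= sup_nu n r r' O)%E.
Proof.
move=> saZ Zr; have [[A hA]|h] := pselect (exists A, microstates r Z O A).
  apply: ereal_sup_ubound; right; exists Z => //; split=> //.
  by exists (mx_law (join A Z)); [case: hA|exact: mx_law_snd].
rewrite (_ : nu _ = 0%E); first by apply: ereal_sup_ubound; left.
have [mu _ muE] := lebesgue_tuple_measure R (m * (n * n)).
rewrite /nu (_ : _ @^-1` _ = set0); last first.
  by apply/seteqP; split=> t // ht; apply: h; exists (tuple_of_coord t).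
by rewrite -(muE _ measurable0) measure0.
Qed.

Lemma chi_lift_le_cutoff U Yn : nonprincipal_ultrafilter U ->
  (forall n j, samx (Yn n j)) -> (forall n j, mx_opnorm_le (Yn n j) (r' j)) ->
  (chi_lift l U Yn <= chi_cutoff l r r')%E.
Proof.
move=> hU saYn Ynr; apply: ge_ereal_sup => _ [q q0 <-].
apply: le_ereal_inf_tmp => _ [V hV <-].
apply/lee_addgt0Pr => eps eps0.
have mom j k : Re (l (mon 1 (nseq (2 * k) (inl j)))) <= r j ^+ (2 * k).
  exact: (op_moment (2 * k) MXY (Xr j : opnorm_le (join X Y (inl j)) (r j))).
have [V' hV' [N hN]] := cutoff law_is_law r0 q0 r'0 mom hV eps0.
apply: (@le_trans _ _ (lim ((fun n => normalized_log m n
  (nu (microstates q (Yn n) V'))) @ U))).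
  by apply: ereal_inf_lbound; exists V'.
apply: le_trans (_ : (lim ((fun n => normalized_log m n (sup_nu n r r' V)) @ U) +
    eps%:E <= _)%E); last by rewrite leeD2r// lim_ultra_limn_esup.
pose instU : ProperFilter U := ultra_pf hU.
apply: lim_ultra_mono => //; apply: filterS2 (ultra_ge hU N) (ultra_ge hU 1) => n /= Nn n0.
have hnu := nu_microstates_le V (saYn n) (Ynr n).
apply: le_normalized_log => //; [exact: nu_ge0|exact: le_trans (nu_ge0 _) hnu|].
apply: le_trans (hN n Nn _ (saYn n) (Ynr n)) _.
by rewrite lee_wpmul2l// lee_fin expR_ge0.
Qed.

Lemma chi_U_le_cutoff U : nonprincipal_ultrafilter U ->
  (chi_U tau X B U <= chi_cutoff l r r')%E.
Proof.
move=> hU; apply: ge_ereal_sup => _ [iota hiota <-].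
have [Yn lY Ynr] := clamped_lift_ex hU hiota r'0 Yr.
rewrite (chi_embE hU hiota lY); apply: chi_lift_le_cutoff => // n j.
by have [h _ _] := lY j.
Qed.

Lemma limn_esup_gt (f : nat -> \bar R) c N : (c < limn_esup f)%E ->
  exists2 n, (N <= n)%N & (c < f n)%E.
Proof.
move=> h; have : (c < esups f N)%E.
  apply: lt_le_trans h _; rewrite limn_esup_lim; apply: lime_le; first exact: is_cvg_esups.
  by exists N => // n /= Nn; exact: nonincreasing_esups.
by move=> /ereal_sup_gt[_ [n /= Nn <-] h1]; exists n.
Qed.

Local Notation word := (seq ('I_m + nat)%type).

(** The words with codes below k. Together with the radius 1/(k+1) they give a decreasing sequence
    of neighborhoods that is a basis. *)
Definition word_prefix k : seq word := pmap choice.unpickle (iota 0 k).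

Definition law_base k := close_laws l [seq mon 1 w | w <- word_prefix k] k.+1%:R^-1.

Lemma law_base_nbhd k : law_nbhd l (law_base k).
Proof. by apply: close_laws_nbhd; [exact: law_is_law|rewrite invr_gt0]. Qed.

Lemma law_base_mono k k' : (k <= k')%N -> law_base k' `<=` law_base k.
Proof.
move=> kk' f [lf hf]; split=> // _ /mapP[w win ->].
apply: (@lt_le_trans _ _ k'.+1%:R^-1).
  apply: hf; apply: map_f; move: win; rewrite !mem_pmap => /mapP[i ik ->].
  by apply: map_f; move: ik; rewrite !mem_iota !add0n /= => /leq_trans; apply.
by rewrite lef_pV2 ?posrE// ler_nat.
Qed.

Lemma law_base_sub O : law_nbhd l O -> exists k, law_base k `<=` O.
Proof.
move=> /law_nbhd_words[ws [e [e0 hO]]].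
have [N hN] := invS_le e0.
have [k hk] : exists k, {subset ws <= word_prefix k}.
  exists (\max_(w <- ws) (choice.pickle w).+1) => w win; rewrite mem_pmap.
  rewrite -(choice.pickleK w); apply: map_f; rewrite mem_iota /= add0n.
  exact: (leq_bigmax_seq _ win).
exists (maxn N k); apply: subset_trans hO => f [lf hf]; split=> // _ /mapP[w win ->].
apply: lt_le_trans (hN _ (leq_maxl N k)).
apply: hf; apply: map_f; have := hk _ win; rewrite !mem_pmap => /mapP[i ik ->].
by apply: map_f; move: ik; rewrite !mem_iota !add0n /= => /leq_trans; apply; exact: leq_maxr.
Qed.

Definition good (c : R) n k := exists2 Z, microstates_snd (n := n) r' (law_base k) Z &
  (0 < n)%N /\ (c%:E < normalized_log m n (nu (microstates r Z (law_base k))))%E.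

Lemma good_mono c n k k' : (k <= k')%N -> good c n k' -> good c n k.
Proof.
move=> kk' [Z [saZ Zr [lam hlam Zlam]] [n0 hc]]; exists Z.
  split; [exact: saZ|exact: Zr|exists lam; last exact: Zlam].
  exact: (@law_base_mono _ _ kk' lam hlam).
split; first exact: n0.
apply: lt_le_trans hc _; apply: normalized_log_mono; [exact: n0|exact: nu_ge0|].
apply: le_nu => A [h1 h2 h3]; split; [exact: h1|exact: h2|].
exact: (@law_base_mono _ _ kk' _ h3).
Qed.

Lemma good_unbounded c k N : (c%:E < chi_cutoff l r r')%E -> exists2 n, (N <= n)%N & good c n k.
Proof.
move=> hc; have : (c%:E < limn_esup (fun n => normalized_log m n
    (sup_nu n r r' (law_base k))))%E.
  apply: lt_le_trans hc _; apply: ereal_inf_lbound; exists (law_base k); last reflexivity.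
  exact: law_base_nbhd.
move=> /(limn_esup_gt (maxn N 1))[n]; rewrite geq_max => /andP[Nn n0] h; exists n => //.
have s0 : (0 <= sup_nu n r r' (law_base k))%E by apply: ereal_sup_ubound; left.
move: h; rewrite normalized_log_gt// => /ereal_sup_gt[_ [->|[Z hZ <-]]].
  by rewrite lte_fin ltNge expR_ge0.
move=> h; exists Z; first exact: hZ.
by split; [exact: n0|rewrite normalized_log_gt ?nu_ge0].
Qed.

(** The sets G are nonempty by [good_unbounded] and directed by [good_mono]. Their second index
    pushes n to infinity, so an ultrafilter containing them is nonprincipal. *)
Lemma good_ultrafilter c : (c%:E < chi_cutoff l r r')%E ->
  exists2 U, nonprincipal_ultrafilter U & forall k, U [set n | good c n k].
Proof.
move=> hc; pose G (kN : nat * nat) := [set n | good c n kN.1 /\ (kN.2 <= n)%N].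
have FF : ProperFilter (filter_from setT G).
  apply: filter_from_proper => [|[k N] _].
    apply: filter_from_filter; first by exists (0, 0)%N.
    move=> [k1 N1] [k2 N2] _ _; exists (maxn k1 k2, maxn N1 N2) => // n [/= h1].
    rewrite geq_max => /andP[h2 h3]; split; split=> //=; apply: good_mono h1.
      exact: leq_maxl.
    exact: leq_maxr.
  by have [n Nn gn] := good_unbounded k N hc; exists n.
have [U [UU FU]] := ultraFilterLemma FF.
have UG k N : U (G (k, N)) by apply: FU; exists (k, N).
pose instU : ProperFilter U := @ultra_proper _ _ UU.
exists U; first split=> // k Uk.
  have [n [/= -> [_ /=]]] := filter_ex (filterI Uk (UG 0%N k.+1)).
  by rewrite ltnn.
by move=> k; apply: filterS (UG k 0%N) => n [].
Qed.

Lemma cutoff_le_chi_U c : (c%:E < chi_cutoff l r r')%E ->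
  exists2 U, nonprincipal_ultrafilter U & (c%:E <= chi_U tau X B U)%E.
Proof.
move=> /good_ultrafilter[U hU Ug]; exists U => //.
pose instU : ProperFilter U := ultra_pf hU.
have [kappa hkappa] := diagonal hU Ug.
(* The default 0 is used off a set of U and keeps the lift self-adjoint and bounded for all n. *)
pose Yn n : nat -> 'M[C]_n :=
  if pselect (good c n (kappa n)) is left h then projT1 (cid2 h) else fun _ => 0.
have YnP n : good c n (kappa n) -> [/\ microstates_snd r' (law_base (kappa n)) (Yn n),
    (0 < n)%N & (c%:E < normalized_log m n (nu (microstates r (Yn n) (law_base (kappa n)))))%E].
  rewrite /Yn; case: pselect => // h _.
  by case: cid2 => Z hZ [h1 h2].
have saYn n j : samx (Yn n j).
  have [/YnP[[h _ _] _ _]|h] := pselect (good c n (kappa n)); first exact: h.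
  rewrite /Yn; case: pselect => // _; apply/matrixP => i i'.
  by rewrite adjmxE !mxE [LHS]conjc0.
have Ynr n j : mx_opnorm_le (Yn n j) (r' j).
  have [/YnP[[_ h _] _ _]|h] := pselect (good c n (kappa n)); first exact: h.
  rewrite /Yn; case: pselect => // _; apply/mx_opnormP; split; first exact: ltW.
  by move=> v; rewrite mul0mx /cnorm (snorm0 (cdot_sdot R n)) mulr_ge0 ?snorm_ge0// ltW.
have law_cv p e : 0 < e -> U [set n | normc (mx_law (Yn n) p - op_law tau Y p) <= e].
  (* The law of Yn n is known only as the restriction of some law near l, so p is tested through its
     image in the polynomials in x and y. *)
  move=> e0; have [k hk] := law_base_sub (close_laws_nbhd [:: ncsnd R 'I_m nat p] law_is_law e0).
  apply: filterS (hkappa k) => n /= [kn /YnP[[_ _ [lam hlam lamY]] _ _]].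
  have [_ /(_ (ncsnd R 'I_m nat p))] := hk _ (@law_base_mono _ _ kn _ hlam).
  rewrite mem_head -law_sndE lamY => /(_ isT) h; apply: le_trans (ltW h).
  rewrite le_eqVlt (_ : l _ = op_law tau Y p) ?eqxx//.
  by rewrite !op_lawE; congr tau; apply/funext => v; rewrite ev_ncsnd.
have r'0' j : 0 <= r' j by exact: ltW.
have hiota := rep_iota_embedding hM MY saY r'0' Yr hU saYn Ynr law_cv.
have lY := rep_iota_lift hM MY saY hU saYn Ynr law_cv.
apply: le_trans (_ : (chi_emb tau X B U (rep_iota tau Y U Yn) <= _)%E); last first.
  by apply: ereal_sup_ubound; exists (rep_iota tau Y U Yn).
(* In the supremum over cutoffs Q the choice Q = r suffices. *)
rewrite (chi_embE hU hiota lY); apply: le_trans; last by apply: ereal_sup_ubound; exists r.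
apply: le_ereal_inf_tmp => _ [V hV <-]; have [k hk] := law_base_sub hV.
apply: lim_ultra_ge => //; apply: filterS (hkappa k) => n /= [kn /YnP[_ n0 h]].
apply: le_trans (ltW h) _; apply: normalized_log_mono; [exact: n0|exact: nu_ge0|].
apply: le_nu => A [h1 h2 h3]; split; [exact: h1|exact: h2|].
by apply: hk; exact: (@law_base_mono _ _ kn _ h3).
Qed.

Lemma chi_cutoffE : chi_cutoff l r r' =
  ereal_sup [set chi_U tau X B U | U in @nonprincipal_ultrafilter].
Proof.
apply/eqP; rewrite eq_le; apply/andP; split; last first.
  by apply: ge_ereal_sup => _ [U hU <-]; exact: chi_U_le_cutoff.
rewrite leNgt; apply/negP => h.
have [c h1 h2] : exists2 c : R, (ereal_sup [set chi_U tau X B U | U in @nonprincipal_ultrafilter]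
    < c%:E)%E & (c%:E < chi_cutoff l r r')%E.
  move: h; case: (chi_cutoff _ _ _) => [b| |]; case: (ereal_sup _) => [a| |] //=.
  - by rewrite lte_fin => ab; exists ((a + b) / 2); rewrite lte_fin; lra.
  - by move=> _; exists (b - 1); rewrite ?ltNyr// lte_fin; lra.
  - by move=> _; exists (a + 1); rewrite ?ltry// lte_fin; lra.
  - by move=> _; exists 0; rewrite ?ltNyr ?ltry.
have [U hU hc] := cutoff_le_chi_U h2.
have hs : (chi_U tau X B U <= ereal_sup [set chi_U tau X B U | U in @nonprincipal_ultrafilter])%E.
  by apply: ereal_sup_ubound; exists U.
by have := le_lt_trans (le_trans hc hs) h1; rewrite ltxx.
Qed.

End EntropyOfEmbeddings.

Theorem lemma4p9 (R : realType) (H : hilbert R) (M : set (H -> H))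
    (tau : (H -> H) -> R[i]) (hM : tracial_vna M tau)
    (m : nat) (X : 'I_m -> H -> H) (Y : nat -> H -> H)
    (hX : forall j, M (X j) /\ sa_op (X j))
    (hY : forall j, M (Y j) /\ sa_op (Y j))
    (r : 'I_m -> R) (r' : nat -> R)
    (hr : forall j, 0 < r j) (hr' : forall j, 0 < r' j)
    (hXr : forall j, opnorm_le (X j) (r j))
    (hYr : forall j, opnorm_le (Y j) (r' j)) :
  let B := Wstar Y in
  [/\ chi_bar tau X Y = chi_bar_cutoff tau X Y r r',
      chi_bar_cutoff tau X Y r r' =
        ereal_sup [set chi_U tau X B U | U in @nonprincipal_ultrafilter]
    & ereal_sup [set chi_U tau X B U | U in @nonprincipal_ultrafilter] =
        ereal_sup [set ereal_sup [set chi_emb tau X B U iota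
                                 | iota in embedding U tau B]
                  | U in @nonprincipal_ultrafilter]].
Proof.
(* The right-hand side does not mention rr, so all admissible cutoffs give the same value. *)
have E rr : norm_bounds X Y rr.1 rr.2 -> chi_bar_cutoff tau X Y rr.1 rr.2 =
    ereal_sup [set chi_U tau X (Wstar Y) U | U in @nonprincipal_ultrafilter].
  by move=> hrr; exact: (chi_cutoffE hM hX hY hrr).
have hrr : norm_bounds X Y (r, r').1 (r, r').2 by split.
split; [|exact: (E (r, r'))|reflexivity].
rewrite (E (r, r') hrr) /chi_bar; apply/eqP; rewrite eq_le; apply/andP; split.
  by apply: ge_ereal_sup => _ [rr hrr' <-]; rewrite (E rr hrr').
by rewrite -(E (r, r') hrr); apply: ereal_sup_ubound; exists (r, r').
Qed.
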